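(* Suppose that $b\in[0,1)$. Then for every fixed pair $(\tau,c)\in\mathfrak{D}$ the equation $$\partial_t\big(u(t,x)-bu(t-\tau,x)\big)=\partial_{xx}\big(u(t,x)-bu(t-\tau,x)\big)+u(t,x)\big(1-u(t-\tau,x)\big)$$ has a unique (up to translation) monotone traveling front $u(t,x)=\phi(x+ct)$.
   Context: A monotone traveling front with speed $c$ is a solution $u(t,x)=\phi(x+ct)$ whose profile $\phi$ is monotone on $\mathbb{R}$, such that $v(t):=\phi(t)-b\phi(t-c\tau)$ is $C^2$-smooth on $\mathbb{R}$ and $$v''(t)-cv'(t)+\phi(t)(1-\phi(t-c\tau))=0,\ t\in\mathbb{R},\quad \phi(-\infty)=0,\ \phi(+\infty)=1.$$ Set $$\chi_0(z)=z^2-cz+\frac{1}{1-be^{-zc\tau}},\qquad \chi_1(z)=z^2-cz-\frac{e^{-zc\tau}}{1-be^{-zc\tau}},$$ $$\mathfrak{D}=\{(\tau,c)\in\mathbb{R}_+^2:\ \chi_0(z)\text{ has positive zeros and }\chi_1(z)\text{ has negative zeros}\}$$ (positive and negative zeros are real zeros). ''Unique up to translation'' means that any two such profiles $\phi,\psi$ satisfy $\psi(t)=\phi(t+s)$ for all $t$, for some constant $s\in\mathbb{R}$. *)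

(* Defs.v *)
From Stdlib Require Import Reals.
From Coquelicot Require Import Coquelicot.
Open Scope R_scope.

(* [ex_derive_n v 2] alone only says that [Derive v] is differentiable, not [v]:
   hence the quantification over [k <= 2]. *)
Definition C2_smooth (v : R -> R) : Prop :=
  (forall (k : nat) (t : R), (k <= 2)%nat -> ex_derive_n v k t) /\
  (forall t : R, continuous (Derive_n v 2) t).

Definition monotone (f : R -> R) : Prop :=
  (forall x y : R, x <= y -> f x <= f y) \/
  (forall x y : R, x <= y -> f y <= f x).

Definition neutral_part (b tau : R) (u : R -> R -> R) (t x : R) : R :=
  u t x - b * u (t - tau) x.

(* Classical solution on R x R; only the neutral combination w is required to be
   differentiable, not u itself. *)
Definition neutral_KPP_solution (b tau : R) (u : R -> R -> R) : Prop :=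
  let w := neutral_part b tau u in
  forall t x : R,
    ex_derive (fun s => w s x) t /\
    ex_derive (w t) x /\
    ex_derive_n (w t) 2 x /\
    Derive (fun s => w s x) t
      = Derive_n (w t) 2 x + u t x * (1 - u (t - tau) x).

Definition monotone_front (b tau c : R) (phi : R -> R) : Prop :=
  let v := fun t => phi t - b * phi (t - c * tau) in
  neutral_KPP_solution b tau (fun t x => phi (x + c * t)) /\
  monotone phi /\
  C2_smooth v /\
  (forall t : R,
     Derive_n v 2 t - c * Derive v t + phi t * (1 - phi (t - c * tau)) = 0) /\
  is_lim phi m_infty 0 /\
  is_lim phi p_infty 1.

Definition chi_den (b tau c z : R) : R := 1 - b * exp (- z * c * tau).

Definition chi0 (b tau c z : R) : R :=
  z ^ 2 - c * z + 1 / chi_den b tau c z.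

Definition chi1 (b tau c z : R) : R :=
  z ^ 2 - c * z - exp (- z * c * tau) / chi_den b tau c z.

(* Division is total, so poles are excluded explicitly.
   R_+ is taken to be [0, +oo), so tau = 0 is allowed. *)
Definition frakD (b tau c : R) : Prop :=
  0 <= tau /\ 0 <= c /\
  (exists z : R, 0 < z /\ chi_den b tau c z <> 0 /\ chi0 b tau c z = 0) /\
  (exists z : R, z < 0 /\ chi_den b tau c z <> 0 /\ chi1 b tau c z = 0).

(* Main.v *)
Require Import Defs.
From Stdlib Require Import Reals Lra Lia.
From Coquelicot Require Import Coquelicot.
Open Scope R_scope.

(** Write [h = c tau], let [f_h] be the translate [f (. - h)], let [z1] be the given
    negative zero of [chi1], and put [a = - z1], [zeta = a + c], [beta = a zeta]. The
    quadratic [z^2 - c z - beta] has the roots [z1] and [zeta], so for bounded profiles the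
    equation is equivalent to the system
<<
      phi' = J - a phi,    J' = zeta J - g,
      g - b g_h = beta (phi - b phi_h) + phi (1 - phi_h).
>>
    Reading it cyclically gives a map [J |-> phi |-> g |-> next J] whose fixed points are
    the profiles.

    The reaction decreases in [phi_h], so it is not monotone for the pointwise order. It is
    monotone for a finer one, in which [psi] dominates [phi] when [exp (a t) (psi - phi)] is
    nondecreasing: then [(psi - phi)_h <= exp (a h) (psi - phi)], and [chi1 z1 = 0] says
    precisely that the instantaneous gain [beta] covers this worst case ([reaction_gain]).
    In terms of [J] this order is the pointwise one, because
    [(exp (a t) phi)' = exp (a t) J]; hence [next] is monotone ([step_le]). It commutes with
    translations, so it also preserves monotonicity in [t].

    Existence. Among the positive zeros of [chi0] there is one, [p], at which [chi0] does
    not increase ([leading_root]). On [t <= 0] the exact solutions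
    [(A - B t) exp (p t)] of the linearization at [0], with [B = 0] unless [p] is a double
    zero, continued by [J = a] for [t >= 0], start a decreasing iteration
    ([upper_barrier]); a perturbation by [exp ((p + eps) t)] stays below all iterates
    ([lower_barrier]). The limit is an increasing fixed point, and its limits at both ends
    are equilibria, because translates converge to constant fixed points
    ([fixed_point_limits]). The lower barrier excludes [phi = 0] and the upper one
    [phi = 1], so the equilibria are [0] and [1].

    Uniqueness. Let [w = exp (- p t) phi]. Since [chi0 p = 0], the equation multiplied by
    [exp (- p t)] is a conservation law [flux' = w phi_h >= 0]. The flux tends to [0] at
    [+oo], and to a limit [- C] at [-oo], which is finite and negative
    ([leading_exists]); translating a front by [s] multiplies [C] by [exp (p s)]. The number
    [C] plays the role of the leading coefficient at [-oo], but no asymptotic expansion is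
    needed. Given two fronts with [C_phi <= C_psi], take the largest [theta <= 1] with
    [theta J_phi <= J_psi]. If [theta < 1], concavity of the reaction gives room on every
    half-line [t >= T], while the flux of [d = psi - theta phi] is bounded away from [0]
    near [-oo], which forces [d] to be at least of the size of [phi] there
    ([energy_envelope]); so [theta] could be enlarged ([improve_multiple]). Hence
    [C_phi <= C_psi] implies [phi <= psi], and fronts translated to equal [C] coincide. *)

(** * Calculus on the line *)

Lemma is_derive_rewrite (f : R -> R) (t l l' : R) :
  is_derive f t l' -> l' = l -> is_derive f t l.
Proof. now intros H <-. Qed.

Lemma is_derive_add (f g : R -> R) (t l m : R) :
  is_derive f t l -> is_derive g t m -> is_derive (fun u => f u + g u) t (l + m).
Proof. exact (is_derive_plus f g t l m). Qed.

Lemma is_derive_sub (f g : R -> R) (t l m : R) :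
  is_derive f t l -> is_derive g t m -> is_derive (fun u => f u - g u) t (l - m).
Proof. exact (is_derive_minus f g t l m). Qed.

Lemma is_derive_mul (f g : R -> R) (t l m : R) :
  is_derive f t l -> is_derive g t m ->
  is_derive (fun u => f u * g u) t (l * g t + f t * m).
Proof. intros Hf Hg. apply (is_derive_mult f g t l m Hf Hg). intros; apply Rmult_comm. Qed.

Lemma is_derive_neg (f : R -> R) (t l : R) :
  is_derive f t l -> is_derive (fun u => - f u) t (- l).
Proof. exact (is_derive_opp f t l). Qed.

Lemma is_derive_cst (k t : R) : is_derive (fun _ => k) t 0.
Proof. exact (is_derive_const k t). Qed.

Lemma is_derive_var (t : R) : is_derive (fun u => u) t 1.
Proof. exact (is_derive_id t). Qed.

Lemma is_derive_exp_lin (k t : R) :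
  is_derive (fun u => exp (k * u)) t (k * exp (k * t)).
Proof. auto_derive; [easy | ring]. Qed.

Lemma is_derive_exp_centered (k s t : R) :
  is_derive (fun u => exp (k * (u - s))) t (k * exp (k * (t - s))).
Proof. auto_derive; [easy |]. unfold Rminus. ring. Qed.

Lemma is_derive_affine (f : R -> R) (a s t l : R) :
  is_derive f (a * t + s) l -> is_derive (fun u => f (a * u + s)) t (a * l).
Proof.
intros H.
assert (Hl : is_derive (fun u => a * u + s) t a) by (auto_derive; [easy | ring]).
exact (is_derive_comp f (fun u => a * u + s) t l a H Hl).
Qed.

Lemma is_derive_shift (f : R -> R) (s t l : R) :
  is_derive f (t + s) l -> is_derive (fun u => f (u + s)) t l.
Proof.
intros H. apply (is_derive_ext (fun u => f (1 * u + s))).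
- intros u. now rewrite Rmult_1_l.
- rewrite <- (Rmult_1_l l). apply is_derive_affine. now rewrite Rmult_1_l.
Qed.

Lemma is_derive_delay (f : R -> R) (h t l : R) :
  is_derive f (t - h) l -> is_derive (fun u => f (u - h)) t l.
Proof. exact (is_derive_shift f (- h) t l). Qed.

(** The hypotheses come last: matching them compares functions up to conversion, which
    may try to unfold [exp]. *)
Ltac derive :=
  repeat
    match goal with
      | |- is_derive (fun _ => ?k) _ _ => apply is_derive_cst
      | |- is_derive (fun u => u) _ _ => apply is_derive_var
      | |- is_derive (fun u => exp (_ * u)) _ _ => apply is_derive_exp_lin
      | |- is_derive (fun u => exp (_ * (u - _))) _ _ => apply is_derive_exp_centered
      | |- is_derive (fun u => _ + _) _ _ => apply is_derive_add
      | |- is_derive (fun u => _ - _) _ _ => apply is_derive_sub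
      | |- is_derive (fun u => - _) _ _ => apply is_derive_neg
      | |- is_derive (fun u => _ * _) _ _ => apply is_derive_mul
      | |- is_derive (fun u => ?f (u - _)) _ _ => apply (is_derive_delay f)
      | |- is_derive (fun u => ?f (u + _)) _ _ => apply (is_derive_shift f)
      | H : is_derive ?f _ _ |- is_derive ?f _ _ => exact H
      | H : forall _, is_derive ?f _ _ |- is_derive ?f _ _ => apply H
      end.

Lemma is_derive_cont (f : R -> R) (t l : R) : is_derive f t l -> continuous f t.
Proof. intros H. apply (ex_derive_continuous f). now exists l. Qed.

Lemma mean_value (f f' : R -> R) (s t : R) :
  s <= t -> (forall u, s <= u <= t -> is_derive f u (f' u)) ->
  exists xi, s <= xi <= t /\ f t - f s = f' xi * (t - s).
Proof.
intros Hst Hd.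
destruct (MVT_gen f s t f') as [xi [Hxi He]].
- intros u. rewrite Rmin_left, Rmax_right by easy. intros Hu. apply Hd. lra.
- intros u. rewrite Rmin_left, Rmax_right by easy. intros Hu.
  apply continuity_pt_filterlim. exact (is_derive_cont f u _ (Hd u Hu)).
- rewrite Rmin_left, Rmax_right in Hxi by easy. now exists xi.
Qed.

Lemma derive_nonneg_incr (f f' : R -> R) (s t : R) :
  s <= t -> (forall u, s <= u <= t -> is_derive f u (f' u)) ->
  (forall u, s <= u <= t -> 0 <= f' u) -> f s <= f t.
Proof.
intros Hst Hd Hp. destruct (mean_value f f' s t Hst Hd) as [xi [Hxi He]].
specialize (Hp xi Hxi). nra.
Qed.

(** Multiplication by the integrating factor turns every differential
    inequality met below into monotonicity; this is the only comparison
    principle for ordinary differential equations that is used. *)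
Lemma exp_growth (f f' : R -> R) (k s t : R) :
  s <= t -> (forall u, s <= u <= t -> is_derive f u (f' u)) ->
  (forall u, s <= u <= t -> k * f u <= f' u) ->
  f s * exp (k * (t - s)) <= f t.
Proof.
intros Hst Hd Hk.
assert (H : f s * exp (- k * (s - s)) <= f t * exp (- k * (t - s))).
{ apply (derive_nonneg_incr (fun u => f u * exp (- k * (u - s)))
    (fun u => (f' u - k * f u) * exp (- k * (u - s)))); [easy | |].
  - intros u Hu. specialize (Hd u Hu).
    eapply is_derive_rewrite; [derive | cbv beta; ring].
  - intros u Hu. specialize (Hk u Hu).
    apply Rmult_le_pos; [lra | left; apply exp_pos]. }
replace (- k * (s - s)) with 0 in H by ring. rewrite exp_0, Rmult_1_r in H.
replace (f t) with (f t * exp (- k * (t - s)) * exp (k * (t - s))).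
- apply Rmult_le_compat_r; [left; apply exp_pos | exact H].
- rewrite Rmult_assoc, <- exp_plus.
  replace (- k * (t - s) + k * (t - s)) with 0 by ring. rewrite exp_0; ring.
Qed.

Lemma exp_decay_below (k eps : R) : 0 < k -> 0 < eps ->
  exists L, 0 <= L /\ forall x, L <= x -> exp (- k * x) < eps.
Proof.
intros Hk He. exists (Rmax 0 (/ (k * eps))). split; [apply Rmax_l |].
intros x Hx.
assert (H0 : / (k * eps) <= x) by (eapply Rle_trans; [apply Rmax_r | exact Hx]).
assert (Hke : 0 < k * eps) by nra.
assert (Hx0 : 0 < x) by (pose proof (Rinv_0_lt_compat _ Hke); lra).
assert (H1 : 1 <= k * eps * x).
{ rewrite <- (Rinv_r (k * eps)) by lra. apply Rmult_le_compat_l; lra. }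
assert (Hkx : 0 < k * x) by nra.
assert (H2 : 1 + k * x < exp (k * x)) by (apply exp_ineq1; lra).
replace (- k * x) with (- (k * x)) by ring. rewrite exp_Ropp.
apply (Rmult_lt_reg_r (exp (k * x))); [apply exp_pos |].
rewrite Rinv_l by (pose proof (exp_pos (k * x)); lra). nra.
Qed.

(** Backwards in time a solution of [D' = z D] dies out, so a lower bound at
    infinity replaces an initial condition. *)
Lemma backward_nonneg (D D' : R -> R) (z T M : R) : 0 < z ->
  (forall u, T <= u -> is_derive D u (D' u)) ->
  (forall u, T <= u -> D' u <= z * D u) ->
  (forall u, T <= u -> - M <= D u) ->
  forall t, T <= t -> 0 <= D t.
Proof.
intros Hz Hd Hi Hb t Ht.
destruct (Rle_or_lt 0 (D t)) as [H | H]; [easy | exfalso].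
destruct (exp_decay_below z (- D t / (Rabs M + 1)) Hz) as [L [HL0 HL]].
{ apply Rdiv_lt_0_compat; [lra | pose proof (Rabs_pos M); lra]. }
specialize (HL L (Rle_refl _)).
assert (HG : - D t * exp (z * (t + L - t)) <= - D (t + L)).
{ apply (exp_growth (fun u => - D u) (fun u => - D' u)); [lra | |].
  - intros u Hu. apply is_derive_neg, Hd. lra.
  - intros u Hu. specialize (Hi u ltac:(lra)). lra. }
specialize (Hb (t + L) ltac:(lra)).
replace (t + L - t) with L in HG by ring.
replace (- z * L) with (- (z * L)) in HL by ring. rewrite exp_Ropp in HL.
pose proof (exp_pos (z * L)) as HE. pose proof (Rle_abs M) as HM.
pose proof (Rabs_pos M) as HM0.
apply (Rmult_lt_compat_r (exp (z * L))) in HL; [| easy].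
rewrite Rinv_l in HL by lra.
assert (Rabs M + 1 < - D t * exp (z * L)); [| lra].
apply (Rmult_lt_compat_r (Rabs M + 1)) in HL; [| lra].
unfold Rdiv in HL.
replace (- D t * / (Rabs M + 1) * exp (z * L) * (Rabs M + 1)) with
  (- D t * exp (z * L)) in HL by (field; lra). lra.
Qed.

Lemma backward_nonneg_left (D D' : R -> R) (z T : R) :
  (forall u, u <= T -> is_derive D u (D' u)) ->
  (forall u, u <= T -> D' u <= z * D u) ->
  0 <= D T -> forall t, t <= T -> 0 <= D t.
Proof.
intros Hd Hi HT t Ht.
assert (HG : - D t * exp (z * (T - t)) <= - D T).
{ apply (exp_growth (fun u => - D u) (fun u => - D' u)); [lra | |].
  - intros u Hu. apply is_derive_neg, Hd. lra.
  - intros u Hu. specialize (Hi u ltac:(lra)). lra. }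
pose proof (exp_pos (z * (T - t))) as HE. nra.
Qed.

Lemma forward_nonneg (f f' : R -> R) (a T M : R) : 0 < a ->
  (forall u, u <= T -> is_derive f u (f' u)) ->
  (forall u, u <= T -> - a * f u <= f' u) ->
  (forall u, u <= T -> - M <= f u) ->
  forall t, t <= T -> 0 <= f t.
Proof.
intros Ha Hd Hi Hb t Ht.
rewrite <- (Ropp_involutive t).
apply (backward_nonneg (fun u => f (- u)) (fun u => - f' (- u)) a (- T) M Ha).
- intros u Hu. apply (is_derive_ext (fun u => f (-1 * u + 0))).
  + intros v. now replace (-1 * v + 0) with (- v) by ring.
  + eapply is_derive_rewrite.
    * apply is_derive_affine. replace (-1 * u + 0) with (- u) by ring. apply Hd; lra.
    * ring.
- intros u Hu. specialize (Hi (- u) ltac:(lra)). lra.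
- intros u Hu. apply Hb; lra.
- lra.
Qed.

Lemma is_derive_of_quadratic (f : R -> R) (t d L : R) :
  (forall s, Rabs (f (t + s) - f t - s * d) <= L * (s * s)) -> is_derive f t d.
Proof.
intros H. apply is_derive_Reals. intros eps He.
assert (HL : 0 < Rabs L + 1) by (pose proof (Rabs_pos L); lra).
assert (Hd : 0 < eps / (Rabs L + 1)) by now apply Rdiv_lt_0_compat.
exists (mkposreal _ Hd). simpl. intros s Hs0 Hs.
replace ((f (t + s) - f t) / s - d) with ((f (t + s) - f t - s * d) / s) by (field; easy).
unfold Rdiv. rewrite Rabs_mult, Rabs_inv.
assert (Hsp : 0 < Rabs s) by now apply Rabs_pos_lt.
apply (Rmult_lt_reg_r (Rabs s)); [easy |].
rewrite Rmult_assoc, Rinv_l, Rmult_1_r by lra.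
eapply Rle_lt_trans; [apply H |].
apply Rle_lt_trans with ((Rabs L + 1) * (Rabs s * Rabs s)).
- rewrite <- Rabs_mult, (Rabs_pos_eq (s * s)) by nra.
  pose proof (Rle_abs L). nra.
- rewrite <- Rmult_assoc. apply Rmult_lt_compat_r; [easy |].
  apply (Rmult_lt_compat_l (Rabs L + 1)) in Hs; [| easy].
  unfold Rdiv in Hs. rewrite <- Rmult_assoc in Hs.
  replace ((Rabs L + 1) * eps * / (Rabs L + 1)) with eps in Hs by (field; lra). lra.
Qed.

Lemma quadratic_of_lipschitz_derive (f d : R -> R) (L t s : R) :
  (forall u, is_derive f u (d u)) ->
  (forall u v, Rabs (d u - d v) <= L * Rabs (u - v)) ->
  Rabs (f (t + s) - f t - s * d t) <= L * (s * s).
Proof.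
intros Hd HL.
assert (HL0 : 0 <= L).
{ specialize (HL 1 0). replace (1 - 0) with 1 in HL by ring. rewrite Rabs_R1 in HL.
  pose proof (Rabs_pos (d 1 - d 0)). lra. }
assert (Hx : exists xi, Rabs (xi - t) <= Rabs s /\ f (t + s) - f t = d xi * s).
{ destruct (Rle_or_lt 0 s) as [Hs | Hs].
  - destruct (mean_value f d t (t + s)) as [xi [Hxi He]]; [lra | intros; apply Hd |].
    exists xi. rewrite (Rabs_pos_eq (xi - t)), (Rabs_pos_eq s), He by lra.
    split; [lra | ring].
  - destruct (mean_value f d (t + s) t) as [xi [Hxi He]]; [lra | intros; apply Hd |].
    exists xi. rewrite (Rabs_left1 (xi - t)), (Rabs_left1 s) by lra.
    split; [lra |].
    transitivity (- (f t - f (t + s))); [ring | rewrite He; ring]. }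
destruct Hx as [xi [Hxi ->]].
replace (d xi * s - s * d t) with (s * (d xi - d t)) by ring.
rewrite Rabs_mult.
replace (s * s) with (Rabs s * Rabs s)
  by (rewrite <- Rabs_mult; apply Rabs_pos_eq; nra).
specialize (HL xi t). pose proof (Rabs_pos s).
replace (L * (Rabs s * Rabs s)) with (Rabs s * (L * Rabs s)) by ring.
apply Rmult_le_compat_l; [easy |]. eapply Rle_trans; [exact HL |].
now apply Rmult_le_compat_l.
Qed.

(** An equi-Lipschitz bound on the derivatives makes the first order Taylor
    estimate uniform in [n]; it then survives pointwise limits, which spares
    uniform convergence. *)
Lemma is_derive_pointwise_limit (f d : nat -> R -> R) (F D : R -> R) (L : R) :
  (forall n u, is_derive (f n) u (d n u)) ->
  (forall n u v, Rabs (d n u - d n v) <= L * Rabs (u - v)) ->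
  (forall u, is_lim_seq (fun n => f n u) (F u)) ->
  (forall u, is_lim_seq (fun n => d n u) (D u)) ->
  forall t, is_derive F t (D t).
Proof.
intros Hd HL HF HD t. apply (is_derive_of_quadratic F t (D t) L). intros s.
assert (HA : is_lim_seq (fun n => Rabs (f n (t + s) - f n t - s * d n t))
               (Rabs (F (t + s) - F t - s * D t))).
{ apply (is_lim_seq_abs _ (Finite (F (t + s) - F t - s * D t))).
  apply is_lim_seq_minus'; [apply is_lim_seq_minus'; apply HF |].
  apply (is_lim_seq_scal_l _ s (Finite (D t))), HD. }
exact (is_lim_seq_le _ _ (Finite _) (Finite _)
  (fun n => quadratic_of_lipschitz_derive (f n) (d n) L t s (Hd n) (HL n))
  HA (is_lim_seq_const _)).
Qed.

Lemma lipschitz_of_derive_bound (f d : R -> R) (L : R) :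
  (forall u, is_derive f u (d u)) -> (forall u, Rabs (d u) <= L) ->
  forall u v, Rabs (f u - f v) <= L * Rabs (u - v).
Proof.
intros Hd HL.
assert (H : forall u v, v <= u -> Rabs (f u - f v) <= L * Rabs (u - v)).
{ intros u v Huv. destruct (mean_value f d v u Huv) as [xi [_ ->]]; [intros; apply Hd |].
  rewrite Rabs_mult. apply Rmult_le_compat_r; [apply Rabs_pos | apply HL]. }
intros u v. destruct (Rle_or_lt v u) as [Huv | Huv]; [now apply H |].
rewrite (Rabs_minus_sym (f u)), (Rabs_minus_sym u). apply H; lra.
Qed.

Lemma decreasing_limit (u : nat -> R) (m : R) :
  (forall n, u (S n) <= u n) -> (forall n, m <= u n) ->
  is_lim_seq u (real (Lim_seq u)) /\ forall n, real (Lim_seq u) <= u n.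
Proof.
intros Hd Hm. destruct (ex_finite_lim_seq_decr u m Hd Hm) as [l Hl].
rewrite (is_lim_seq_unique _ _ Hl). split; [exact Hl |].
exact (is_lim_seq_decr_compare u l Hl Hd).
Qed.

Definition increasing_fun (f : R -> R) : Prop := forall s t, s <= t -> f s <= f t.

Lemma increasing_lim_p (f : R -> R) (M : R) :
  increasing_fun f -> (forall t, f t <= M) ->
  exists l, is_lim f p_infty (Finite l) /\ forall t, f t <= l.
Proof.
intros Hi HM.
destruct (completeness (fun y => exists t, y = f t)) as [l [Hub Hlub]].
- exists M. intros y [t ->]. apply HM.
- now exists (f 0), 0.
- exists l. assert (Hl : forall t, f t <= l) by (intros t; apply Hub; now exists t).
  split; [| easy]. apply is_lim_spec. intros eps.
  assert (Hex : exists t, l - eps < f t).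
  { destruct (Classical_Prop.classic (exists t, l - eps < f t)) as [E | E]; [easy |].
    exfalso. assert (l <= l - eps); [| destruct eps; simpl in *; lra].
    apply Hlub. intros y [t ->]. destruct (Rle_or_lt (f t) (l - eps)); [easy |].
    exfalso. apply E. now exists t. }
  destruct Hex as [t Ht]. exists t. intros x Hx.
  specialize (Hi t x (Rlt_le _ _ Hx)). specialize (Hl x).
  rewrite Rabs_left1; lra.
Qed.

Lemma increasing_lim_m (f : R -> R) (m : R) :
  increasing_fun f -> (forall t, m <= f t) ->
  exists l, is_lim f m_infty (Finite l) /\ forall t, l <= f t.
Proof.
intros Hi Hm.
destruct (increasing_lim_p (fun t => - f (- t)) (- m)) as [l [Hl Hle]].
- intros s t Hst. specialize (Hi (- t) (- s)). lra.
- intros t. specialize (Hm (- t)). lra.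
- exists (- l). split.
  + apply is_lim_spec. apply is_lim_spec in Hl. intros eps.
    destruct (Hl eps) as [T HT]. exists (- T). intros x Hx.
    specialize (HT (- x) ltac:(lra)). rewrite Ropp_involutive in HT.
    rewrite <- Rabs_Ropp. now replace (- (f x - - l)) with (- f x - l) by ring.
  + intros t. specialize (Hle (- t)). rewrite Ropp_involutive in Hle. lra.
Qed.

Lemma lim_seq_shift_p (f : R -> R) (l t : R) :
  is_lim f p_infty (Finite l) -> is_lim_seq (fun n => f (t + INR n)) l.
Proof.
intros Hf. apply (is_lim_comp_seq f (fun n => t + INR n) p_infty (Finite l) Hf).
- exists 0%nat. easy.
- apply (is_lim_seq_plus _ _ (Finite t) p_infty); [apply is_lim_seq_const | apply is_lim_seq_INR | easy].
Qed.

Lemma lim_seq_shift_m (f : R -> R) (l t : R) :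
  is_lim f m_infty (Finite l) -> is_lim_seq (fun n => f (t + - INR n)) l.
Proof.
intros Hf. apply (is_lim_comp_seq f (fun n => t + - INR n) m_infty (Finite l) Hf).
- exists 0%nat. easy.
- apply (is_lim_seq_plus _ _ (Finite t) m_infty); [apply is_lim_seq_const | | easy].
  apply (is_lim_seq_opp _ p_infty), is_lim_seq_INR.
Qed.

Lemma derive_neg_right (f : R -> R) (x l d : R) : is_derive f x l -> l < 0 -> 0 < d ->
  exists e, 0 < e < d /\ f (x + e) < f x.
Proof.
intros Hf Hl Hd. apply is_derive_Reals in Hf.
destruct (Hf (- l) ltac:(lra)) as [[d' Hd'] H]. simpl in H.
set (e := Rmin d d' / 2).
assert (He : 0 < e) by (unfold e; pose proof (Rmin_glb_lt d d' 0 Hd Hd'); lra).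
assert (Hed : e < d /\ e < d').
{ unfold e. pose proof (Rmin_l d d'). pose proof (Rmin_r d d').
  unfold e in He. lra. }
exists e. split; [lra |].
specialize (H e ltac:(lra)). rewrite Rabs_pos_eq in H by lra. specialize (H (proj2 Hed)).
apply Rabs_lt_between in H.
assert (H1 : (f (x + e) - f x) / e < 0) by lra.
apply (Rmult_lt_compat_r e) in H1; [| easy].
unfold Rdiv in H1. rewrite Rmult_assoc, Rinv_l in H1 by lra. lra.
Qed.

Lemma exp_nonpos_le_1 (k t : R) : 0 <= k -> t <= 0 -> exp (k * t) <= 1.
Proof.
intros Hk Ht. destruct (Req_dec (k * t) 0) as [-> | H]; [rewrite exp_0; lra |].
left. rewrite <- exp_0. apply exp_increasing. nra.
Qed.

Definition clip (t : R) : R := (t - Rabs t) / 2.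

Lemma clip_left (t : R) : t <= 0 -> clip t = t.
Proof. intros Ht. unfold clip. rewrite Rabs_left1 by easy. field. Qed.

Lemma clip_right (t : R) : 0 <= t -> clip t = 0.
Proof. intros Ht. unfold clip. rewrite Rabs_pos_eq by easy. field. Qed.

Lemma clip_continuous (t : R) : continuous clip t.
Proof.
unfold clip, Rdiv.
apply (continuous_mult (fun t => t - Rabs t) (fun _ => / 2)); [| apply continuous_const].
apply (continuous_minus (fun t => t) Rabs); [apply continuous_id | apply continuous_Rabs].
Qed.

(** * The delay operator [f |-> f - b f(. - h)] *)

(** Iterating [d >= b d(. - h)] into the past loses only [b ^ n] times the bound.
    Only the past of [t] is involved, whence the half-line version. *)
Lemma delay_nonneg (b h T M : R) (d : R -> R) : 0 <= b < 1 -> 0 <= h ->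
  (forall t, t <= T -> - M <= d t) ->
  (forall t, t <= T -> 0 <= d t - b * d (t - h)) ->
  forall t, t <= T -> 0 <= d t.
Proof.
intros Hb Hh HM Hd.
assert (Hn : forall n t, t <= T -> - (b ^ n * M) <= d t).
{ induction n as [| n IH]; intros t Ht; simpl.
  - specialize (HM t Ht). lra.
  - specialize (IH (t - h) ltac:(lra)). specialize (Hd t Ht). nra. }
intros t Ht.
assert (Hl : is_lim_seq (fun n => - (b ^ n * M)) (- (0 * M))).
{ apply (is_lim_seq_opp _ (Finite (0 * M))).
  apply (is_lim_seq_scal_r _ M (Finite 0)), is_lim_seq_geom.
  rewrite Rabs_pos_eq; lra. }
assert (HR := is_lim_seq_le _ _ (Finite _) (Finite _) (fun n => Hn n t Ht) Hl
  (is_lim_seq_const (d t))).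
simpl in HR. lra.
Qed.

Definition delay_inverse (b h : R) (f : R -> R) (t : R) : R :=
  Series (fun k => b ^ k * f (t - INR k * h)).

Lemma delay_inverse_spec (b h M : R) (f : R -> R) : 0 <= b < 1 ->
  (forall t, 0 <= f t <= M) ->
  (forall t, delay_inverse b h f t - b * delay_inverse b h f (t - h) = f t) /\
  (forall t, 0 <= delay_inverse b h f t <= M / (1 - b)).
Proof.
intros Hb Hf.
assert (Hg : is_series (fun k => b ^ k) (/ (1 - b)))
  by (apply is_series_geom; rewrite Rabs_pos_eq; lra).
assert (Hpow : forall k, 0 <= b ^ k) by (intros; now apply pow_le).
assert (HgM : is_series (fun k => b ^ k * M) (/ (1 - b) * M))
  by now apply is_series_scal_r.
assert (Hex : forall t, ex_series (fun k => b ^ k * f (t - INR k * h))).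
{ intros t. apply (ex_series_le (V := R_CompleteNormedModule) _ (fun k => b ^ k * M)); [| now eexists; exact HgM].
  intros k. unfold norm; simpl; unfold abs; simpl.
  specialize (Hpow k); specialize (Hf (t - INR k * h)).
  rewrite Rabs_pos_eq; nra. }
split; intros t; unfold delay_inverse.
- rewrite Series_incr_1 by apply Hex.
  rewrite <- Series_scal_l.
  rewrite (Series_ext (fun k => b ^ S k * f (t - INR (S k) * h))
    (fun k => b * (b ^ k * f (t - h - INR k * h)))).
  + simpl. replace (t - 0 * h) with t by ring. ring.
  + intros k. rewrite S_INR. simpl. replace (t - (INR k + 1) * h) with (t - h - INR k * h)
      by ring. ring.
- split.
  + rewrite <- (Rmult_0_l (Series (fun k : nat => b ^ k * M))).
    rewrite <- Series_scal_l. apply Series_le; [| apply Hex].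
    intros k. specialize (Hpow k); specialize (Hf (t - INR k * h)). nra.
  + replace (M / (1 - b)) with (/ (1 - b) * M) by (field; lra).
    rewrite <- (is_series_unique _ _ HgM).
    apply Series_le; [| now eexists; exact HgM].
    intros k. specialize (Hpow k); specialize (Hf (t - INR k * h)). nra.
Qed.

(** Unfolding the relation [n] times exhibits [g] as a uniform limit of continuous
    functions. *)
Lemma delay_continuous (b h M : R) (f g : R -> R) : 0 <= b < 1 ->
  (forall t, Rabs (g t) <= M) -> (forall t, g t - b * g (t - h) = f t) ->
  (forall t, continuous f t) -> forall t, continuous g t.
Proof.
intros Hb HM Hg Hf t.
assert (HS : forall n, exists S : R -> R, (forall u, continuous S u) /\
  forall u, Rabs (g u - S u) <= b ^ n * M).
{ induction n as [| n [S [HSc HS]]].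
  - exists (fun _ => 0). split; [intros u; apply continuous_const |].
    intros u. rewrite Rminus_0_r. simpl. rewrite Rmult_1_l. apply HM.
  - exists (fun u => f u + b * S (u - h)). split.
    + intros u. apply (continuous_plus f (fun u => b * S (u - h))); [apply Hf |].
      apply (continuous_mult (fun _ => b) (fun u => S (u - h))); [apply continuous_const |].
      apply (continuous_comp (fun u => u - h) S); [| apply HSc].
      apply (continuous_minus (fun u => u) (fun _ => h));
        [apply continuous_id | apply continuous_const].
    + intros u. replace (g u - (f u + b * S (u - h))) with (b * (g (u - h) - S (u - h)))
        by (rewrite <- Hg; ring).
      rewrite Rabs_mult, (Rabs_pos_eq b) by lra. simpl. rewrite Rmult_assoc.
      apply Rmult_le_compat_l; [lra | apply HS]. }
apply (continuity_pt_filterlim g t). intros eps He.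
assert (HM0 : 0 <= M) by (pose proof (HM 0); pose proof (Rabs_pos (g 0)); lra).
destruct (pow_lt_1_zero b ltac:(rewrite Rabs_pos_eq; lra) (eps / (3 * (M + 1)))) as [n Hn].
{ apply Rdiv_lt_0_compat; lra. }
specialize (Hn n (le_n n)). rewrite Rabs_pos_eq in Hn by (apply pow_le; lra).
destruct (HS n) as [S [HSc HSn]].
assert (Hsmall : b ^ n * M < eps / 3).
{ apply (Rmult_lt_compat_r (M + 1)) in Hn; [| lra].
  replace (eps / (3 * (M + 1)) * (M + 1)) with (eps / 3) in Hn by (field; lra).
  assert (0 <= b ^ n) by (apply pow_le; lra). nra. }
destruct (proj2 (continuity_pt_filterlim S t) (HSc t) (eps / 3) ltac:(lra)) as [d [Hd0 Hd]].
exists d. split; [easy |]. intros x Hx. specialize (Hd x Hx).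
unfold dist in *; simpl in *; unfold Rdist in *.
pose proof (HSn x) as H1. pose proof (HSn t) as H2.
rewrite Rabs_minus_sym in H2.
replace (g x - g t) with ((g x - S x) + (S x - S t) + (S t - g t)) by ring.
eapply Rle_lt_trans; [apply Rabs_triang |].
assert (H3 := Rabs_triang (g x - S x) (S x - S t)). lra.
Qed.

(** * Bounded solutions of first order linear equations *)

(** The solution of [J' = z J - g] that is bounded at [+oo]; the limit over the integers is
    the integral up to [+oo]. *)
Definition backward_resolvent (z : R) (g : R -> R) (t : R) : R :=
  exp (z * t) *
  (real (Lim_seq (fun n => RInt (fun r => exp (- z * r) * g r) 0 (INR n)))
   - RInt (fun r => exp (- z * r) * g r) 0 t).

Lemma is_derive_primitive (f : R -> R) :
  (forall t, continuous f t) -> forall t, is_derive (fun x => RInt f 0 x) t (f t).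
Proof.
intros Hf t. apply (is_derive_RInt f (fun x => RInt f 0 x) 0 t); [| apply Hf].
apply filter_forall. intros x. apply (RInt_correct f). apply ex_RInt_continuous.
intros u _. apply Hf.
Qed.

(** For [g >= 0] the primitive [H] of [exp (- z r) g] increases and [H + M / z * exp (- z r)]
    decreases; their common limit gives the convergence and both bounds at once. *)
Lemma backward_resolvent_spec (z M : R) (g : R -> R) : 0 < z ->
  (forall t, continuous g t) -> (forall t, 0 <= g t <= M) ->
  (forall t, is_derive (backward_resolvent z g) t (z * backward_resolvent z g t - g t)) /\
  (forall t, 0 <= backward_resolvent z g t <= M / z).
Proof.
intros Hz Hc Hg. set (k := fun r => exp (- z * r) * g r).
set (H := fun x => RInt k 0 x).
assert (HM : 0 <= M) by (specialize (Hg 0); lra).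
assert (Hk : forall t, continuous k t).
{ intros t. apply (continuous_mult (fun r => exp (- z * r)) g); [| apply Hc].
  eapply is_derive_cont. apply is_derive_exp_lin. }
assert (HdH : forall t, is_derive H t (k t)) by now apply is_derive_primitive.
assert (Hup : forall s t, s <= t -> H s <= H t).
{ intros s t Hst. apply (derive_nonneg_incr H k); [easy | intros; apply HdH |].
  intros u _. apply Rmult_le_pos; [left; apply exp_pos | apply Hg]. }
assert (Hlow : forall s t, s <= t ->
  H t + M / z * exp (- z * t) <= H s + M / z * exp (- z * s)).
{ intros s t Hst.
  assert (HH : - (H s + M / z * exp (- z * s)) <= - (H t + M / z * exp (- z * t))); [| lra].
  apply (derive_nonneg_incr (fun u => - (H u + M / z * exp (- z * u)))
    (fun u => exp (- z * u) * (M - g u))); [easy | |].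
  - intros u _. eapply is_derive_rewrite; [derive | cbv beta; unfold k; field; lra].
  - intros u _. apply Rmult_le_pos; [left; apply exp_pos | specialize (Hg u); lra]. }
assert (HMz : 0 <= M / z) by (apply Rdiv_le_0_compat; lra).
assert (Hbd : forall s t, H t <= H s + M / z * exp (- z * s)).
{ intros s t. destruct (Rle_or_lt s t) as [Hst | Hst].
  - specialize (Hlow s t Hst). pose proof (exp_pos (- z * t)). nra.
  - specialize (Hup t s ltac:(lra)). pose proof (exp_pos (- z * s)). nra. }
destruct (ex_finite_lim_seq_incr (fun n => H (INR n)) (H 0 + M / z * exp (- z * 0)))
  as [L HL].
{ intros n. apply Hup. rewrite S_INR. lra. }
{ intros n. apply Hbd. }
assert (HLow : forall s, H s <= L).
{ intros s. destruct (INR_unbounded s) as [n Hn].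
  apply Rle_trans with (H (INR n)); [apply Hup; lra |].
  apply (is_lim_seq_incr_compare (fun n => H (INR n)) L HL).
  intros m. apply Hup. rewrite S_INR. lra. }
assert (HLup : forall s, L <= H s + M / z * exp (- z * s)).
{ intros s. exact (is_lim_seq_le _ _ (Finite _) (Finite _) (fun n => Hbd s (INR n)) HL
    (is_lim_seq_const _)). }
assert (Hform : forall t, backward_resolvent z g t = exp (z * t) * (L - H t)).
{ intros t. unfold backward_resolvent. fold k. fold (H t).
  change (fun n => RInt k 0 (INR n)) with (fun n => H (INR n)).
  rewrite (is_lim_seq_unique _ _ HL). reflexivity. }
assert (Hexp : forall t, exp (z * t) * exp (- z * t) = 1).
{ intros t. rewrite <- exp_plus. replace (z * t + - z * t) with 0 by ring. apply exp_0. }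
split; intros t.
- apply (is_derive_ext (fun t => exp (z * t) * (L - H t))); [intros; now rewrite Hform |].
  rewrite Hform. eapply is_derive_rewrite; [derive |]. cbv beta.
  unfold k. rewrite <- (Rmult_1_l (g t)) at 2. rewrite <- (Hexp t). ring.
- rewrite Hform. pose proof (exp_pos (z * t)) as He.
  specialize (HLow t). specialize (HLup t). split; [apply Rmult_le_pos; lra |].
  apply Rle_trans with (exp (z * t) * (M / z * exp (- z * t))).
  + apply Rmult_le_compat_l; lra.
  + rewrite <- (Rmult_1_r (M / z)) at 2. rewrite <- (Hexp t). right; ring.
Qed.

Definition forward_resolvent (a : R) (J : R -> R) (t : R) : R :=
  backward_resolvent a (fun s => J (- s)) (- t).

Lemma forward_resolvent_spec (a M : R) (J : R -> R) : 0 < a ->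
  (forall t, continuous J t) -> (forall t, 0 <= J t <= M) ->
  (forall t, is_derive (forward_resolvent a J) t (J t - a * forward_resolvent a J t)) /\
  (forall t, 0 <= forward_resolvent a J t <= M / a).
Proof.
intros Ha Hc HJ.
destruct (backward_resolvent_spec a M (fun s => J (- s)) Ha) as [Hd Hb].
- intros t. apply (continuous_comp (fun s => - s) J); [| apply Hc].
  exact (is_derive_cont _ _ _ (is_derive_neg _ _ _ (is_derive_var t))).
- intros t. apply HJ.
- split; intros t; [| apply Hb].
  apply (is_derive_ext (fun u => backward_resolvent a (fun s => J (- s)) (-1 * u + 0))).
  + intros u. unfold forward_resolvent. now replace (-1 * u + 0) with (- u) by ring.
  + eapply is_derive_rewrite; [apply is_derive_affine, Hd |].
    unfold forward_resolvent. replace (-1 * t + 0) with (- t) by ring.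
    rewrite Ropp_involutive. ring.
Qed.

(** * The quasi-monotone first order system *)

Section Profile.

Context (b h c a : R).
Hypothesis Hb : 0 <= b < 1.
Hypothesis Hh : 0 <= h.
Hypothesis Hc : 0 < c.
Hypothesis Ha : 0 < a.

(** The positive root of [z^2 - c z - beta]; the negative one is [- a]. *)
Definition zeta : R := a + c.
Definition beta : R := a * zeta.

Hypothesis Hchar : beta * (1 - b * exp (a * h)) = exp (a * h).

Definition reaction (phi : R -> R) (t : R) : R :=
  beta * (phi t - b * phi (t - h)) + phi t * (1 - phi (t - h)).

Lemma zeta_pos : 0 < zeta.
Proof. unfold zeta; lra. Qed.

Lemma beta_pos : 0 < beta.
Proof. unfold beta, zeta; nra. Qed.

Definition contraction : R := 1 - b * exp (a * h).

Lemma contraction_pos : 0 < contraction.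
Proof.
unfold contraction.
pose proof (exp_pos (a * h)). pose proof beta_pos.
apply (Rmult_lt_reg_l beta); lra.
Qed.

(** The order provides [yh - theta xh <= exp (a h) (y - theta x)], and [Hchar] reads
    [beta = (beta b + 1) exp (a h)], so the delayed loss never exceeds the instantaneous gain.
    What is left over comes from the concavity of [x (1 - xh)] under [x |-> theta x].
    Monotonicity of the reaction is the case [theta = 1]. *)
Lemma reaction_gain (theta x y xh yh : R) :
  0 <= theta <= 1 -> 0 <= x <= 1 -> yh <= 1 -> 0 <= y - theta * x ->
  yh - theta * xh <= exp (a * h) * (y - theta * x) ->
  theta * (1 - theta) * (x * xh) <=
  beta * (y - b * yh) + y * (1 - yh) - theta * (beta * (x - b * xh) + x * (1 - xh)).
Proof.
intros Ht Hx Hyh Hd Hdh.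
pose proof (exp_pos (a * h)) as HE. pose proof beta_pos as Hbeta.
set (d := y - theta * x) in *. set (dh := yh - theta * xh) in *.
set (E := exp (a * h)) in *.
replace (beta * (y - b * yh) + y * (1 - yh) - theta * (beta * (x - b * xh) + x * (1 - xh)))
  with (beta * d + d * (1 - yh) + theta * (1 - theta) * (x * xh)
        - (beta * b + theta * x) * dh) by (unfold d, dh; ring).
assert (H1 : (beta * b + theta * x) * dh <= (beta * b + theta * x) * (E * d)).
{ apply Rmult_le_compat_l; [| easy]. apply Rplus_le_le_0_compat; apply Rmult_le_pos; lra. }
assert (H2 : (beta * b + theta * x) * (E * d) <= (beta * b + 1) * (E * d)).
{ apply Rmult_le_compat_r; [apply Rmult_le_pos; lra |]. nra. }
assert (H3 : (beta * b + 1) * (E * d) = beta * d).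
{ rewrite <- Rmult_assoc. f_equal. lra. }
assert (H4 : 0 <= d * (1 - yh)) by (apply Rmult_le_pos; lra).
lra.
Qed.

(** One turn of the cycle. It is a relation rather than a function because the comparison
    principle, the passage to the limit and translations only use the equations and the
    boundedness of the solutions, which also makes them unique. *)
Record step (J phi g K : R -> R) : Prop := {
  step_phi : forall t, is_derive phi t (J t - a * phi t);
  step_range : forall t, 0 <= phi t <= 1;
  step_g : forall t, g t - b * g (t - h) = reaction phi t;
  step_g_bounded : exists M, forall t, Rabs (g t) <= M;
  step_K : forall t, is_derive K t (zeta * K t - g t);
  step_K_bounded : exists M, forall t, Rabs (K t) <= M
}.

(** A function nonnegative in the order controls its own past; this backward Harnack
    inequality replaces all estimates of delayed terms. *)
Lemma order_harnack (d d' : R -> R) (T M : R) :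
  (forall u, u <= T -> is_derive d u (d' u)) ->
  (forall u, u <= T -> - a * d u <= d' u) ->
  (forall u, u <= T -> - M <= d u) ->
  (forall t, t <= T -> 0 <= d t) /\
  (forall s t, s <= t -> t <= T -> d s <= exp (a * (t - s)) * d t).
Proof.
intros Hd Hi HM. split.
- exact (forward_nonneg d d' a T M Ha Hd Hi HM).
- intros s t Hst Ht.
  assert (H := exp_growth d d' (- a) s t Hst
    (fun u Hu => Hd u ltac:(lra)) (fun u Hu => Hi u ltac:(lra))).
  pose proof (exp_pos (a * (t - s))) as HE.
  replace (d s) with (exp (a * (t - s)) * (d s * exp (- a * (t - s)))).
  + now apply Rmult_le_compat_l; [left |].
  + rewrite (Rmult_comm (d s)), <- Rmult_assoc, <- exp_plus.
    replace (a * (t - s) + - a * (t - s)) with 0 by ring. rewrite exp_0; ring.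
Qed.

(** Comparison is carried along the cycle: through [order_harnack] and [reaction_gain] from
    [J] to the reaction, by [delay_nonneg] to [g], by [backward_nonneg] to [K]. *)
Lemma step_le (J phi g K J' phi' g' K' : R -> R) :
  step J phi g K -> step J' phi' g' K' -> (forall t, J' t <= J t) ->
  (forall t, phi' t <= phi t) /\ (forall t, g' t <= g t) /\ (forall t, K' t <= K t).
Proof.
intros H H' HJ.
assert (HK : forall T, (forall t, t <= T -> 0 <= phi t - phi' t) /\
  forall s t, s <= t -> t <= T ->
  phi s - phi' s <= exp (a * (t - s)) * (phi t - phi' t)).
{ intros T.
  apply (order_harnack (fun u => phi u - phi' u)
    (fun u => (J u - a * phi u) - (J' u - a * phi' u)) T 1); intros u Hu.
  - apply is_derive_sub; [apply (step_phi _ _ _ _ H) | apply (step_phi _ _ _ _ H')].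
  - specialize (HJ u). lra.
  - pose proof (step_range _ _ _ _ H u). pose proof (step_range _ _ _ _ H' u). lra. }
assert (Hphi : forall t, phi' t <= phi t).
{ intros t. pose proof (proj1 (HK t) t (Rle_refl t)). lra. }
destruct (step_g_bounded _ _ _ _ H) as [M HM].
destruct (step_g_bounded _ _ _ _ H') as [M' HM'].
assert (Hg : forall t, g' t <= g t).
{ intros T.
  assert (HD := delay_nonneg b h T (M + M') (fun u => g u - g' u) Hb Hh).
  cut (0 <= g T - g' T); [lra |]. apply HD; [| | apply Rle_refl].
  - intros u _. specialize (HM u). specialize (HM' u).
    apply Rabs_le_between in HM. apply Rabs_le_between in HM'. lra.
  - intros u _. pose proof (step_g _ _ _ _ H u) as E1. pose proof (step_g _ _ _ _ H' u) as E2.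
    replace (g u - g' u - b * (g (u - h) - g' (u - h))) with (reaction phi u - reaction phi' u)
      by (rewrite <- E1, <- E2; ring).
    pose proof (step_range _ _ _ _ H (u - h)) as R1.
    pose proof (step_range _ _ _ _ H' u) as R2.
    assert (HG := reaction_gain 1 (phi' u) (phi u) (phi' (u - h)) (phi (u - h))
      ltac:(lra) R2 ltac:(lra) ltac:(specialize (Hphi u); lra)).
    unfold reaction.
    destruct (HK u) as [_ HKu]. specialize (HKu (u - h) u ltac:(lra) ltac:(lra)).
    replace (u - (u - h)) with h in HKu by ring.
    rewrite !Rmult_1_l in HG. specialize (HG HKu). lra. }
destruct (step_K_bounded _ _ _ _ H) as [N HN].
destruct (step_K_bounded _ _ _ _ H') as [N' HN'].
split; [easy | split; [easy |]]. intros t.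
cut (0 <= K t - K' t); [lra |].
apply (backward_nonneg (fun u => K u - K' u)
  (fun u => (zeta * K u - g u) - (zeta * K' u - g' u)) zeta t (N + N') zeta_pos);
  [| | | apply Rle_refl]; intros u _.
- apply is_derive_sub; [apply (step_K _ _ _ _ H) | apply (step_K _ _ _ _ H')].
- specialize (Hg u). lra.
- specialize (HN u). specialize (HN' u).
  apply Rabs_le_between in HN. apply Rabs_le_between in HN'. lra.
Qed.

Lemma step_shift (s : R) (J phi g K : R -> R) : step J phi g K ->
  step (fun t => J (t + s)) (fun t => phi (t + s)) (fun t => g (t + s)) (fun t => K (t + s)).
Proof.
intros H. split.
- intros t. apply is_derive_shift, (step_phi _ _ _ _ H).
- intros t. apply (step_range _ _ _ _ H).
- intros t. unfold reaction. replace (t - h + s) with (t + s - h) by ring.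
  apply (step_g _ _ _ _ H).
- destruct (step_g_bounded _ _ _ _ H) as [M HM]. exists M. intros t. apply HM.
- intros t. apply (is_derive_shift K), (step_K _ _ _ _ H).
- destruct (step_K_bounded _ _ _ _ H) as [M HM]. exists M. intros t. apply HM.
Qed.

(** Comparison of a step with its translates to the left. *)
Lemma step_increasing (J phi g K : R -> R) : step J phi g K -> increasing_fun J ->
  increasing_fun phi /\ increasing_fun g /\ increasing_fun K.
Proof.
intros H HJ.
assert (HS : forall s, 0 <= s -> (forall t, phi t <= phi (t + s)) /\
  (forall t, g t <= g (t + s)) /\ (forall t, K t <= K (t + s))).
{ intros s Hs. apply (step_le _ _ _ _ _ _ _ _ (step_shift s _ _ _ _ H) H).
  intros t. apply HJ. lra. }
split; [| split]; intros s t Hst; destruct (HS (t - s) ltac:(lra)) as [H1 [H2 H3]];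
  specialize (H1 s); specialize (H2 s); specialize (H3 s);
  replace (s + (t - s)) with t in * by ring; easy.
Qed.

Lemma step_zero : step (fun _ => 0) (fun _ => 0) (fun _ => 0) (fun _ => 0).
Proof.
split; intros; unfold reaction; try lra.
- eapply is_derive_rewrite; [derive | cbv beta; ring].
- exists 0. intros. rewrite Rabs_R0. lra.
- eapply is_derive_rewrite; [derive | cbv beta; ring].
- exists 0. intros. rewrite Rabs_R0. lra.
Qed.

Lemma step_one : step (fun _ => a) (fun _ => 1) (fun _ => beta) (fun _ => a).
Proof.
split; intros; unfold reaction; try lra.
- eapply is_derive_rewrite; [derive | cbv beta; ring].
- exists (Rabs beta). intros. lra.
- eapply is_derive_rewrite; [derive | unfold beta; ring].
- exists (Rabs a). intros. lra.
Qed.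

Lemma step_bounds (J phi g K : R -> R) : step J phi g K -> (forall t, 0 <= J t <= a) ->
  (forall t, 0 <= g t <= beta) /\ (forall t, 0 <= K t <= a).
Proof.
intros H HJ.
destruct (step_le _ _ _ _ _ _ _ _ H step_zero ltac:(intros; apply HJ)) as [_ [H1 H2]].
destruct (step_le _ _ _ _ _ _ _ _ step_one H ltac:(intros; apply HJ)) as [_ [H3 H4]].
split; intros t; split; auto.
Qed.

Definition next_phi (J : R -> R) : R -> R := forward_resolvent a J.
Definition next_g (J : R -> R) : R -> R := delay_inverse b h (reaction (next_phi J)).
Definition next (J : R -> R) : R -> R := backward_resolvent zeta (next_g J).

Lemma next_step (J : R -> R) : (forall t, continuous J t) -> (forall t, 0 <= J t <= a) ->
  step J (next_phi J) (next_g J) (next J).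
Proof.
intros HJc HJ.
destruct (forward_resolvent_spec a a J Ha HJc HJ) as [Hd Hr].
replace (a / a) with 1 in Hr by (field; lra).
fold (next_phi J) in Hd, Hr. set (phi := next_phi J) in *.
pose proof beta_pos as Hbeta.
assert (HF : forall t, 0 <= reaction phi t <= beta + 1).
{ intros t. split.
  - destruct (order_harnack phi (fun u => J u - a * phi u) t 0) as [_ HK].
    + intros u _. apply Hd.
    + intros u _. specialize (HJ u). lra.
    + intros u _. specialize (Hr u). lra.
    + specialize (HK (t - h) t ltac:(lra) ltac:(lra)).
      replace (t - (t - h)) with h in HK by ring.
      assert (HG := reaction_gain 0 0 (phi t) 0 (phi (t - h)) ltac:(lra) ltac:(lra)
        ltac:(apply Hr) ltac:(specialize (Hr t); lra)).
      rewrite !Rmult_0_l, !Rminus_0_r in HG. specialize (HG HK). exact HG.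
  - unfold reaction. pose proof (Hr t). pose proof (Hr (t - h)).
    apply Rplus_le_compat.
    + rewrite <- (Rmult_1_r beta) at 2. apply Rmult_le_compat_l; nra.
    + nra. }
destruct (delay_inverse_spec b h (beta + 1) (reaction phi) Hb HF) as [Hg Hgb].
fold (next_g J) in Hg, Hgb. set (g := next_g J) in *.
assert (Hphic : forall t, continuous phi t) by (intros t; exact (is_derive_cont _ _ _ (Hd t))).
assert (Hgc : forall t, continuous g t).
{ apply (delay_continuous b h ((beta + 1) / (1 - b)) (reaction phi) g Hb); [| exact Hg |].
  - intros t. rewrite Rabs_pos_eq; apply Hgb.
  - intros t. unfold reaction. eapply is_derive_cont. derive. }
destruct (backward_resolvent_spec zeta ((beta + 1) / (1 - b)) g zeta_pos Hgc Hgb) as [HK HKb].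
fold (next J) in HK, HKb.
split; try assumption.
- exists ((beta + 1) / (1 - b)). intros t. rewrite Rabs_pos_eq; apply Hgb.
- exists ((beta + 1) / (1 - b) / zeta). intros t. rewrite Rabs_pos_eq; apply HKb.
Qed.

(** A Lipschitz constant for [g]: one of the reaction, divided by [1 - b]. *)
Definition reaction_lip : R := (2 * beta + 2) * a / (1 - b).

Lemma step_lipschitz (J phi g K : R -> R) : step J phi g K -> (forall t, 0 <= J t <= a) ->
  (forall u v, Rabs (phi u - phi v) <= a * Rabs (u - v)) /\
  (forall u v, Rabs (g u - g v) <= reaction_lip * Rabs (u - v)) /\
  (forall u v, Rabs (K u - K v) <= beta * Rabs (u - v)).
Proof.
intros H HJ. destruct (step_bounds _ _ _ _ H HJ) as [Hg HK].
pose proof beta_pos as Hbeta. pose proof zeta_pos as Hzeta.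
assert (Hphi : forall u v, Rabs (phi u - phi v) <= a * Rabs (u - v)).
{ apply (lipschitz_of_derive_bound phi (fun u => J u - a * phi u) a (step_phi _ _ _ _ H)).
  intros u. apply Rabs_le. specialize (HJ u). pose proof (step_range _ _ _ _ H u). nra. }
split; [easy | split].
- assert (HF : forall u v, Rabs (reaction phi u - reaction phi v) <=
    (2 * beta + 2) * a * Rabs (u - v)).
  { intros u v. pose proof (Hphi u v) as L1. pose proof (Hphi (u - h) (v - h)) as L2.
    replace (u - h - (v - h)) with (u - v) in L2 by ring.
    pose proof (step_range _ _ _ _ H u). pose proof (step_range _ _ _ _ H (u - h)).
    pose proof (step_range _ _ _ _ H v). pose proof (step_range _ _ _ _ H (v - h)).
    unfold reaction.
    set (x := phi u) in *. set (y := phi v) in *.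
    set (xh := phi (u - h)) in *. set (yh := phi (v - h)) in *.
    replace (beta * (x - b * xh) + x * (1 - xh) - (beta * (y - b * yh) + y * (1 - yh)))
      with ((beta + (1 - xh)) * (x - y) + (- (beta * b) - y) * (xh - yh)) by ring.
    eapply Rle_trans; [apply Rabs_triang |]. rewrite !Rabs_mult.
    rewrite (Rabs_pos_eq (beta + (1 - xh))) by lra.
    rewrite (Rabs_left1 (- (beta * b) - y)) by nra.
    assert (Hbb : beta * b <= beta) by nra.
    set (D := a * Rabs (u - v)) in *.
    assert (0 <= D) by (apply Rmult_le_pos; [lra | apply Rabs_pos]).
    replace ((2 * beta + 2) * a * Rabs (u - v)) with ((beta + 1) * D + (beta + 1) * D)
      by (unfold D; ring).
    apply Rplus_le_compat.
    - apply Rmult_le_compat; try lra. apply Rabs_pos.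
    - apply Rmult_le_compat; try lra; try nra. apply Rabs_pos. }
  intros u v. set (L := reaction_lip * Rabs (u - v)).
  assert (HL : forall t, Rabs (reaction phi (t + u) - reaction phi (t + v)) <= (1 - b) * L).
  { intros t. eapply Rle_trans; [apply HF |].
    replace (t + u - (t + v)) with (u - v) by ring.
    right. unfold L, reaction_lip. field. lra. }
  assert (HL0 : 0 <= L).
  { unfold L, reaction_lip. apply Rmult_le_pos; [| apply Rabs_pos].
    apply Rdiv_le_0_compat; [nra | lra]. }
  assert (HD : forall sg, sg = 1 \/ sg = -1 -> 0 <= L + sg * (g (0 + u) - g (0 + v))).
  { intros sg Hsg.
    apply (delay_nonneg b h 0 (beta) (fun t => L + sg * (g (t + u) - g (t + v))) Hb Hh);
      [| | apply Rle_refl]; intros t _.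
    - pose proof (Hg (t + u)). pose proof (Hg (t + v)). destruct Hsg; subst sg; lra.
    - specialize (HL t). apply Rabs_le_between in HL.
      rewrite <- !(step_g _ _ _ _ H) in HL.
      replace (t + u - h) with (t - h + u) in HL by ring.
      replace (t + v - h) with (t - h + v) in HL by ring.
      destruct Hsg; subst sg; lra. }
  rewrite !Rplus_0_l in HD. apply Rabs_le.
  pose proof (HD 1 (or_introl eq_refl)). pose proof (HD (-1) (or_intror eq_refl)). lra.
- apply (lipschitz_of_derive_bound K (fun u => zeta * K u - g u) beta (step_K _ _ _ _ H)).
  intros u. apply Rabs_le. specialize (HK u). specialize (Hg u).
  assert (0 <= zeta * K u <= beta) by (unfold beta in *; nra). lra.
Qed.

Lemma step_limit (Jn phin gn Kn : nat -> R -> R) (J phi g K : R -> R) :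
  (forall n, step (Jn n) (phin n) (gn n) (Kn n)) ->
  (forall n t, 0 <= Jn n t <= a) ->
  (forall n u v, Rabs (Jn n u - Jn n v) <= beta * Rabs (u - v)) ->
  (forall t, is_lim_seq (fun n => Jn n t) (J t)) ->
  (forall t, is_lim_seq (fun n => phin n t) (phi t)) ->
  (forall t, is_lim_seq (fun n => gn n t) (g t)) ->
  (forall t, is_lim_seq (fun n => Kn n t) (K t)) ->
  step J phi g K /\ forall t, 0 <= J t <= a.
Proof.
intros H HJ HJL LJ Lphi Lg LK.
assert (Hbox : forall (fn : nat -> R -> R) (f : R -> R) (m M : R),
  (forall t, is_lim_seq (fun n => fn n t) (f t)) -> (forall n t, m <= fn n t <= M) ->
  forall t, m <= f t <= M).
{ intros fn f m M Lf Hf t. split.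
  - exact (is_lim_seq_le _ _ (Finite _) (Finite _) (fun n => proj1 (Hf n t))
      (is_lim_seq_const m) (Lf t)).
  - exact (is_lim_seq_le _ _ (Finite _) (Finite _) (fun n => proj2 (Hf n t))
      (Lf t) (is_lim_seq_const M)). }
assert (Hgn : forall n t, 0 <= gn n t <= beta)
  by (intros n; apply (step_bounds _ _ _ _ (H n) (HJ n))).
assert (HKn : forall n t, 0 <= Kn n t <= a)
  by (intros n; apply (step_bounds _ _ _ _ (H n) (HJ n))).
split; [split |].
- apply (is_derive_pointwise_limit phin (fun n u => Jn n u - a * phin n u) phi
    (fun u => J u - a * phi u) (beta + a * a)); [intros n; apply (step_phi _ _ _ _ (H n)) | | easy |].
  + intros n u v. destruct (step_lipschitz _ _ _ _ (H n) (HJ n)) as [L1 _].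
    specialize (L1 u v). specialize (HJL n u v).
    replace (Jn n u - a * phin n u - (Jn n v - a * phin n v)) with
      ((Jn n u - Jn n v) + - (a * (phin n u - phin n v))) by ring.
    eapply Rle_trans; [apply Rabs_triang |].
    rewrite Rabs_Ropp, Rabs_mult, (Rabs_pos_eq a) by lra. nra.
  + intros u. apply is_lim_seq_minus'; [apply LJ |].
    apply (is_lim_seq_scal_l _ a (Finite (phi u))), Lphi.
- apply (Hbox phin); [easy |]. intros n. apply (step_range _ _ _ _ (H n)).
- intros t.
  assert (E1 : is_lim_seq (fun n => gn n t - b * gn n (t - h)) (g t - b * g (t - h))).
  { apply is_lim_seq_minus'; [apply Lg |].
    apply (is_lim_seq_scal_l _ b (Finite (g (t - h)))), Lg. }
  assert (E2 : is_lim_seq (fun n => reaction (phin n) t) (reaction phi t)).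
  { unfold reaction. apply is_lim_seq_plus'.
    - apply (is_lim_seq_scal_l _ beta (Finite (phi t - b * phi (t - h)))).
      apply is_lim_seq_minus'; [apply Lphi |].
      apply (is_lim_seq_scal_l _ b (Finite (phi (t - h)))), Lphi.
    - apply is_lim_seq_mult'; [apply Lphi |].
      apply is_lim_seq_minus'; [apply is_lim_seq_const | apply Lphi]. }
  apply (is_lim_seq_ext _ (fun n => gn n t - b * gn n (t - h))) in E2;
    [| intros n; symmetry; apply (step_g _ _ _ _ (H n))].
  apply is_lim_seq_unique in E1. apply is_lim_seq_unique in E2.
  rewrite E1 in E2. now injection E2.
- exists beta. intros t. pose proof (Hbox gn g 0 beta Lg Hgn t). rewrite Rabs_pos_eq; lra.
- apply (is_derive_pointwise_limit Kn (fun n u => zeta * Kn n u - gn n u) K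
    (fun u => zeta * K u - g u) (zeta * beta + reaction_lip));
    [intros n; apply (step_K _ _ _ _ (H n)) | | easy |].
  + intros n u v. destruct (step_lipschitz _ _ _ _ (H n) (HJ n)) as [_ [L2 L3]].
    specialize (L2 u v). specialize (L3 u v). pose proof zeta_pos.
    replace (zeta * Kn n u - gn n u - (zeta * Kn n v - gn n v)) with
      (zeta * (Kn n u - Kn n v) + - (gn n u - gn n v)) by ring.
    eapply Rle_trans; [apply Rabs_triang |].
    rewrite Rabs_Ropp, Rabs_mult, (Rabs_pos_eq zeta) by lra. nra.
  + intros u. apply is_lim_seq_minus'; [| apply Lg].
    apply (is_lim_seq_scal_l _ zeta (Finite (K u))), LK.
- exists a. intros t. pose proof (Hbox Kn K 0 a LK HKn t). rewrite Rabs_pos_eq; lra.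
- apply (Hbox Jn); easy.
Qed.

(** ** Monotone iteration *)

(** The function [low] stands for a lower barrier. It is only compared on [t <= 0], which
    suffices because the delays look into the past. *)
Lemma monotone_iteration (J0 low : R -> R) :
  (forall t, continuous J0 t) -> increasing_fun J0 -> (forall t, 0 <= J0 t <= a) ->
  (forall t, next J0 t <= J0 t) ->
  (forall J phi g K, step J phi g K -> (forall t, 0 <= J t <= a) ->
    (forall t, t <= 0 -> low t <= J t) -> forall t, t <= 0 -> low t <= K t) ->
  (forall t, t <= 0 -> low t <= J0 t) ->
  exists J phi g, step J phi g J /\ (forall t, 0 <= J t <= a) /\ increasing_fun J /\
    (forall t, t <= 0 -> low t <= J t) /\ (forall t, J t <= J0 t).
Proof.
intros Hc0 Hi0 Hb0 Hd0 Hlow Hl0.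
set (Jn := fun n => Nat.iter n next J0).
assert (HI : forall n, (forall t, continuous (Jn n) t) /\ increasing_fun (Jn n) /\
  (forall t, 0 <= Jn n t <= a) /\ (forall t, Jn (S n) t <= Jn n t) /\
  (forall t, t <= 0 -> low t <= Jn n t)).
{ induction n as [| n [H1 [H2 [H3 [H4 H5]]]]]; [repeat (split; [easy |]); easy |].
  assert (HS := next_step (Jn n) H1 H3).
  change (next (Jn n)) with (Jn (S n)) in HS.
  destruct (step_bounds _ _ _ _ HS H3) as [_ HB].
  assert (HC : forall t, continuous (Jn (S n)) t)
    by (intros t; exact (is_derive_cont _ _ _ (step_K _ _ _ _ HS t))).
  split; [easy |]. split; [now apply (step_increasing _ _ _ _ HS) |].
  split; [easy |]. split; [| now apply (Hlow _ _ _ _ HS H3)].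
  apply (step_le _ _ _ _ _ _ _ _ HS (next_step (Jn (S n)) HC HB)), H4. }
assert (HS : forall n, step (Jn n) (next_phi (Jn n)) (next_g (Jn n)) (Jn (S n))).
{ intros n. apply next_step; apply (HI n). }
assert (HJ00 : forall t, Jn 0%nat t = J0 t) by reflexivity.
clearbody Jn.
assert (HSd : forall n, (forall t, next_phi (Jn (S n)) t <= next_phi (Jn n) t) /\
  (forall t, next_g (Jn (S n)) t <= next_g (Jn n) t)).
{ intros n. destruct (step_le _ _ _ _ _ _ _ _ (HS n) (HS (S n))) as [H1 [H2 _]];
    [apply (HI n) | easy]. }
assert (LJ := fun t => decreasing_limit (fun n => Jn n t) 0
  (fun n => proj1 (proj2 (proj2 (proj2 (HI n)))) t)
  (fun n => proj1 (proj1 (proj2 (proj2 (HI n))) t))).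
assert (Lphi := fun t => decreasing_limit (fun n => next_phi (Jn n) t) 0
  (fun n => proj1 (HSd n) t) (fun n => proj1 (step_range _ _ _ _ (HS n) t))).
assert (Lg := fun t => decreasing_limit (fun n => next_g (Jn n) t) 0
  (fun n => proj2 (HSd n) t)
  (fun n => proj1 (proj1 (step_bounds _ _ _ _ (HS n) (proj1 (proj2 (proj2 (HI n))))) t))).
set (J := fun t => real (Lim_seq (fun n => Jn n t))) in *.
exists J, (fun t => real (Lim_seq (fun n => next_phi (Jn n) t))),
  (fun t => real (Lim_seq (fun n => next_g (Jn n) t))).
assert (LJt : forall t, is_lim_seq (fun n => Jn n t) (J t)) by apply LJ.
destruct (step_limit (fun n => Jn (S n)) (fun n => next_phi (Jn (S n)))
  (fun n => next_g (Jn (S n))) (fun n => Jn (S (S n))) J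
  (fun t => real (Lim_seq (fun n => next_phi (Jn n) t)))
  (fun t => real (Lim_seq (fun n => next_g (Jn n) t))) J) as [HJ HJb].
- intros n. apply HS.
- intros n. apply (HI (S n)).
- intros n. apply (step_lipschitz _ _ _ _ (HS n)), (HI n).
- intros t. apply (is_lim_seq_incr_1 (fun n => Jn n t)), LJt.
- intros t. apply (is_lim_seq_incr_1 (fun n => next_phi (Jn n) t)), Lphi.
- intros t. apply (is_lim_seq_incr_1 (fun n => next_g (Jn n) t)), Lg.
- intros t. apply (is_lim_seq_incr_1 (fun n => Jn (S n) t)).
  apply (is_lim_seq_incr_1 (fun n => Jn n t)), LJt.
- split; [easy |]. split; [easy |]. split; [| split].
  + intros s t Hst.
    exact (is_lim_seq_le _ _ (Finite _) (Finite _)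
      (fun n => proj1 (proj2 (HI n)) s t Hst) (LJt s) (LJt t)).
  + intros t Ht.
    exact (is_lim_seq_le _ _ (Finite _) (Finite _)
      (fun n => proj2 (proj2 (proj2 (proj2 (HI n)))) t Ht) (is_lim_seq_const _) (LJt t)).
  + intros t. rewrite <- HJ00. apply (proj2 (LJ t) 0%nat).
Qed.

(** ** From fixed points to fronts *)

Lemma constant_step (lJ l lg : R) :
  step (fun _ => lJ) (fun _ => l) (fun _ => lg) (fun _ => lJ) -> l = 0 \/ l = 1.
Proof.
intros H. pose proof zeta_pos.
assert (E1 := is_derive_unique _ _ _ (step_phi _ _ _ _ H 0)).
assert (E2 := is_derive_unique _ _ _ (step_K _ _ _ _ H 0)).
assert (E3 := step_g _ _ _ _ H 0). rewrite Derive_const in E1, E2. unfold reaction, beta in E3.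
assert (HJ : lJ = a * l) by lra.
assert (Hg : lg = zeta * (a * l)) by (rewrite <- HJ; lra).
rewrite Hg in E3.
assert (E : l * (1 - l) = 0) by lra.
apply Rmult_integral in E. destruct E; [left | right]; lra.
Qed.

(** Translates of an increasing fixed point converge to constant fixed points, so
    its limits are equilibria. *)
Lemma fixed_point_limits (J phi g : R -> R) (t1 t2 : R) :
  step J phi g J -> (forall t, 0 <= J t <= a) -> increasing_fun J ->
  phi t1 < 1 -> 0 < phi t2 ->
  is_lim phi m_infty 0 /\ is_lim phi p_infty 1.
Proof.
intros H HJ Hi H1 H2.
destruct (step_increasing _ _ _ _ H Hi) as [Hip [Hig _]].
destruct (step_bounds _ _ _ _ H HJ) as [Hg _].
destruct (step_lipschitz _ _ _ _ H HJ) as [_ [_ HL]].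
pose proof (step_range _ _ _ _ H) as Hr.
assert (HSs : forall s : nat -> R, forall lJ l lg,
  (forall t, is_lim_seq (fun n => J (t + s n)) (Finite lJ)) ->
  (forall t, is_lim_seq (fun n => phi (t + s n)) (Finite l)) ->
  (forall t, is_lim_seq (fun n => g (t + s n)) (Finite lg)) -> l = 0 \/ l = 1).
{ intros s lJ l lg L1 L2 L3. apply (constant_step lJ l lg).
  apply (step_limit (fun n t => J (t + s n)) (fun n t => phi (t + s n))
    (fun n t => g (t + s n)) (fun n t => J (t + s n))); try easy.
  - intros n. now apply step_shift.
  - intros n u v. specialize (HL (u + s n) (v + s n)).
    now replace (u + s n - (v + s n)) with (u - v) in HL by ring. }
split.
- destruct (increasing_lim_m J 0 Hi (fun t => proj1 (HJ t))) as [lJ [L1 _]].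
  destruct (increasing_lim_m phi 0 Hip (fun t => proj1 (Hr t))) as [l [L2 Hl]].
  destruct (increasing_lim_m g 0 Hig (fun t => proj1 (Hg t))) as [lg [L3 _]].
  destruct (HSs (fun n => - INR n) lJ l lg) as [-> | ->]; try easy;
    try (intros t; now apply lim_seq_shift_m).
  specialize (Hl t1). lra.
- destruct (increasing_lim_p J a Hi (fun t => proj2 (HJ t))) as [lJ [L1 _]].
  destruct (increasing_lim_p phi 1 Hip (fun t => proj2 (Hr t))) as [l [L2 Hl]].
  destruct (increasing_lim_p g beta Hig (fun t => proj2 (Hg t))) as [lg [L3 _]].
  destruct (HSs (fun n => INR n) lJ l lg) as [-> | ->]; try easy;
    try (intros t; now apply lim_seq_shift_p).
  specialize (Hl t2). lra.
Qed.

Lemma fixed_point_derivatives (J phi g : R -> R) : step J phi g J ->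
  let v := fun t => phi t - b * phi (t - h) in
  exists v1, (forall t, is_derive v t (v1 t)) /\
    (forall t, is_derive v1 t (c * v1 t - phi t * (1 - phi (t - h)))).
Proof.
intros H v.
pose proof (step_phi _ _ _ _ H) as Hp. pose proof (step_K _ _ _ _ H) as HK.
exists (fun t => (J t - a * phi t) - b * (J (t - h) - a * phi (t - h))).
split; intros t.
- unfold v. eapply is_derive_rewrite; [derive | cbv beta; ring].
- eapply is_derive_rewrite; [derive | cbv beta].
  assert (E := step_g _ _ _ _ H t). unfold reaction, beta, zeta in *.
  apply Rminus_diag_uniq.
  match goal with |- ?x = 0 => replace x with
    (a * (a + c) * (phi t - b * phi (t - h)) + phi t * (1 - phi (t - h)) - (g t - b * g (t - h)))
    by ring end.
  rewrite E. ring.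
Qed.

Lemma fixed_point_front (tau : R) (J phi g : R -> R) : h = c * tau ->
  step J phi g J -> (forall t, 0 <= J t <= a) -> increasing_fun J ->
  is_lim phi m_infty 0 -> is_lim phi p_infty 1 -> monotone_front b tau c phi.
Proof.
intros Htau H HJ Hi L0 L1.
destruct (fixed_point_derivatives J phi g H) as [v1 [Hv Hv1]].
set (v := fun t => phi t - b * phi (t - h)) in *.
assert (Dv : forall t, Derive v t = v1 t) by (intros t; now apply is_derive_unique).
assert (D2 : forall t, Derive_n v 2 t = c * v1 t - phi t * (1 - phi (t - h))).
{ intros t. simpl. rewrite (Derive_ext _ v1) by (intros; apply Dv).
  now apply is_derive_unique. }
assert (Hc2 : forall k t, (k <= 2)%nat -> ex_derive_n v k t).
{ intros [| [| [| k]]] t Hk; simpl; [easy | | | lia].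
  - exists (v1 t). apply Hv.
  - apply (ex_derive_ext v1); [intros; symmetry; apply Dv |]. eexists. apply Hv1. }
assert (Hphic : forall t, continuous phi t)
  by (intros t; exact (is_derive_cont _ _ _ (step_phi _ _ _ _ H t))).
unfold monotone_front. rewrite <- Htau. fold v.
split; [| split; [| split; [| split]]].
- unfold neutral_KPP_solution, neutral_part. intros t x.
  assert (E : forall s y, phi (y + c * s) - b * phi (y + c * (s - tau)) = v (y + c * s)).
  { intros s y. unfold v. rewrite Htau.
    now replace (y + c * (s - tau)) with (y + c * s - c * tau) by ring. }
  assert (Dt : is_derive (fun s => phi (x + c * s) - b * phi (x + c * (s - tau))) t
    (c * v1 (x + c * t))).
  { apply (is_derive_ext (fun s => v (c * s + x))).
    - intros s. rewrite E. now rewrite Rplus_comm.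
    - apply (is_derive_affine v). rewrite (Rplus_comm (c * t)). apply Hv. }
  assert (Dx : forall y, is_derive (fun y => phi (y + c * t) - b * phi (y + c * (t - tau))) y
    (v1 (y + c * t))).
  { intros y. apply (is_derive_ext (fun y => v (y + c * t))).
    - intros s. now rewrite E.
    - apply (is_derive_shift v), Hv. }
  assert (Dxx : is_derive (Derive (fun y => phi (y + c * t) - b * phi (y + c * (t - tau)))) x
    (c * v1 (x + c * t) - phi (x + c * t) * (1 - phi (x + c * t - h)))).
  { apply (is_derive_ext (fun y => v1 (y + c * t))).
    - intros y. symmetry. apply is_derive_unique, Dx.
    - apply (is_derive_shift v1), Hv1. }
  split; [eexists; exact Dt |]. split; [eexists; apply Dx |].
  split; [eexists; exact Dxx |].
  transitivity (c * v1 (x + c * t)); [exact (is_derive_unique _ _ _ Dt) |].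
  transitivity (c * v1 (x + c * t) - phi (x + c * t) * (1 - phi (x + c * t - h))
    + phi (x + c * t) * (1 - phi (x + c * (t - tau))));
    [| apply Rplus_eq_compat_r; symmetry; exact (is_derive_unique _ _ _ Dxx)].
  replace (x + c * (t - tau)) with (x + c * t - h) by (rewrite Htau; ring). ring.
- left. apply (step_increasing _ _ _ _ H Hi).
- split; [exact Hc2 |]. intros t.
  apply (continuous_ext (fun t => c * v1 t - phi t * (1 - phi (t - h))));
    [intros; now rewrite D2 |].
  eapply is_derive_cont. pose proof (step_phi _ _ _ _ H). derive.
- intros t. rewrite D2, Dv. ring.
- split; easy.
Qed.
(** ** Barriers *)

(** Only supersolutions on [t <= 0] are needed: for [t >= 0] the value [J = a] belongs to the
    equilibrium [phi = 1], which dominates every iterate. *)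
Lemma upper_barrier (Phi Phi1 Phi2 : R -> R) (M : R) :
  (forall t, is_derive Phi t (Phi1 t)) -> (forall t, is_derive Phi1 t (Phi2 t)) ->
  (forall t, t <= 0 -> Rabs (Phi t) <= M) ->
  (forall t, t <= 0 -> Rabs (- Phi2 t + c * Phi1 t + beta * Phi t) <= M) ->
  (forall s t, s <= t -> t <= 0 -> Phi1 s + a * Phi s <= Phi1 t + a * Phi t) ->
  (forall t, t <= 0 -> 0 <= Phi1 t + a * Phi t) -> Phi1 0 + a * Phi 0 = a ->
  (forall t, t <= 0 ->
    (Phi2 t - c * Phi1 t) - b * (Phi2 (t - h) - c * Phi1 (t - h)) + Phi t <= 0) ->
  let J0 := fun t => Phi1 (clip t) + a * Phi (clip t) in
  (forall t, continuous J0 t) /\ increasing_fun J0 /\ (forall t, 0 <= J0 t <= a) /\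
  (forall t, t <= 0 -> next_phi J0 t = Phi t) /\ (forall t, next J0 t <= J0 t).
Proof.
intros HP1 HP2 HPM HGM Hji Hjp Hj0 Hsup J0.
assert (HJc : forall t, continuous J0 t).
{ intros t. apply (continuous_comp clip (fun u => Phi1 u + a * Phi u)); [apply clip_continuous |].
  eapply is_derive_cont. derive. }
assert (HJl : forall t, t <= 0 -> J0 t = Phi1 t + a * Phi t)
  by (intros t Ht; unfold J0; now rewrite clip_left).
assert (HJr : forall t, 0 <= t -> J0 t = a)
  by (intros t Ht; unfold J0; now rewrite clip_right).
assert (HJi : increasing_fun J0).
{ intros s t Hst. destruct (Rle_or_lt t 0) as [Ht | Ht].
  - rewrite !HJl by lra. now apply Hji.
  - rewrite (HJr t) by lra. destruct (Rle_or_lt s 0) as [Hs | Hs].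
    + rewrite HJl by easy. apply Rle_trans with (Phi1 0 + a * Phi 0); [apply Hji; lra | lra].
    + rewrite HJr; lra. }
assert (HJb : forall t, 0 <= J0 t <= a).
{ intros t. split.
  - destruct (Rle_or_lt t 0) as [Ht | Ht]; [rewrite HJl; auto | rewrite HJr; lra].
  - rewrite <- (HJr (Rmax t 0)) by apply Rmax_r. apply HJi, Rmax_l. }
assert (HS := next_step J0 HJc HJb).
assert (Heq : forall t, t <= 0 -> next_phi J0 t = Phi t).
{ intros t Ht.
  assert (H1 : 0 <= next_phi J0 t - Phi t).
  { apply (forward_nonneg (fun u => next_phi J0 u - Phi u)
      (fun u => (J0 u - a * next_phi J0 u) - Phi1 u) a 0 M Ha); [| | | easy]; intros u Hu.
    - apply is_derive_sub; [apply (step_phi _ _ _ _ HS) | apply HP1].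
    - rewrite HJl by easy. lra.
    - pose proof (step_range _ _ _ _ HS u). specialize (HPM u Hu).
      apply Rabs_le_between in HPM. lra. }
  assert (H2 : 0 <= Phi t - next_phi J0 t).
  { apply (forward_nonneg (fun u => Phi u - next_phi J0 u)
      (fun u => Phi1 u - (J0 u - a * next_phi J0 u)) a 0 (M + 1) Ha); [| | | easy]; intros u Hu.
    - apply is_derive_sub; [apply HP1 | apply (step_phi _ _ _ _ HS)].
    - rewrite HJl by easy. lra.
    - pose proof (step_range _ _ _ _ HS u). specialize (HPM u Hu).
      apply Rabs_le_between in HPM. lra. }
  lra. }
split; [easy |]. split; [easy |]. split; [easy |]. split; [easy |].
destruct (step_bounds _ _ _ _ HS HJb) as [Hg HK].
set (G := fun t => - Phi2 t + c * Phi1 t + beta * Phi t) in *.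
assert (HgG : forall t, t <= 0 -> 0 <= G t - next_g J0 t).
{ apply (delay_nonneg b h 0 (M + beta) (fun t => G t - next_g J0 t) Hb Hh); intros t Ht.
  - specialize (HGM t Ht). apply Rabs_le_between in HGM. specialize (Hg t). unfold G. lra.
  - assert (E := step_g _ _ _ _ HS t). unfold reaction in E.
    pose proof (step_range _ _ _ _ HS t) as R1.
    pose proof (step_range _ _ _ _ HS (t - h)) as R2.
    rewrite (Heq (t - h)) in E, R2 by lra. rewrite (Heq t Ht) in E, R1.
    specialize (Hsup t Ht). unfold G.
    assert (0 <= Phi t * Phi (t - h)) by (apply Rmult_le_pos; lra). lra. }
intros t. destruct (Rle_or_lt t 0) as [Ht | Ht].
- rewrite HJl by easy.
  cut (0 <= Phi1 t + a * Phi t - next J0 t); [lra |].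
  apply (backward_nonneg_left (fun u => Phi1 u + a * Phi u - next J0 u)
    (fun u => Phi2 u + a * Phi1 u - (zeta * next J0 u - next_g J0 u)) zeta 0);
    [| | | easy].
  + intros u _. pose proof (step_K _ _ _ _ HS) as HdK.
    eapply is_derive_rewrite; [derive | cbv beta; ring].
  + intros u Hu. specialize (HgG u Hu). unfold G, beta, zeta in *. lra.
  + specialize (HK 0). lra.
- rewrite HJr by lra. apply HK.
Qed.

(** The function [m] lives on [t <= 0] and vanishes at [0] with a nonpositive slope, so there
    [m1 + a m <= 0 <= K], which starts the backward comparison. *)
Lemma lower_barrier (m m1 m2 : R -> R) (M : R) :
  (forall t, is_derive m t (m1 t)) -> (forall t, is_derive m1 t (m2 t)) ->
  (forall t, t <= 0 -> 0 <= m t <= M) ->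
  (forall t, t <= 0 -> Rabs (- m2 t + c * m1 t + beta * m t) <= M) ->
  m 0 = 0 -> m1 0 <= 0 ->
  (forall t, t <= 0 ->
    0 <= (m2 t - c * m1 t) - b * (m2 (t - h) - c * m1 (t - h)) + m t * (1 - m (t - h))) ->
  forall J phi g K, step J phi g K -> (forall t, 0 <= J t <= a) ->
  (forall t, t <= 0 -> m1 t + a * m t <= J t) ->
  (forall t, t <= 0 -> m t <= phi t) /\ (forall t, t <= 0 -> m1 t + a * m t <= K t).
Proof.
intros Hm1 Hm2 HmM HGM Hm0 Hm10 Hsub J phi g K HS HJ HmJ.
destruct (order_harnack (fun u => phi u - m u) (fun u => (J u - a * phi u) - m1 u) 0 M)
  as [Hpos Hhar].
{ intros u _. apply is_derive_sub; [apply (step_phi _ _ _ _ HS) | apply Hm1]. }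
{ intros u Hu. specialize (HmJ u Hu). lra. }
{ intros u Hu. specialize (HmM u Hu). pose proof (step_range _ _ _ _ HS u). lra. }
split; [intros t Ht; specialize (Hpos t Ht); lra |].
destruct (step_bounds _ _ _ _ HS HJ) as [Hg HK].
set (G := fun t => - m2 t + c * m1 t + beta * m t) in *.
assert (HgG : forall t, t <= 0 -> 0 <= g t - G t).
{ apply (delay_nonneg b h 0 M (fun t => g t - G t) Hb Hh); intros t Ht.
  - specialize (HGM t Ht). apply Rabs_le_between in HGM. specialize (Hg t). unfold G. lra.
  - assert (E := step_g _ _ _ _ HS t). unfold reaction in E.
    pose proof (step_range _ _ _ _ HS t) as R1.
    pose proof (step_range _ _ _ _ HS (t - h)) as R2.
    specialize (Hhar (t - h) t ltac:(lra) Ht). specialize (Hpos t Ht).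
    replace (t - (t - h)) with h in Hhar by ring.
    assert (HG := reaction_gain 1 (m t) (phi t) (m (t - h)) (phi (t - h)) ltac:(lra)
      ltac:(specialize (HmM t Ht); lra) ltac:(lra) ltac:(lra)).
    rewrite !Rmult_1_l in HG. specialize (HG Hhar). specialize (Hsub t Ht).
    unfold G. lra. }
intros t Ht. cut (0 <= K t - (m1 t + a * m t)); [lra |].
apply (backward_nonneg_left (fun u => K u - (m1 u + a * m u))
  (fun u => (zeta * K u - g u) - (m2 u + a * m1 u)) zeta 0); [| | | easy].
- intros u _. pose proof (step_K _ _ _ _ HS) as HdK.
  eapply is_derive_rewrite; [derive | cbv beta; ring].
- intros u Hu. specialize (HgG u Hu). unfold G, beta, zeta in *. lra.
- specialize (HK 0). rewrite Hm0. lra.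
Qed.

(** ** The characteristic function at the unstable state *)

(** The function [chi0] multiplied by [1 - b exp (- z h)], which is positive for [z >= 0]. *)
Definition char_fun (z : R) : R := (z * z - c * z) * (1 - b * exp (- z * h)) + 1.

Definition char_fun' (z : R) : R :=
  (2 * z - c) * (1 - b * exp (- z * h)) + (z * z - c * z) * (b * h * exp (- z * h)).

Lemma char_fun_derive (z : R) : is_derive char_fun z (char_fun' z).
Proof.
unfold char_fun, char_fun'. auto_derive; [easy |]. ring.
Qed.

Lemma char_den_pos (z : R) : 0 <= z -> 0 < 1 - b * exp (- z * h).
Proof.
intros Hz. assert (exp (- z * h) <= 1).
{ pose proof (exp_ineq1_le (z * h)) as H1. pose proof (exp_pos (- z * h)) as H2.
  assert (H3 : exp (- z * h) * exp (z * h) = 1)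
    by (rewrite <- exp_plus; replace (- z * h + z * h) with 0 by ring; apply exp_0).
  assert (0 <= z * h) by nra. nra. }
pose proof (exp_pos (- z * h)). nra.
Qed.

(** Divided by its positive delay factor, [char_fun] is [z ^ 2 - c z] plus a convex
    function, hence lies above its tangents with a quadratic margin. *)
Lemma char_fun_convex (p y : R) : 0 <= p -> 0 <= y -> char_fun p = 0 ->
  (y - p) * (y - p) + (y - p) * (char_fun' p / (1 - b * exp (- p * h))) <=
  char_fun y / (1 - b * exp (- y * h)).
Proof.
intros Hp Hy Hroot.
pose proof (char_den_pos p Hp) as Dp. pose proof (char_den_pos y Hy) as Dy.
assert (Hexp : b * exp (- p * h) * (1 - (y - p) * h) <= b * exp (- y * h)).
{ rewrite Rmult_assoc. apply Rmult_le_compat_l; [lra |].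
  replace (- y * h) with (- p * h + - ((y - p) * h)) by ring. rewrite exp_plus.
  apply Rmult_le_compat_l; [left; apply exp_pos |].
  pose proof (exp_ineq1_le (- ((y - p) * h))). lra. }
unfold char_fun in *. unfold char_fun'.
set (xp := b * exp (- p * h)) in *. set (xy := b * exp (- y * h)) in *.
replace (b * h * exp (- p * h)) with (h * xp) by (unfold xp; ring).
assert (Hpp : p * p - c * p = - / (1 - xp)).
{ apply (Rmult_eq_reg_r (1 - xp)); [| lra].
  replace (- / (1 - xp) * (1 - xp)) with (-1) by (field; lra). lra. }
apply Rminus_le_0.
replace (((y * y - c * y) * (1 - xy) + 1) / (1 - xy) - ((y - p) * (y - p) +
   (y - p) * (((2 * p - c) * (1 - xp) + (p * p - c * p) * (h * xp)) / (1 - xp))))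
  with ((p * p - c * p + / (1 - xy)) - (y - p) * ((p * p - c * p) * (h * xp) / (1 - xp)))
  by (field; lra).
rewrite Hpp.
replace (- / (1 - xp) + / (1 - xy) - (y - p) * (- / (1 - xp) * (h * xp) / (1 - xp)))
  with ((xy - xp) * (xy - xp) / ((1 - xy) * ((1 - xp) * (1 - xp))) +
        (xy - xp * (1 - (y - p) * h)) / ((1 - xp) * (1 - xp))) by (field; lra).
assert (Dpp : 0 < (1 - xp) * (1 - xp)) by now apply Rmult_lt_0_compat.
apply Rplus_le_le_0_compat; apply Rdiv_le_0_compat.
- apply Rle_0_sqr.
- now apply Rmult_lt_0_compat.
- lra.
- easy.
Qed.

(** If [char_fun] increases at the given root, then it is negative just to the left; being
    [1] at [0] it has a smaller root, where convexity makes the slope negative. *)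
Lemma leading_root (z0 : R) : 0 < z0 -> char_fun z0 = 0 ->
  exists p, 0 < p /\ char_fun p = 0 /\ char_fun' p <= 0.
Proof.
intros Hz0 Hroot.
destruct (Rle_or_lt (char_fun' z0) 0) as [H | H]; [now exists z0 |].
assert (Hy : exists y, 0 < y < z0 /\ char_fun y < 0).
{ destruct (derive_neg_right (fun x => char_fun (-1 * x + 0)) (- z0) (-1 * char_fun' z0) z0)
    as [e [He1 He2]]; [| lra | easy |].
  - apply is_derive_affine. replace (-1 * - z0 + 0) with z0 by ring. apply char_fun_derive.
  - exists (z0 - e). split; [lra |].
    replace (-1 * (- z0 + e) + 0) with (z0 - e) in He2 by ring.
    replace (-1 * - z0 + 0) with z0 in He2 by ring. lra. }
destruct Hy as [y [Hy1 Hy2]].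
assert (H0 : char_fun 0 = 1) by (unfold char_fun; ring).
destruct (IVT_gen char_fun 0 y 0) as [p [Hp1 Hp2]].
- intros z. apply continuity_pt_filterlim. exact (is_derive_cont _ _ _ (char_fun_derive z)).
- rewrite Rmin_right, Rmax_left by lra. lra.
- rewrite Rmin_left, Rmax_right in Hp1 by lra.
  assert (Hp0 : p <> 0) by (intros ->; lra).
  assert (Hpy : p <> y) by (intros ->; lra).
  exists p. split; [lra | split; [easy |]].
  pose proof (char_fun_convex p y ltac:(lra) ltac:(lra) Hp2) as HC.
  pose proof (char_den_pos p ltac:(lra)) as Dp. pose proof (char_den_pos y ltac:(lra)) as Dy.
  assert (HCy : char_fun y / (1 - b * exp (- y * h)) < 0) by (apply Rdiv_neg_pos; lra).
  destruct (Rle_or_lt (char_fun' p) 0) as [Hd | Hd]; [easy | exfalso].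
  assert (0 < char_fun' p / (1 - b * exp (- p * h))) by now apply Rdiv_lt_0_compat.
  assert (0 < y - p) by lra. nra.
Qed.
(** ** Existence *)

(** Closed under differentiation, with [t exp (p t)] included for a double root [p]. *)
Definition quasi_exp (A B D p r t : R) : R := (A - B * t) * exp (p * t) + D * exp (r * t).

Lemma quasi_exp_derive (A B D p r t : R) :
  is_derive (quasi_exp A B D p r) t (quasi_exp (p * A - B) (p * B) (r * D) p r t).
Proof. unfold quasi_exp. auto_derive; [easy | ring]. Qed.

Lemma quasi_exp_char (A B D p r t : R) : char_fun p = 0 -> B * char_fun' p = 0 ->
  let f := quasi_exp A B D p r in
  let f1 := quasi_exp (p * A - B) (p * B) (r * D) p r in
  let f2 := quasi_exp (p * (p * A - B) - p * B) (p * (p * B)) (r * (r * D)) p r in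
  (f2 t - c * f1 t) - b * (f2 (t - h) - c * f1 (t - h)) + f t = D * char_fun r * exp (r * t).
Proof.
intros H0 H1 f f1 f2. unfold f, f1, f2, quasi_exp.
replace (exp (p * (t - h))) with (exp (p * t) * exp (- p * h))
  by (rewrite <- exp_plus; f_equal; ring).
replace (exp (r * (t - h))) with (exp (r * t) * exp (- r * h))
  by (rewrite <- exp_plus; f_equal; ring).
transitivity (exp (p * t) * ((A - B * t) * char_fun p - B * char_fun' p)
  + D * char_fun r * exp (r * t)).
- unfold char_fun, char_fun'. ring.
- rewrite H0, H1. ring.
Qed.

Lemma quasi_exp_bounded (A B D p r : R) : 0 < p -> 0 < r ->
  exists M, forall t, t <= 0 -> Rabs (quasi_exp A B D p r t) <= M.
Proof.
intros Hp Hr. exists (Rabs A + Rabs B * / p + Rabs D). intros t Ht. unfold quasi_exp.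
pose proof (exp_nonpos_le_1 p t ltac:(lra) Ht) as E1.
pose proof (exp_nonpos_le_1 r t ltac:(lra) Ht) as E2.
pose proof (exp_pos (p * t)) as P1. pose proof (exp_pos (r * t)) as P2.
assert (E3 : - t * exp (p * t) <= / p).
{ apply (Rmult_le_reg_l p); [easy |]. rewrite Rinv_r by lra.
  pose proof (exp_ineq1_le (- (p * t))) as E. rewrite exp_Ropp in E.
  apply (Rmult_le_compat_r (exp (p * t))) in E; [| lra].
  rewrite Rinv_l in E by lra. lra. }
replace ((A - B * t) * exp (p * t)) with (A * exp (p * t) + B * (- t * exp (p * t))) by ring.
eapply Rle_trans; [apply Rabs_triang |].
apply Rplus_le_compat; [eapply Rle_trans; [apply Rabs_triang |]; apply Rplus_le_compat |];
  rewrite Rabs_mult, (Rabs_pos_eq (_ * exp _)) || rewrite Rabs_mult, (Rabs_pos_eq (exp _));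
  try lra.
- pose proof (Rabs_pos A). nra.
- apply Rmult_le_compat_l; [apply Rabs_pos | easy].
- apply Rmult_le_pos; lra.
- pose proof (Rabs_pos D). nra.
Qed.

(** The factor [w = - D - B t + D exp (eps t)] of the lower barrier is nonnegative and
    nonincreasing for [t <= 0] and vanishes at [0]. Applying the linearized operator to
    [exp (p t) w] leaves [D char_fun (p + eps) exp ((p + eps) t)], which dominates the quadratic
    term once the barrier is multiplied by a small [k]. *)
Lemma fixed_point_exists (p D B eps : R) :
  0 < p -> char_fun p = 0 -> 0 <= B <= 1 -> B * char_fun' p = 0 ->
  0 < eps < p -> -1 <= D -> D * eps <= B -> 0 < D * char_fun (p + eps) ->
  exists J phi g, step J phi g J /\ (forall t, 0 <= J t <= a) /\ increasing_fun J /\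
    is_lim phi m_infty 0 /\ is_lim phi p_infty 1.
Proof.
intros Hp Hroot HB HB0 Heps HD HDB HX.
set (r := p + eps) in *.
(* The largest coefficient of [- t] for which [Phi1 + a Phi] still increases on [t <= 0]. *)
set (k0 := p * a / (p + a)).
assert (Hk0 : 0 < k0) by (unfold k0; apply Rdiv_lt_0_compat; nra).
assert (Hk0e : k0 * (p + a) = p * a) by (unfold k0; field; lra).
clearbody k0.
(* Normalizes [Phi1 + a Phi] to the value [a] at [0]. *)
set (A := (a + k0 * B) / (p + a)).
assert (HAe : A * (p + a) = a + k0 * B) by (unfold A; field; lra).
clearbody A.
set (P := quasi_exp A (k0 * B) 0 p p).
set (P1 := quasi_exp (p * A - k0 * B) (p * (k0 * B)) (p * 0) p p).
set (P2 := quasi_exp (p * (p * A - k0 * B) - p * (k0 * B)) (p * (p * (k0 * B)))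
             (p * (p * 0)) p p).
assert (HP1 : forall t, is_derive P t (P1 t)) by (intros; apply quasi_exp_derive).
assert (HP2 : forall t, is_derive P1 t (P2 t)) by (intros; apply quasi_exp_derive).
assert (Hj : forall t, P1 t + a * P t = (a - (p + a) * (k0 * B) * t) * exp (p * t)).
{ intros t. unfold P1, P, quasi_exp.
  replace (p * A) with (a + k0 * B - A * a) by lra. ring. }
destruct (quasi_exp_bounded A (k0 * B) 0 p p Hp Hp) as [M1 HM1]. fold P in HM1.
destruct (quasi_exp_bounded
  (- (p * (p * A - k0 * B) - p * (k0 * B)) + c * (p * A - k0 * B) + beta * A)
  (- (p * (p * (k0 * B))) + c * (p * (k0 * B)) + beta * (k0 * B)) 0 p p Hp Hp) as [M2 HM2].
destruct (upper_barrier P P1 P2 (Rmax M1 M2)) as [U1 [U2 [U3 [U4 U5]]]].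
{ easy. } { easy. }
{ intros t Ht. eapply Rle_trans; [now apply HM1 | apply Rmax_l]. }
{ intros t Ht. eapply Rle_trans; [| apply Rmax_r].
  eapply Rle_trans; [| apply (HM2 t Ht)]. right. f_equal.
  unfold P, P1, P2, quasi_exp. ring. }
{ intros s t Hst Ht. rewrite !Hj.
  apply (derive_nonneg_incr (fun u => (a - (p + a) * (k0 * B) * u) * exp (p * u))
    (fun u => (p * a - (p + a) * (k0 * B) - p * ((p + a) * (k0 * B)) * u) * exp (p * u)));
    [easy | |].
  - intros u _. auto_derive; [easy | ring].
  - intros u Hu. apply Rmult_le_pos; [| left; apply exp_pos].
    replace ((p + a) * (k0 * B)) with (p * a * B) by (rewrite <- Hk0e; ring).
    assert (0 <= p * a * (1 - B)) by (apply Rmult_le_pos; nra).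
    assert (0 <= p * (p * a * B) * (- u)) by (apply Rmult_le_pos; [repeat apply Rmult_le_pos |]; lra).
    lra. }
{ intros t Ht. rewrite Hj. apply Rmult_le_pos; [| left; apply exp_pos].
  assert (0 <= (p + a) * (k0 * B) * (- t)) by (repeat apply Rmult_le_pos; lra). lra. }
{ rewrite Hj, !Rmult_0_r, exp_0. ring. }
{ intros t Ht. right. unfold P, P1, P2. rewrite quasi_exp_char; [ring | easy |].
  rewrite Rmult_assoc, HB0. ring. }
set (J0 := fun t => P1 (clip t) + a * P (clip t)) in *.
(* Half of the exponent [r] bounds each of the two factors of the quadratic term; the
   remaining [nu = p - r / 2] absorbs the factor [1 - t]. *)
set (nu := (p - eps) / 2).
assert (Hnu : 0 < nu) by (unfold nu; lra).
set (M := 1 + / nu).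
assert (HM : 0 < M) by (unfold M; pose proof (Rinv_0_lt_compat nu Hnu); lra).
set (k := Rmin (Rmin k0 (a / (p + a))) (D * char_fun r / (M * M))).
assert (Hk : 0 < k /\ k <= k0 /\ k * (p + a) <= a /\ k * (M * M) <= D * char_fun r).
{ unfold k.
  pose proof (Rmin_l (Rmin k0 (a / (p + a))) (D * char_fun r / (M * M))) as L1.
  pose proof (Rmin_r (Rmin k0 (a / (p + a))) (D * char_fun r / (M * M))) as L2.
  pose proof (Rmin_l k0 (a / (p + a))) as L3. pose proof (Rmin_r k0 (a / (p + a))) as L4.
  assert (HMM : 0 < M * M) by nra.
  split; [| split; [lra | split]].
  - apply Rmin_glb_lt; [apply Rmin_glb_lt; [easy |] |]; apply Rdiv_lt_0_compat; lra.
  - apply Rle_trans with (a / (p + a) * (p + a)); [apply Rmult_le_compat_r; lra |].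
    right. field. lra.
  - apply Rle_trans with (D * char_fun r / (M * M) * (M * M));
      [apply Rmult_le_compat_r; lra |]. right. field. lra. }
clearbody k. destruct Hk as [Hk [Hkk0 [Hka HkX]]].
set (m := quasi_exp (k * - D) (k * B) (k * D) p r).
set (m1 := quasi_exp (p * (k * - D) - k * B) (p * (k * B)) (r * (k * D)) p r).
set (m2 := quasi_exp (p * (p * (k * - D) - k * B) - p * (k * B)) (p * (p * (k * B)))
             (r * (r * (k * D))) p r).
assert (Hm1 : forall t, is_derive m t (m1 t)) by (intros; apply quasi_exp_derive).
assert (Hm2 : forall t, is_derive m1 t (m2 t)) by (intros; apply quasi_exp_derive).
assert (Hr : 0 < r) by (unfold r; lra).
set (w := fun t => - D - B * t + D * exp (eps * t)).
assert (Her : forall t, exp (r * t) = exp (p * t) * exp (eps * t)).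
{ intros t. rewrite <- exp_plus. f_equal. unfold r. ring. }
assert (Hmw : forall t, m t = k * (exp (p * t) * w t)).
{ intros t. unfold m, quasi_exp, w. rewrite Her. ring. }
assert (HDn : D <> 0) by (intros ->; lra).
assert (Hw : forall t, t <= 0 -> 0 <= w t <= 1 - B * t /\ - B + D * eps * exp (eps * t) <= 0).
{ intros t Ht. unfold w.
  pose proof (exp_nonpos_le_1 eps t ltac:(lra) Ht) as E1.
  pose proof (exp_pos (eps * t)) as E2. pose proof (exp_ineq1_le (eps * t)) as E3.
  set (e := exp (eps * t)) in *.
  destruct (Rle_or_lt 0 D) as [HDs | HDs].
  - assert (D * (eps * t) <= D * (e - 1)) by (apply Rmult_le_compat_l; lra).
    assert (B * t <= D * eps * t) by nra.
    assert (D * (e - 1) <= 0) by nra.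
    assert (D * eps * e <= D * eps * 1) by (apply Rmult_le_compat_l; nra). lra.
  - assert (0 <= - D * (1 - e) <= 1) by nra. assert (D * eps * e <= 0).
    { assert (0 <= - D * (eps * e)) by (apply Rmult_le_pos; nra). lra. }
    nra. }
assert (Hw1 : 0 < w (-1)).
{ unfold w. pose proof (exp_ineq1 (eps * -1) ltac:(lra)) as E3.
  pose proof (exp_nonpos_le_1 (eps / 2) (-1) ltac:(lra) ltac:(lra)) as E1.
  assert (E4 : exp (eps * -1) < 1) by (rewrite <- exp_0; apply exp_increasing; lra).
  set (e := exp (eps * -1)) in *.
  destruct (Rle_or_lt 0 D) as [HDs | HDs]; nra. }
assert (HmE : forall t, t <= 0 -> 0 <= m t <= k * M * exp (r / 2 * t)).
{ intros t Ht. destruct (Hw t Ht) as [Hwt _]. rewrite Hmw.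
  pose proof (exp_pos (p * t)) as E1. split.
  - repeat apply Rmult_le_pos; lra.
  - rewrite Rmult_assoc. apply Rmult_le_compat_l; [lra |].
    replace (p * t) with (nu * t + r / 2 * t) by (unfold nu, r; field).
    rewrite exp_plus, (Rmult_comm (exp (nu * t))), Rmult_assoc, (Rmult_comm M).
    apply Rmult_le_compat_l; [left; apply exp_pos |].
    pose proof (exp_ineq1_le (- (nu * t))) as E. rewrite exp_Ropp in E.
    pose proof (exp_pos (nu * t)) as E2.
    apply (Rmult_le_compat_r (exp (nu * t))) in E; [| lra]. rewrite Rinv_l in E by lra.
    assert (HwM : w t <= M * (1 + - (nu * t))).
    { apply Rle_trans with (1 - t); [nra |]. unfold M.
      replace ((1 + / nu) * (1 + - (nu * t))) with (1 + / nu - nu * t - t) by (field; lra).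
      pose proof (Rinv_0_lt_compat nu Hnu). nra. }
    apply Rle_trans with (exp (nu * t) * (M * (1 + - (nu * t))));
      [apply Rmult_le_compat_l; lra |].
    rewrite <- (Rmult_1_r M) at 2.
    replace (exp (nu * t) * (M * (1 + - (nu * t)))) with (M * ((1 + - (nu * t)) * exp (nu * t)))
      by ring.
    apply Rmult_le_compat_l; lra. }
assert (Hm0 : m 0 = 0) by (rewrite Hmw; unfold w; rewrite !Rmult_0_r, exp_0; ring).
assert (Hmj : forall t, t <= 0 -> m1 t + a * m t <= J0 t).
{ intros t Ht. unfold J0. rewrite clip_left, Hj by easy.
  replace (m1 t + a * m t) with
    (k * ((- B + D * eps * exp (eps * t)) + (p + a) * w t) * exp (p * t))
    by (unfold m1, m, quasi_exp, w; rewrite Her; unfold r; ring).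
  apply Rmult_le_compat_r; [left; apply exp_pos |].
  destruct (Hw t Ht) as [[_ Hwt] Hwd].
  apply Rle_trans with (k * ((p + a) * (1 - B * t))).
  - apply Rmult_le_compat_l; [lra |].
    assert ((p + a) * w t <= (p + a) * (1 - B * t)) by (apply Rmult_le_compat_l; lra). lra.
  - assert (0 <= (k0 - k) * ((p + a) * (B * - t)))
      by (repeat apply Rmult_le_pos; lra). lra. }
destruct (quasi_exp_bounded
  (- (p * (p * (k * - D) - k * B) - p * (k * B)) + c * (p * (k * - D) - k * B)
     + beta * (k * - D))
  (- (p * (p * (k * B))) + c * (p * (k * B)) + beta * (k * B))
  (- (r * (r * (k * D))) + c * (r * (k * D)) + beta * (k * D)) p r Hp Hr) as [M3 HM3].
assert (Hlow : forall J phi g K, step J phi g K -> (forall t, 0 <= J t <= a) ->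
  (forall t, t <= 0 -> m1 t + a * m t <= J t) ->
  (forall t, t <= 0 -> m t <= phi t) /\ (forall t, t <= 0 -> m1 t + a * m t <= K t)).
{ apply (lower_barrier m m1 m2 (Rmax (k * M) M3)); try easy.
  - intros t Ht. split; [apply HmE, Ht |]. eapply Rle_trans; [| apply Rmax_l].
    eapply Rle_trans; [apply HmE, Ht |].
    rewrite <- (Rmult_1_r (k * M)) at 2. apply Rmult_le_compat_l; [nra |].
    apply exp_nonpos_le_1; lra.
  - intros t Ht. eapply Rle_trans; [| apply Rmax_r].
    eapply Rle_trans; [| apply (HM3 t Ht)]. right. f_equal.
    unfold m, m1, m2, quasi_exp. ring.
  - unfold m1, quasi_exp. rewrite !Rmult_0_r, exp_0.
    replace ((p * (k * - D) - k * B - 0) * 1 + r * (k * D) * 1) with (k * (D * eps - B))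
      by (unfold r; ring). nra.
  - intros t Ht.
    assert (E : (m2 t - c * m1 t) - b * (m2 (t - h) - c * m1 (t - h)) + m t =
      k * D * char_fun r * exp (r * t)).
    { apply quasi_exp_char; [easy |]. rewrite Rmult_assoc, HB0. ring. }
    assert (Hprod : m t * m (t - h) <= k * D * char_fun r * exp (r * t)).
    { pose proof (HmE t Ht) as [Q1 Q2]. pose proof (HmE (t - h) ltac:(lra)) as [Q3 Q4].
      assert (Q5 : exp (r / 2 * (t - h)) <= exp (r / 2 * t)).
      { replace (r / 2 * (t - h)) with (r / 2 * t + r / 2 * - h) by ring.
        rewrite exp_plus. rewrite <- (Rmult_1_r (exp (r / 2 * t))) at 2.
        apply Rmult_le_compat_l; [left; apply exp_pos | apply exp_nonpos_le_1; lra]. }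
      assert (HkM : 0 <= k * M) by nra.
      apply Rle_trans with ((k * M * exp (r / 2 * t)) * (k * M * exp (r / 2 * t))).
      - apply Rmult_le_compat; try easy. eapply Rle_trans; [exact Q4 |].
        now apply Rmult_le_compat_l.
      - replace (r * t) with (r / 2 * t + r / 2 * t) by field. rewrite exp_plus.
        pose proof (exp_pos (r / 2 * t)) as Q6. set (e := exp (r / 2 * t)) in *.
        replace (k * M * e * (k * M * e)) with (k * (e * e) * (k * (M * M))) by ring.
        replace (k * D * char_fun r * (e * e)) with (k * (e * e) * (D * char_fun r)) by ring.
        apply Rmult_le_compat_l; [apply Rmult_le_pos; nra | easy]. }
    lra. }
destruct (monotone_iteration J0 (fun t => m1 t + a * m t) U1 U2 U3 U5) as
  [J [phi [g [HS [HJ [HJi [HJl HJu]]]]]]].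
{ intros J phi g K H1 H2 H3. apply (Hlow J phi g K H1 H2 H3). }
{ exact Hmj. }
exists J, phi, g. split; [easy | split; [easy | split; [easy |]]].
apply (fixed_point_limits J phi g 0 (-1) HS HJ HJi).
- destruct (step_le _ _ _ _ _ _ _ _ (next_step J0 U1 U3) HS HJu) as [H1 _].
  eapply Rle_lt_trans; [apply H1 |]. rewrite U4 by lra.
  unfold P, quasi_exp. rewrite !Rmult_0_r, exp_0.
  assert (k0 < p) by (apply (Rmult_lt_reg_r (p + a)); nra).
  assert (A < 1) by (apply (Rmult_lt_reg_r (p + a)); nra). lra.
- destruct (Hlow J phi g J HS HJ HJl) as [H1 _].
  eapply Rlt_le_trans; [| apply (H1 (-1)); lra]. rewrite Hmw.
  apply Rmult_lt_0_compat; [easy |]. apply Rmult_lt_0_compat; [apply exp_pos | easy].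
Qed.

(** A simple and a double leading root are handled by the same barriers: a simple root has
    [char_fun < 0] just to its right, and at a double root the resonant factor [t] becomes
    available. *)
Lemma front_exists (tau p : R) : h = c * tau ->
  0 < p -> char_fun p = 0 -> char_fun' p <= 0 -> exists phi, monotone_front b tau c phi.
Proof.
intros Htau Hp Hroot Hd.
assert (H : exists J phi g, step J phi g J /\ (forall t, 0 <= J t <= a) /\
  increasing_fun J /\ is_lim phi m_infty 0 /\ is_lim phi p_infty 1).
{ destruct (Rle_lt_or_eq_dec _ _ Hd) as [Hneg | Hzero].
  - destruct (derive_neg_right char_fun p _ p (char_fun_derive p) Hneg Hp) as [e [He1 He2]].
    apply (fixed_point_exists p (-1) 0 e); lra.
  - set (e := Rmin p 1 / 2).
    assert (He : 0 < e < p /\ e <= 1).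
    { unfold e. pose proof (Rmin_l p 1). pose proof (Rmin_r p 1).
      pose proof (Rmin_glb_lt p 1 0 Hp ltac:(lra)). lra. }
    apply (fixed_point_exists p 1 1 e); try lra.
    pose proof (char_fun_convex p (p + e) ltac:(lra) ltac:(lra) Hroot) as HC.
    pose proof (char_den_pos (p + e) ltac:(lra)) as Dy.
    set (y := char_fun (p + e) / (1 - b * exp (- (p + e) * h))) in HC.
    replace (char_fun (p + e)) with (y * (1 - b * exp (- (p + e) * h))) by (unfold y; field; lra).
    assert (0 < y).
    { replace (p + e - p) with e in HC by ring.
      rewrite Hzero in HC. unfold Rdiv in HC. rewrite Rmult_0_l, Rmult_0_r in HC. nra. }
    rewrite Rmult_1_l. now apply Rmult_lt_0_compat. }
destruct H as [J [phi [g [HS [HJ [Hi [L0 L1]]]]]]].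
exists phi. now apply (fixed_point_front tau J phi g).
Qed.
(** ** Fronts are fixed points *)

(** The roots [zeta] and [- a] of the characteristic polynomial are real and nonzero, so no
    nontrivial solution is bounded on the whole line. *)
Lemma bounded_homogeneous (d d1 : R -> R) (M : R) :
  (forall t, is_derive d t (d1 t)) -> (forall t, is_derive d1 t (c * d1 t + beta * d t)) ->
  (forall t, Rabs (d t) <= M) -> forall t, d t = 0.
Proof.
intros Hd Hd1 HM. pose proof zeta_pos as Hz.
assert (Hj : forall t, is_derive (fun t => d1 t + a * d t) t (zeta * (d1 t + a * d t))).
{ intros t. eapply is_derive_rewrite; [derive | cbv beta; unfold beta, zeta; ring]. }
set (j := fun t => d1 t + a * d t) in *.
set (k := / (zeta + a)).
assert (Hk : 0 < k) by (apply Rinv_0_lt_compat; lra).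
(* The component of [d] along the other exponential, which decays forwards. *)
set (y := fun t => d t - k * j t).
assert (Hy : forall t, is_derive y t (- a * y t)).
{ intros t. unfold y. eapply is_derive_rewrite; [derive | cbv beta].
  unfold j. replace (d1 t) with ((zeta + a) * (k * d1 t)) at 1
    by (unfold k; field; lra).
  replace (d t) with ((zeta + a) * (k * d t)) at 3 by (unfold k; field; lra). ring. }
assert (Hyb : forall s t, s <= t -> Rabs (y t) <= Rabs (y s)).
{ intros s t Hst.
  assert (G1 := exp_growth y (fun u => - a * y u) (- a) s t Hst
    (fun u _ => Hy u) (fun u _ => Rle_refl _)).
  assert (G2 := exp_growth (fun u => - y u) (fun u => - (- a * y u)) (- a) s t Hst
    (fun u _ => is_derive_neg _ _ _ (Hy u)) ltac:(intros; lra)).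
  assert (He : exp (- a * (t - s)) <= 1).
  { rewrite <- exp_0. destruct (Req_dec s t) as [-> | Hne].
    - right. f_equal. ring.
    - left. apply exp_increasing. nra. }
  pose proof (exp_pos (- a * (t - s))) as He0.
  replace (y t) with (y s * exp (- a * (t - s))) by lra.
  rewrite Rabs_mult, (Rabs_pos_eq (exp _)) by lra.
  pose proof (Rabs_pos (y s)). nra. }
assert (Hj0 : forall t, j t = 0).
{ intros s. set (N := (M + Rabs (y s)) / k).
  assert (HN : forall t, s <= t -> Rabs (j t) <= N).
  { intros t Hst. unfold N. replace (j t) with ((d t - y t) / k) by (unfold y; field; lra).
    unfold Rdiv. rewrite Rabs_mult, Rabs_inv, (Rabs_pos_eq k) by lra.
    apply Rmult_le_compat_r; [left; now apply Rinv_0_lt_compat |].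
    unfold Rminus. eapply Rle_trans; [apply Rabs_triang |]. rewrite Rabs_Ropp.
    apply Rplus_le_compat; [apply HM | now apply Hyb]. }
  assert (H1 : 0 <= j s).
  { apply (backward_nonneg j (fun t => zeta * j t) zeta s N Hz); intros; try lra.
    - apply Hj.
    - specialize (HN u H). apply Rabs_le_between in HN. lra. }
  assert (H2 : 0 <= - j s).
  { apply (backward_nonneg (fun t => - j t) (fun t => - (zeta * j t)) zeta s N Hz);
      intros; try lra.
    - apply is_derive_neg, Hj.
    - specialize (HN u H). apply Rabs_le_between in HN. lra. }
  lra. }
assert (Hd' : forall t, d1 t = - a * d t) by (intros t; specialize (Hj0 t); unfold j in Hj0; lra).
intros t.
assert (H1 : 0 <= d t).
{ apply (forward_nonneg d d1 a t M Ha); intros; try lra.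
  - apply Hd.
  - rewrite Hd'. lra.
  - specialize (HM u). apply Rabs_le_between in HM. lra. }
assert (H2 : 0 <= - d t).
{ apply (forward_nonneg (fun t => - d t) (fun t => - d1 t) a t M Ha); intros; try lra.
  - apply is_derive_neg, Hd.
  - rewrite Hd'. lra.
  - specialize (HM u). apply Rabs_le_between in HM. lra. }
lra.
Qed.

Record front_profile (phi J g : R -> R) : Prop := {
  fp_step : step J phi g J;
  fp_increasing : increasing_fun phi;
  fp_pos : forall t, 0 < phi t;
  fp_small : forall eps, 0 < eps -> exists T, forall t, t <= T -> phi t <= eps
}.

Lemma reaction_increasing_bounds (phi : R -> R) (t : R) :
  increasing_fun phi -> (forall u, 0 <= phi u <= 1) ->
  beta * (1 - b) * phi t <= reaction phi t <= (beta + 1) * phi t.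
Proof.
intros Hi Hr. pose proof (Hr t). pose proof (Hr (t - h)). pose proof beta_pos.
pose proof (Hi (t - h) t ltac:(lra)). unfold reaction. split.
- assert (0 <= phi t * (1 - phi (t - h))) by (apply Rmult_le_pos; lra).
  assert (beta * ((1 - b) * phi t) <= beta * (phi t - b * phi (t - h)))
    by (apply Rmult_le_compat_l; nra). lra.
- assert (beta * (phi t - b * phi (t - h)) <= beta * phi t)
    by (apply Rmult_le_compat_l; nra). nra.
Qed.

Lemma front_shape (tau : R) (phi : R -> R) : monotone_front b tau c phi ->
  increasing_fun phi /\ (forall t, 0 <= phi t <= 1) /\
  (forall eps, 0 < eps -> exists T, forall t, t <= T -> phi t <= eps) /\
  (exists T, 1 / 2 < phi T).
Proof.
intros [_ [Hm [_ [_ [L0 L1]]]]].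
apply is_lim_spec in L0. apply is_lim_spec in L1.
assert (S0 : forall eps, 0 < eps -> exists T, forall t, t < T -> Rabs (phi t) < eps).
{ intros eps He. destruct (L0 (mkposreal eps He)) as [T HT]. exists T. intros t Ht.
  specialize (HT t Ht). now rewrite Rminus_0_r in HT. }
assert (S1 : forall eps, 0 < eps -> exists T, forall t, T < t -> Rabs (phi t - 1) < eps).
{ intros eps He. destruct (L1 (mkposreal eps He)) as [T HT]. now exists T. }
assert (Hi : increasing_fun phi).
{ destruct Hm as [Hm | Hm]; [exact Hm | exfalso].
  destruct (S0 (1 / 3) ltac:(lra)) as [T0 H0]. destruct (S1 (1 / 3) ltac:(lra)) as [T1 H1].
  pose proof (Rmin_l T0 T1). pose proof (Rmax_r T0 T1).
  specialize (H0 (Rmin T0 T1 - 1) ltac:(lra)). specialize (H1 (Rmax T0 T1 + 1) ltac:(lra)).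
  specialize (Hm (Rmin T0 T1 - 1) (Rmax T0 T1 + 1)).
  pose proof (Rmax_l T0 T1). pose proof (Rmin_r T0 T1).
  specialize (Hm ltac:(lra)). apply Rabs_lt_between in H0. apply Rabs_lt_between in H1. lra. }
split; [easy |]. split; [intros t; split | split].
- destruct (Rle_or_lt 0 (phi t)) as [H | H]; [easy | exfalso].
  destruct (S0 (- phi t) ltac:(lra)) as [T HT].
  pose proof (Rmin_l T t). pose proof (Rmin_r T t).
  specialize (HT (Rmin T t - 1) ltac:(lra)).
  specialize (Hi (Rmin T t - 1) t ltac:(lra)). apply Rabs_lt_between in HT. lra.
- destruct (Rle_or_lt (phi t) 1) as [H | H]; [easy | exfalso].
  destruct (S1 (phi t - 1) ltac:(lra)) as [T HT].
  pose proof (Rmax_l T t). pose proof (Rmax_r T t).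
  specialize (HT (Rmax T t + 1) ltac:(lra)).
  specialize (Hi t (Rmax T t + 1) ltac:(lra)). apply Rabs_lt_between in HT. lra.
- intros eps He. destruct (S0 eps He) as [T HT]. exists (T - 1). intros t Ht.
  specialize (HT t ltac:(lra)). apply Rabs_lt_between in HT. lra.
- destruct (S1 (1 / 2) ltac:(lra)) as [T HT]. exists (T + 1).
  specialize (HT (T + 1) ltac:(lra)). apply Rabs_lt_between in HT. lra.
Qed.

Lemma increasing_step_nonneg (J phi g : R -> R) : step J phi g J -> increasing_fun phi ->
  (forall t, 0 <= g t) /\ (forall t, 0 <= J t).
Proof.
intros H Hi.
destruct (step_g_bounded _ _ _ _ H) as [M HM].
destruct (step_K_bounded _ _ _ _ H) as [N HN].
assert (Hg : forall t, 0 <= g t).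
{ intros t. apply (delay_nonneg b h t M g Hb Hh); [| | apply Rle_refl]; intros u _.
  - specialize (HM u). apply Rabs_le_between in HM. lra.
  - rewrite (step_g _ _ _ _ H).
    pose proof (reaction_increasing_bounds phi u Hi (step_range _ _ _ _ H)) as [H1 _].
    pose proof (step_range _ _ _ _ H u). pose proof beta_pos.
    assert (0 <= beta * (1 - b) * phi u) by (apply Rmult_le_pos; [apply Rmult_le_pos |]; lra). lra. }
split; [easy |]. intros t.
apply (backward_nonneg J (fun u => zeta * J u - g u) zeta t N zeta_pos);
  [| | | apply Rle_refl]; intros u _.
- apply (step_K _ _ _ _ H).
- specialize (Hg u). lra.
- specialize (HN u). apply Rabs_le_between in HN. lra.
Qed.

(** The delayed equation only makes the neutral part [v] smooth. The bounded
    solution obtained by inverting the delay first has the same neutral part,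
    because their difference solves a homogeneous equation. *)
Lemma front_is_fixed_point (tau : R) (phi : R -> R) : h = c * tau ->
  monotone_front b tau c phi -> exists J g, front_profile phi J g.
Proof.
intros Htau HF. destruct (front_shape tau phi HF) as [Hi [Hr [Hs [T0 HT0]]]].
destruct HF as [_ [_ [[Hsm _] [Heq _]]]]. rewrite <- Htau in Hsm, Heq.
set (v := fun t => phi t - b * phi (t - h)) in *.
set (v1 := Derive v).
assert (Hv : forall t, is_derive v t (v1 t))
  by (intros t; apply Derive_correct, (Hsm 1%nat t); lia).
assert (Hv1 : forall t, is_derive v1 t (c * v1 t - phi t * (1 - phi (t - h)))).
{ intros t. replace (c * v1 t - phi t * (1 - phi (t - h))) with (Derive v1 t).
  - apply Derive_correct, (Hsm 2%nat t). lia.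
  - specialize (Heq t). change (Derive_n v 2 t) with (Derive v1 t) in Heq.
    change (Derive v t) with (v1 t) in Heq. lra. }
assert (Hphic : forall t, continuous phi t).
{ apply (delay_continuous b h 1 v phi Hb).
  - intros t. specialize (Hr t). rewrite Rabs_pos_eq; lra.
  - reflexivity.
  - intros t. exact (is_derive_cont _ _ _ (Hv t)). }
assert (HFb : forall t, 0 <= reaction phi t <= beta + 1).
{ intros t. pose proof (reaction_increasing_bounds phi t Hi Hr) as [H1 H2].
  specialize (Hr t). pose proof beta_pos.
  assert (0 <= beta * (1 - b) * phi t) by (apply Rmult_le_pos; [apply Rmult_le_pos |]; lra). nra. }
destruct (delay_inverse_spec b h (beta + 1) (reaction phi) Hb HFb) as [Hg Hgb].
set (g := delay_inverse b h (reaction phi)) in *.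
set (Mg := (beta + 1) / (1 - b)) in *.
assert (Hgc : forall t, continuous g t).
{ apply (delay_continuous b h Mg (reaction phi) g Hb); [| exact Hg |].
  - intros t. rewrite Rabs_pos_eq; apply Hgb.
  - intros t. unfold reaction.
    assert (Hvc : continuous v t) by exact (is_derive_cont _ _ _ (Hv t)).
    assert (Hdc : continuous (fun u => phi (u - h)) t).
    { apply (continuous_comp (fun u => u - h) phi); [| apply Hphic].
      exact (is_derive_cont _ _ _ (is_derive_sub _ _ _ _ _ (is_derive_var t)
        (is_derive_cst h t))). }
    apply (continuous_plus (fun u => beta * v u) (fun u => phi u * (1 - phi (u - h)))).
    + apply (continuous_mult (fun _ => beta) v); [apply continuous_const | easy].
    + apply (continuous_mult phi (fun u => 1 - phi (u - h))); [apply Hphic |].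
      apply (continuous_minus (fun _ => 1) (fun u => phi (u - h)));
        [apply continuous_const | easy]. }
destruct (backward_resolvent_spec zeta Mg g zeta_pos Hgc Hgb) as [HJ HJb].
set (J := backward_resolvent zeta g) in *.
assert (HJc : forall t, continuous J t) by (intros t; exact (is_derive_cont _ _ _ (HJ t))).
destruct (forward_resolvent_spec a (Mg / zeta) J Ha HJc HJb) as [Hf Hfb].
set (f := forward_resolvent a J) in *. set (Mf := Mg / zeta / a) in *.
set (f1 := fun t => J t - a * f t) in *.
assert (Hf1 : forall t, is_derive f1 t (c * f1 t + beta * f t - g t)).
{ intros t. unfold f1. eapply is_derive_rewrite; [derive | cbv beta].
  unfold f1, beta, zeta. ring. }
assert (Hd : forall t, f t - b * f (t - h) - v t = 0).
{ apply (bounded_homogeneous (fun t => f t - b * f (t - h) - v t)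
    (fun t => f1 t - b * f1 (t - h) - v1 t) (2 * Mf + 2)); intros t.
  - eapply is_derive_rewrite; [derive | unfold f1; ring].
  - eapply is_derive_rewrite; [derive | cbv beta].
    assert (E : g t = reaction phi t + b * g (t - h)) by (rewrite <- Hg; ring).
    rewrite E. unfold reaction, v. ring.
  - pose proof (Hfb t). pose proof (Hfb (t - h)). pose proof (Hr t). pose proof (Hr (t - h)).
    unfold v. apply Rabs_le. nra. }
assert (Hfphi : forall t, f t = phi t).
{ intros t.
  assert (H1 : 0 <= f t - phi t).
  { apply (delay_nonneg b h t 1 (fun u => f u - phi u) Hb Hh); [| | apply Rle_refl];
      intros u _.
    - specialize (Hfb u). specialize (Hr u). lra.
    - specialize (Hd u). unfold v in Hd. lra. }
  assert (H2 : 0 <= phi t - f t).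
  { apply (delay_nonneg b h t Mf (fun u => phi u - f u) Hb Hh); [| | apply Rle_refl];
      intros u _.
    - specialize (Hfb u). specialize (Hr u). lra.
    - specialize (Hd u). unfold v in Hd. lra. }
  lra. }
assert (HS : step J phi g J).
{ split; try easy.
  - intros t. apply (is_derive_ext f); [apply Hfphi |]. rewrite <- Hfphi. apply Hf.
  - exists Mg. intros t. rewrite Rabs_pos_eq; apply Hgb.
  - exists (Mg / zeta). intros t. rewrite Rabs_pos_eq; apply HJb. }
exists J, g. split; try easy.
intros t. destruct (proj1 (Hr t)) as [H | H]; [easy | exfalso].
(* A zero of [phi] is a zero of [J] a little earlier, and both persist forwards. *)
destruct (mean_value phi (fun u => J u - a * phi u) (t - 1) t) as [xi [Hxi He]];
  [lra | intros; apply (step_phi _ _ _ _ HS) |].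
assert (Hz : forall u, u <= t -> phi u = 0).
{ intros u Hu. pose proof (Hi u t Hu). specialize (Hr u). lra. }
assert (HJxi : J xi = 0).
{ rewrite (Hz t), (Hz (t - 1)) in He by lra.
  specialize (Hz xi ltac:(lra)). rewrite Hz in He. lra. }
assert (HJz : forall u, xi <= u -> J u <= 0).
{ intros u Hu.
  assert (G := exp_growth (fun u => - J u) (fun u => - (zeta * J u - g u)) zeta xi u Hu
    (fun s _ => is_derive_neg _ _ _ (HJ s)) ltac:(intros s _; specialize (Hgb s); lra)).
  cbv beta in G. rewrite HJxi in G. lra. }
assert (HT : t < T0).
{ destruct (Rle_or_lt T0 t) as [Hle | Hlt]; [| easy]. specialize (Hz T0 Hle). lra. }
assert (G := derive_nonneg_incr (fun u => - phi u) (fun u => - (J u - a * phi u)) t T0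
  ltac:(lra) (fun s _ => is_derive_neg _ _ _ (step_phi _ _ _ _ HS s))).
assert (- phi t <= - phi T0); [| lra]. apply G. intros u Hu.
specialize (HJz u ltac:(lra)). specialize (Hr u). nra.
Qed.
(** * Behaviour at the unstable state *)

Section Leading.

Context (p : R).
Hypothesis Hp : 0 < p.
Hypothesis Hroot : char_fun p = 0.
Hypothesis Hlead : char_fun' p <= 0.

(** The weight [exp (- p t)] turns [b f_h] into [delay_factor * (exp (- p t) f)_h]. *)
Definition delay_factor : R := b * exp (- p * h).
Definition delay_gain : R := / (1 - delay_factor).

Lemma delay_factor_range : 0 <= delay_factor < 1.
Proof.
unfold delay_factor. pose proof (char_den_pos p ltac:(lra)). pose proof (exp_pos (- p * h)).
split; [apply Rmult_le_pos |]; lra.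
Qed.

Lemma delay_gain_pos : 0 < delay_gain.
Proof. apply Rinv_0_lt_compat. pose proof delay_factor_range. lra. Qed.

Lemma delay_gain_eq : delay_gain * (1 - delay_factor) = 1.
Proof. unfold delay_gain. pose proof delay_factor_range. field. lra. Qed.

Lemma root_eq : c * p - p * p = delay_gain.
Proof.
pose proof delay_factor_range. apply (Rmult_eq_reg_r (1 - delay_factor)); [| lra].
rewrite delay_gain_eq. unfold char_fun in Hroot. fold delay_factor in Hroot. lra.
Qed.

Lemma root_lt_speed : p < c.
Proof. pose proof root_eq. pose proof delay_gain_pos. nra. Qed.

Definition weighted (d : R -> R) (t : R) : R := exp (- p * t) * d t.

Definition primitives (d W W2 : R -> R) : Prop :=
  (forall t, is_derive W t (weighted d t)) /\ (forall t, is_derive W2 t (W t)).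

(** The conserved quantity of the linearization at [0]: written for [w = exp (- p t) d], that
    equation has constant solutions, because [p] is a root, and so it is a total derivative.
    The primitive [W] of [w] enters only through its increments. *)
Definition flux (d d1 W : R -> R) (t : R) : R :=
  exp (- p * t) * ((d1 t - b * d1 (t - h)) - (c - p) * (d t - b * d (t - h)))
  - delay_gain * delay_factor * (W t - W (t - h)).

Definition slope : R := Rmax (2 * p - c) 0.

(** A multiple of [w] up to constants ([energy_bounds]), whose derivative is the flux plus
    a source of one sign ([energy_derive], [source_bounds]). The term with [slope] is there
    for [2 p > c], where [(c - 2 p) w] has the wrong sign; with it, the sources add up to
    [- char_fun' p * w]. *)
Definition energy (d W W2 : R -> R) (t : R) : R :=
  exp (- p * t) * (d t - b * d (t - h)) + delay_factor * slope * (W t - W (t - h))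
  + delay_gain * delay_factor * (h * W t - W2 t + W2 (t - h)).

Definition source (d : R -> R) (t : R) : R :=
  exp (- p * t) * ((c - 2 * p) * (d t - b * d (t - h)))
  + delay_factor * slope * (weighted d t - weighted d (t - h))
  + delay_gain * delay_factor * h * weighted d t.

Lemma weighted_delay (d : R -> R) (t : R) :
  delay_factor * weighted d (t - h) = b * (exp (- p * t) * d (t - h)).
Proof.
unfold delay_factor, weighted.
replace (- p * (t - h)) with (- p * t + - (- p * h)) by ring.
rewrite exp_plus, exp_Ropp. field. apply Rgt_not_eq, exp_pos.
Qed.

(** With [d] for [phi], the bracket is the linearized equation at [0]. *)
Lemma flux_derive (d d1 d2 W W2 : R -> R) (t : R) : primitives d W W2 ->
  (forall u, is_derive d u (d1 u)) -> (forall u, is_derive d1 u (d2 u)) ->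
  is_derive (flux d d1 W) t (exp (- p * t) *
    ((d2 t - b * d2 (t - h)) - c * (d1 t - b * d1 (t - h)) + d t)).
Proof.
intros [HW _] Hd Hd1. unfold flux.
eapply is_derive_rewrite; [derive | cbv beta].
assert (E := weighted_delay d t).
transitivity (exp (- p * t) *
   ((d2 t - b * d2 (t - h)) - c * (d1 t - b * d1 (t - h))
     + (c * p - p * p) * (d t - b * d (t - h)))
   - delay_gain * delay_factor * weighted d t + delay_gain * (delay_factor * weighted d (t - h))); [ring |].
rewrite E, root_eq. unfold weighted.
replace (exp (- p * t) * (d2 t - b * d2 (t - h) - c * (d1 t - b * d1 (t - h)) + d t)) with
  (exp (- p * t) * (d2 t - b * d2 (t - h) - c * (d1 t - b * d1 (t - h)) + delay_gain * (1 - delay_factor) * d t))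
  by (rewrite delay_gain_eq; ring).
ring.
Qed.

Lemma energy_derive (d d1 W W2 : R -> R) (t : R) : primitives d W W2 ->
  (forall u, is_derive d u (d1 u)) ->
  is_derive (energy d W W2) t (flux d d1 W t + source d t).
Proof.
intros [HW HW2] Hd. unfold energy.
eapply is_derive_rewrite; [derive | cbv beta]. unfold flux, source. ring.
Qed.

Definition ordered (T : R) (d : R -> R) : Prop :=
  (forall t, t <= T -> 0 <= d t) /\
  (forall s t, s <= t -> t <= T -> d s <= exp (a * (t - s)) * d t).

Definition window : R := h * exp ((a + p) * h).

(** The delayed part is controlled by the present one, with [b exp (a h) < 1]. *)
Lemma neutral_bounds (T : R) (d : R -> R) (t : R) : ordered T d -> t <= T ->
  contraction * weighted d t <= exp (- p * t) * (d t - b * d (t - h)) <= weighted d t.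
Proof.
intros [H1 H2] Ht. unfold weighted, contraction.
pose proof (exp_pos (- p * t)) as E. specialize (H2 (t - h) t ltac:(lra) Ht).
replace (t - (t - h)) with h in H2 by ring. pose proof (H1 (t - h) ltac:(lra)) as H3.
specialize (H1 t Ht). split.
- replace ((1 - b * exp (a * h)) * (exp (- p * t) * d t)) with
    (exp (- p * t) * (d t - b * (exp (a * h) * d t))) by ring.
  apply Rmult_le_compat_l; [lra |]. nra.
- apply Rmult_le_compat_l; [lra |]. nra.
Qed.

Lemma weighted_nonneg (T : R) (d : R -> R) (t : R) : ordered T d -> t <= T ->
  0 <= weighted d t.
Proof. intros [H1 _] Ht. apply Rmult_le_pos; [left; apply exp_pos | now apply H1]. Qed.

Lemma window_bounds (T : R) (d W W2 : R -> R) (t : R) : primitives d W W2 ->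
  ordered T d -> t <= T ->
  0 <= W t - W (t - h) <= window * weighted d t /\
  0 <= h * W t - W2 t + W2 (t - h) <= h * (window * weighted d t).
Proof.
intros [HW HW2] Ho Ht.
assert (Hwt : 0 <= weighted d t) by now apply (weighted_nonneg T).
assert (HWi : forall s u, s <= u -> u <= T -> W s <= W u).
{ intros s u Hsu Hu. apply (derive_nonneg_incr W (weighted d)); [easy | intros; apply HW |].
  intros r Hr. apply (weighted_nonneg T d r Ho). lra. }
assert (H1 : 0 <= W t - W (t - h) <= window * weighted d t).
{ split; [specialize (HWi (t - h) t ltac:(lra) Ht); lra |].
  destruct (mean_value W (weighted d) (t - h) t) as [r [Hr He]]; [lra | intros; apply HW |].
  rewrite He. replace (t - (t - h)) with h by ring. rewrite (Rmult_comm _ h).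
  unfold window. rewrite Rmult_assoc. apply Rmult_le_compat_l; [easy |].
  destruct Ho as [_ Ho]. specialize (Ho r t ltac:(lra) Ht). unfold weighted in *.
  pose proof (exp_pos (- p * t)) as E1. pose proof (exp_pos (- p * r)) as E2.
  apply Rle_trans with (exp (- p * r) * (exp (a * (t - r)) * d t));
    [apply Rmult_le_compat_l; lra |].
  assert (E3 : exp (- p * r) * exp (a * (t - r)) <= exp ((a + p) * h) * exp (- p * t)).
  { rewrite <- !exp_plus.
    destruct (Req_dec (- p * r + a * (t - r)) ((a + p) * h + - p * t)) as [-> | Hne];
      [lra | left; apply exp_increasing].
    assert (0 <= (a + p) * (h - (t - r))) by (apply Rmult_le_pos; lra). lra. }
  assert (Hd : 0 <= d t).
  { apply (Rmult_le_reg_l (exp (- p * t))); [easy |]. lra. }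
  apply (Rmult_le_compat_r (d t)) in E3; [| easy]. lra. }
split; [easy |].
destruct (mean_value W2 W (t - h) t) as [r [Hr He]]; [lra | intros; apply HW2 |].
replace (t - (t - h)) with h in He by ring.
pose proof (HWi (t - h) r ltac:(lra) ltac:(lra)). pose proof (HWi r t ltac:(lra) Ht).
replace (h * W t - W2 t + W2 (t - h)) with (h * (W t - W r)) by lra.
split; [apply Rmult_le_pos; lra | apply Rmult_le_compat_l; lra].
Qed.

Lemma slope_nonneg : 0 <= slope.
Proof. apply Rmax_r. Qed.

Definition energy_max : R := 1 + delay_factor * slope * window + delay_gain * delay_factor * (h * window).

Lemma window_nonneg : 0 <= window.
Proof. unfold window. apply Rmult_le_pos; [easy | left; apply exp_pos]. Qed.

Lemma energy_max_pos : 0 < energy_max.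
Proof.
unfold energy_max. pose proof slope_nonneg. pose proof delay_factor_range. pose proof delay_gain_pos.
pose proof window_nonneg.
assert (0 <= delay_factor * slope * window) by (apply Rmult_le_pos; [apply Rmult_le_pos |]; lra).
assert (0 <= delay_gain * delay_factor * (h * window)) by (apply Rmult_le_pos; apply Rmult_le_pos; lra). lra.
Qed.

Lemma energy_bounds (T : R) (d W W2 : R -> R) (t : R) : primitives d W W2 ->
  ordered T d -> t <= T ->
  contraction * weighted d t <= energy d W W2 t <= energy_max * weighted d t.
Proof.
intros HW Ho Ht.
destruct (neutral_bounds T d t Ho Ht) as [N1 N2].
destruct (window_bounds T d W W2 t HW Ho Ht) as [[W1 W3] [W4 W5]].
pose proof slope_nonneg as Hs. pose proof delay_factor_range as Hx. pose proof delay_gain_pos as Hq.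
assert (A1 : 0 <= delay_factor * slope) by (apply Rmult_le_pos; lra).
assert (A2 : 0 <= delay_gain * delay_factor) by (apply Rmult_le_pos; lra).
unfold energy, energy_max. split.
- assert (0 <= delay_factor * slope * (W t - W (t - h))) by now apply Rmult_le_pos.
  assert (0 <= delay_gain * delay_factor * (h * W t - W2 t + W2 (t - h))) by now apply Rmult_le_pos. lra.
- apply (Rmult_le_compat_l (delay_factor * slope)) in W3; [| easy].
  apply (Rmult_le_compat_l (delay_gain * delay_factor)) in W5; [| easy]. lra.
Qed.

Lemma root_derivative : char_fun' p = (2 * p - c) * (1 - delay_factor) - delay_gain * delay_factor * h.
Proof.
unfold char_fun'. fold delay_factor. replace (p * p - c * p) with (- delay_gain) by (rewrite <- root_eq; ring).
replace (b * h * exp (- p * h)) with (delay_factor * h) by (unfold delay_factor; ring). ring.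
Qed.

Lemma source_cases :
  (c - 2 * p <= 0 /\ (forall d t, source d t = - char_fun' p * weighted d t)) \/
  (0 < c - 2 * p /\ (forall d t, source d t =
     (c - 2 * p) * (exp (- p * t) * (d t - b * d (t - h))) + delay_gain * delay_factor * h * weighted d t)).
Proof.
unfold source, slope. destruct (Rle_or_lt (c - 2 * p) 0) as [H | H]; [left | right];
  (split; [easy |]); intros d t.
- rewrite Rmax_left by lra. rewrite root_derivative.
  assert (E := weighted_delay d t).
  transitivity (exp (- p * t) * ((c - 2 * p) * d t) - (c - 2 * p) * (delay_factor * weighted d (t - h))
    + delay_factor * (2 * p - c) * weighted d t - (2 * p - c) * (delay_factor * weighted d (t - h))
    + delay_gain * delay_factor * h * weighted d t); [rewrite E at 1; ring |].
  unfold weighted at 2. unfold weighted. ring.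
- rewrite Rmax_right by lra. ring.
Qed.

Definition source_max : R := - char_fun' p + Rabs (c - 2 * p) + delay_gain * delay_factor * h + 1.

Lemma source_bounds (T : R) (d : R -> R) (t : R) : ordered T d -> t <= T ->
  0 <= source d t <= source_max * weighted d t.
Proof.
intros Ho Ht. destruct (neutral_bounds T d t Ho Ht) as [N1 N2].
pose proof (weighted_nonneg T d t Ho Ht) as Hw.
pose proof contraction_pos as Hg.
assert (Hqx : 0 <= delay_gain * delay_factor * h).
{ pose proof delay_factor_range. pose proof delay_gain_pos. apply Rmult_le_pos; [apply Rmult_le_pos |]; lra. }
pose proof (Rabs_pos (c - 2 * p)) as Ha0.
assert (P1 : 0 <= - char_fun' p * weighted d t) by (apply Rmult_le_pos; lra).
assert (P2 : 0 <= Rabs (c - 2 * p) * weighted d t) by (apply Rmult_le_pos; lra).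
assert (P3 : 0 <= delay_gain * delay_factor * h * weighted d t) by now apply Rmult_le_pos.
assert (P4 : 0 <= contraction * weighted d t) by (apply Rmult_le_pos; lra).
unfold source_max. destruct source_cases as [[_ HS] | [Hk HS]]; rewrite HS.
- lra.
- rewrite (Rabs_pos_eq (c - 2 * p)) in * by lra.
  set (V := exp (- p * t) * (d t - b * d (t - h))) in *.
  assert (0 <= (c - 2 * p) * V) by (apply Rmult_le_pos; lra).
  assert ((c - 2 * p) * V <= (c - 2 * p) * weighted d t) by (apply Rmult_le_compat_l; lra).
  lra.
Qed.

(** The source vanishes exactly when [p] is a double root. *)
Lemma source_dichotomy :
  (exists s0, 0 < s0 /\ forall T d t, ordered T d -> t <= T -> s0 * weighted d t <= source d t)
  \/ (forall d t, source d t = 0).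
Proof.
pose proof contraction_pos as Hg.
destruct source_cases as [[_ HS] | [Hk HS]].
- destruct (Rle_lt_or_eq_dec _ _ Hlead) as [H | H].
  + left. exists (- char_fun' p). split; [lra |]. intros T d t Ho Ht. rewrite HS. lra.
  + right. intros d t. rewrite HS, H. ring.
- left. exists ((c - 2 * p) * contraction). split; [now apply Rmult_lt_0_compat |].
  intros T d t Ho Ht. rewrite HS.
  destruct (neutral_bounds T d t Ho Ht) as [N1 _].
  pose proof (weighted_nonneg T d t Ho Ht) as Hw.
  assert (Hqx : 0 <= delay_gain * delay_factor * h).
  { pose proof delay_factor_range. pose proof delay_gain_pos. apply Rmult_le_pos; [apply Rmult_le_pos |]; lra. }
  assert (0 <= delay_gain * delay_factor * h * weighted d t) by now apply Rmult_le_pos.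
  apply (Rmult_le_compat_l (c - 2 * p)) in N1; lra.
Qed.

(** Fronts are of the order of [envelope e t * exp (p t)] near [-oo], with [e = 0] at a
    simple root and [e = 1] at a double one. *)
Definition envelope (e t : R) : R := 1 - e * t.

(** At a simple root the source is comparable to [w], so in [E' = flux + source] a lower
    bound of the flux keeps [E] bounded towards [-oo], and a negative upper bound keeps it
    away from [0], since it would otherwise become negative. At a double
    root [E' = flux], and [E] grows linearly towards [-oo]. *)
Lemma energy_envelope : exists e, 0 <= e <= 1 /\
  (forall C T d d1 W W2, 0 < C -> primitives d W W2 -> (forall u, is_derive d u (d1 u)) ->
    ordered T d -> T <= 0 -> (forall t, t <= T -> - C <= flux d d1 W t) ->
    exists B, 0 < B /\ forall t, t <= T -> weighted d t <= B * envelope e t) /\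
  (forall eta T d d1 W W2, 0 < eta -> primitives d W W2 -> (forall u, is_derive d u (d1 u)) ->
    ordered T d -> T <= 0 -> (forall t, t <= T -> flux d d1 W t <= - eta) ->
    exists k T', 0 < k /\ T' <= T /\ forall t, t <= T' -> k * envelope e t <= weighted d t).
Proof.
pose proof contraction_pos as Hg.  pose proof energy_max_pos as HE.
assert (Hfromw : forall T d W W2 t, primitives d W W2 -> ordered T d -> t <= T ->
  0 <= energy d W W2 t /\ weighted d t <= / contraction * energy d W W2 t /\
  / energy_max * energy d W W2 t <= weighted d t).
{ intros T d W W2 t HW Ho Ht. destruct (energy_bounds T d W W2 t HW Ho Ht) as [E1 E2].
  pose proof (weighted_nonneg T d t Ho Ht) as Hw.
  split; [| split].
  - assert (0 <= contraction * weighted d t) by (apply Rmult_le_pos; lra). lra.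
  - apply (Rmult_le_reg_l contraction); [easy |]. rewrite <- Rmult_assoc, Rinv_r, Rmult_1_l; lra.
  - apply (Rmult_le_reg_l energy_max); [easy |].
    rewrite <- Rmult_assoc, Rinv_r, Rmult_1_l; lra. }
pose proof (Rinv_0_lt_compat _ Hg) as Hgi. pose proof (Rinv_0_lt_compat _ HE) as HEi.
destruct source_dichotomy as [[s0 [Hs0 HS]] | HS].
- exists 0. split; [lra | split].
  + intros C T d d1 W W2 HC HW Hd Ho HT Hf.
    set (s1 := s0 * / energy_max). assert (Hs1 : 0 < s1) by now apply Rmult_lt_0_compat.
    set (B := Rmax (energy d W W2 T) (C / s1)).
    assert (HBC : C <= s1 * B).
    { apply Rle_trans with (s1 * (C / s1)); [right; field; lra |].
      apply Rmult_le_compat_l; [lra | apply Rmax_r]. }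
    assert (HB : 0 < B).
    { eapply Rlt_le_trans; [| apply Rmax_r]. now apply Rdiv_lt_0_compat. }
    exists (/ contraction * B). split; [now apply Rmult_lt_0_compat |]. intros t Ht.
    unfold envelope. rewrite Rmult_0_l, Rminus_0_r, Rmult_1_r.
    destruct (Hfromw T d W W2 t HW Ho Ht) as [_ [E2 _]].
    eapply Rle_trans; [exact E2 |]. apply Rmult_le_compat_l; [lra |].
    cut (0 <= B - energy d W W2 t); [lra |].
    apply (backward_nonneg_left (fun u => B - energy d W W2 u)
      (fun u => 0 - (flux d d1 W u + source d u)) s1 T); [| | | easy].
    * intros u _. apply is_derive_sub; [apply is_derive_cst |].
      now apply energy_derive.
    * intros u Hu. specialize (Hf u Hu). specialize (HS T d u Ho Hu).
      destruct (Hfromw T d W W2 u HW Ho Hu) as [_ [_ E3]].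
      apply (Rmult_le_compat_l s0) in E3; [| lra]. rewrite <- Rmult_assoc in E3.
      fold s1 in E3. lra.
    * unfold B. pose proof (Rmax_l (energy d W W2 T) (C / s1)). lra.
  + intros eta T d d1 W W2 Heta HW Hd Ho HT Hf.
    set (C3 := source_max * / contraction + 1).
    assert (HC3 : 0 < C3).
    { unfold C3, source_max. pose proof delay_factor_range. pose proof delay_gain_pos.
      assert (0 <= delay_gain * delay_factor * h) by (apply Rmult_le_pos; [apply Rmult_le_pos |]; lra).
      pose proof (Rabs_pos (c - 2 * p)).
      assert (0 <= (- char_fun' p + Rabs (c - 2 * p) + delay_gain * delay_factor * h + 1) * / contraction)
        by (apply Rmult_le_pos; lra). lra. }
    assert (Hm1 : exp (- C3) < 1) by (rewrite <- exp_0; apply exp_increasing; lra).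
    set (k := eta / C3 * (1 - exp (- C3))).
    assert (HeC : 0 < eta / C3) by now apply Rdiv_lt_0_compat.
    assert (Hk : 0 < k) by (apply Rmult_lt_0_compat; lra).
    exists (/ energy_max * k), (T - 1).
    split; [now apply Rmult_lt_0_compat |]. split; [lra |]. intros t Ht.
    unfold envelope. rewrite Rmult_0_l, Rminus_0_r, Rmult_1_r.
    destruct (Hfromw T d W W2 t HW Ho ltac:(lra)) as [_ [_ E3]].
    eapply Rle_trans; [| exact E3]. apply Rmult_le_compat_l; [lra |].
    assert (G := exp_growth (fun u => eta / C3 - energy d W W2 u)
      (fun u => 0 - (flux d d1 W u + source d u)) C3 t T ltac:(lra)
      (fun u _ => is_derive_sub _ _ _ _ _ (is_derive_cst _ u) (energy_derive d d1 W W2 u HW Hd))).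
    cbv beta in G.
    assert (G' : (eta / C3 - energy d W W2 t) * exp (C3 * (T - t)) <= eta / C3).
    { destruct (Hfromw T d W W2 T HW Ho ltac:(lra)) as [E0 _].
      eapply Rle_trans; [apply G |]; [| lra]. intros u Hu.
      specialize (Hf u ltac:(lra)).
      destruct (source_bounds T d u Ho ltac:(lra)) as [_ S2].
      destruct (Hfromw T d W W2 u HW Ho ltac:(lra)) as [Eu [E2 _]].
      assert (Hsm : 0 <= source_max).
      { unfold source_max. pose proof delay_factor_range. pose proof delay_gain_pos.
        assert (0 <= delay_gain * delay_factor * h) by (apply Rmult_le_pos; [apply Rmult_le_pos |]; lra).
        pose proof (Rabs_pos (c - 2 * p)). lra. }
      apply (Rmult_le_compat_l source_max) in E2; [| easy]. rewrite <- Rmult_assoc in E2.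
      replace (C3 * (eta / C3 - energy d W W2 u)) with (eta - C3 * energy d W W2 u)
        by (field; lra).
      unfold C3. lra. }
    assert (Hexp : exp (- C3) * exp (C3 * (T - t)) >= 1).
    { rewrite <- exp_plus. pose proof (exp_ineq1_le (- C3 + C3 * (T - t))). nra. }
    pose proof (exp_pos (C3 * (T - t))) as He.
    unfold k. set (y := exp (C3 * (T - t))) in *.
    apply (Rmult_le_reg_r y); [easy |].
    assert (eta / C3 <= eta / C3 * (exp (- C3) * y)) by nra. lra.
- exists 1. split; [lra | split].
  + intros C T d d1 W W2 HC HW Hd Ho HT Hf.
    set (B := Rabs (energy d W W2 T) + C).
    assert (HB : 0 < B) by (unfold B; pose proof (Rabs_pos (energy d W W2 T)); lra).
    exists (/ contraction * B). split; [now apply Rmult_lt_0_compat |]. intros t Ht.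
    destruct (Hfromw T d W W2 t HW Ho Ht) as [_ [E2 _]].
    eapply Rle_trans; [exact E2 |]. rewrite Rmult_assoc.
    apply Rmult_le_compat_l; [lra |]. unfold envelope.
    assert (G := derive_nonneg_incr (fun u => energy d W W2 u + C * u)
      (fun u => flux d d1 W u + source d u + (0 * u + C * 1)) t T Ht
      (fun u _ => is_derive_add _ _ _ _ _ (energy_derive d d1 W W2 u HW Hd)
        (is_derive_mul _ _ _ _ _ (is_derive_cst C u) (is_derive_var u)))).
    cbv beta in G.
    assert (G' : energy d W W2 t + C * t <= energy d W W2 T + C * T).
    { apply G. intros u Hu. rewrite HS. specialize (Hf u ltac:(lra)). lra. }
    pose proof (Rle_abs (energy d W W2 T)) as HA. pose proof (Rabs_pos (energy d W W2 T)).
    unfold B. nra.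
  + intros eta T d d1 W W2 Heta HW Hd Ho HT Hf.
    exists (/ energy_max * (eta / 2)), (2 * T - 1).
    split; [apply Rmult_lt_0_compat; lra |]. split; [lra |]. intros t Ht.
    destruct (Hfromw T d W W2 t HW Ho ltac:(lra)) as [_ [_ E3]].
    eapply Rle_trans; [| exact E3]. rewrite Rmult_assoc.
    apply Rmult_le_compat_l; [lra |]. unfold envelope.
    assert (G := derive_nonneg_incr (fun u => - (energy d W W2 u + eta * u))
      (fun u => - (flux d d1 W u + source d u + (0 * u + eta * 1))) t T ltac:(lra)
      (fun u _ => is_derive_neg _ _ _ (is_derive_add _ _ _ _ _ (energy_derive d d1 W W2 u HW Hd)
        (is_derive_mul _ _ _ _ _ (is_derive_cst eta u) (is_derive_var u))))).
    cbv beta in G.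
    assert (G' : - (energy d W W2 t + eta * t) <= - (energy d W W2 T + eta * T)).
    { apply G. intros u Hu. rewrite HS. specialize (Hf u ltac:(lra)). lra. }
    destruct (Hfromw T d W W2 T HW Ho ltac:(lra)) as [E0 _]. nra.
Qed.
(** ** The leading coefficient of a front *)

Lemma primitives_exist (d : R -> R) : (forall t, continuous d t) ->
  exists W W2, primitives d W W2.
Proof.
intros Hd.
assert (HW : forall t, is_derive (fun x => RInt (weighted d) 0 x) t (weighted d t)).
{ apply is_derive_primitive. intros t.
  apply (continuous_mult (fun t => exp (- p * t)) d); [| apply Hd].
  exact (is_derive_cont _ _ _ (is_derive_exp_lin (- p) t)). }
exists (fun x => RInt (weighted d) 0 x).
exists (fun x => RInt (fun y => RInt (weighted d) 0 y) 0 x). split; [exact HW |].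
apply is_derive_primitive. intros t. exact (is_derive_cont _ _ _ (HW t)).
Qed.

(** The number [- C] is the limit of the flux at [-oo]. *)
Definition leading (phi J : R -> R) (C : R) : Prop :=
  0 < C /\ exists W W2, primitives phi W W2 /\
  (forall t, - C <= flux phi (fun u => J u - a * phi u) W t) /\
  (forall eps, 0 < eps -> exists T, forall t, t <= T ->
    flux phi (fun u => J u - a * phi u) W t <= - C + eps).

Lemma increasing_ordered (phi : R -> R) (T : R) :
  increasing_fun phi -> (forall t, 0 < phi t) -> ordered T phi.
Proof.
intros Hi Hpos. split; [intros t _; left; apply Hpos |]. intros s t Hst _.
specialize (Hi s t Hst). specialize (Hpos t).
pose proof (exp_ineq1_le (a * (t - s))). assert (0 <= a * (t - s)) by nra. nra.
Qed.

Lemma profile_flux_derive (phi J g W W2 : R -> R) (t : R) :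
  step J phi g J -> primitives phi W W2 ->
  is_derive (flux phi (fun u => J u - a * phi u) W) t
    (exp (- p * t) * (phi t * phi (t - h))).
Proof.
intros H HW.
pose proof (step_phi _ _ _ _ H) as Hphi. pose proof (step_K _ _ _ _ H) as HK.
eapply is_derive_rewrite.
- apply (flux_derive phi (fun u => J u - a * phi u)
    (fun u => (zeta * J u - g u) - a * (J u - a * phi u)) W W2 t HW Hphi).
  intros u. eapply is_derive_rewrite; [derive | cbv beta; ring].
- cbv beta. f_equal.
  assert (E := step_g _ _ _ _ H t). unfold reaction, beta, zeta in *.
  transitivity (a * (a + c) * (phi t - b * phi (t - h)) - (g t - b * g (t - h)) + phi t);
    [ring |]. rewrite E. ring.
Qed.

(** The flux increases strictly to [0], so only finiteness of its limit at [-oo] is at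
    issue, that is, integrability of [w phi_h]. For small [phi] the pair of [E] and [- flux]
    grows slower than [exp (- nu t)] towards [-oo], whatever [nu > 0]; hence
    [phi <= K exp ((p - nu) t)], which is enough. *)
Lemma leading_exists (phi J g : R -> R) : front_profile phi J g -> exists C, leading phi J C.
Proof.
intros [HS Hi Hpos Hsmall].
pose proof (step_phi _ _ _ _ HS) as Hphi. pose proof (step_range _ _ _ _ HS) as Hr.
destruct (primitives_exist phi) as [W [W2 HW]].
{ intros t. exact (is_derive_cont _ _ _ (Hphi t)). }
set (Z := flux phi (fun u => J u - a * phi u) W) in *.
assert (HZd : forall t, is_derive Z t (exp (- p * t) * (phi t * phi (t - h))))
  by (intros t; now apply (profile_flux_derive phi J g W W2)).
assert (Hsrc : forall t, 0 < exp (- p * t) * (phi t * phi (t - h))).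
{ intros t. apply Rmult_lt_0_compat; [apply exp_pos |]. now apply Rmult_lt_0_compat. }
assert (HZi : increasing_fun Z).
{ intros s t Hst. apply (derive_nonneg_incr Z _ s t Hst (fun u _ => HZd u)).
  intros u _. left. apply Hsrc. }
destruct (step_K_bounded _ _ _ _ HS) as [N HN].
assert (HN0 : 0 <= N) by (pose proof (HN 0); pose proof (Rabs_pos (J 0)); lra).
pose proof delay_factor_range as Hx. pose proof delay_gain_pos as Hq. pose proof root_lt_speed as Hpc.
assert (HWi : forall s t, s <= t -> W s <= W t).
{ intros s t Hst. apply (derive_nonneg_incr W (weighted phi)); [easy | intros; apply HW |].
  intros u _. apply Rmult_le_pos; [left; apply exp_pos | left; apply Hpos]. }
(* At [+oo] the weight kills the flux. *)
assert (HZup : forall t, Z t <= 2 * (N + a) * exp (- p * t)).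
{ intros t. unfold Z, flux.
  pose proof (HN t) as N1. pose proof (HN (t - h)) as N2.
  apply Rabs_le_between in N1. apply Rabs_le_between in N2.
  pose proof (Hr t) as R1. pose proof (Hr (t - h)) as R2.
  pose proof (Hi (t - h) t ltac:(lra)) as Hi1.
  assert (P1 : 0 <= delay_gain * delay_factor * (W t - W (t - h))).
  { apply Rmult_le_pos; [apply Rmult_le_pos; lra |].
    specialize (HWi (t - h) t ltac:(lra)). lra. }
  assert (P2 : 0 <= (c - p) * (phi t - b * phi (t - h))) by (apply Rmult_le_pos; nra).
  pose proof (exp_pos (- p * t)) as E.
  assert (P5 : b * - J (t - h) <= 1 * N) by (apply Rle_trans with (b * N); nra).
  assert (P6 : b * (a * phi (t - h)) <= 1 * a) by (apply Rmult_le_compat; nra).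
  assert (P7 : 0 <= a * phi t) by (apply Rmult_le_pos; lra).
  assert (P3 : J t - a * phi t - b * (J (t - h) - a * phi (t - h)) <= 2 * (N + a)) by lra.
  assert (P4 : exp (- p * t) * (J t - a * phi t - b * (J (t - h) - a * phi (t - h)) -
    (c - p) * (phi t - b * phi (t - h))) <= exp (- p * t) * (2 * (N + a)))
    by (apply Rmult_le_compat_l; lra).
  lra. }
assert (HZ0 : forall t, Z t <= 0).
{ intros t. destruct (Rle_or_lt (Z t) 0) as [H | H]; [easy | exfalso].
  destruct (exp_decay_below p (Z t / (2 * (N + a))) Hp) as [L [_ HL]].
  { apply Rdiv_lt_0_compat; lra. }
  pose proof (Rmax_l L t) as M1. pose proof (Rmax_r L t) as M2.
  specialize (HL (Rmax L t) M1). specialize (HZi t (Rmax L t) M2).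
  specialize (HZup (Rmax L t)).
  apply (Rmult_lt_compat_l (2 * (N + a))) in HL; [| lra].
  replace (2 * (N + a) * (Z t / (2 * (N + a)))) with (Z t) in HL by (field; lra). lra. }
assert (HZneg : forall t, Z t < 0).
{ intros t. destruct (mean_value Z (fun u => exp (- p * u) * (phi u * phi (u - h))) t (t + 1))
    as [r [_ He]]; [lra | intros; apply HZd |].
  specialize (Hsrc r). specialize (HZ0 (t + 1)). lra. }
(* A first crude exponential rate, close enough to [p] to make the nonlinear term
   integrable against the weight. *)
pose proof contraction_pos as Hg.
set (nu := p / 4). assert (Hnu : 0 < nu) by (unfold nu; lra).
destruct (Hsmall (contraction * (nu * nu))) as [T HT].
{ apply Rmult_lt_0_compat; [easy | now apply Rmult_lt_0_compat]. }
assert (Ho := increasing_ordered phi T Hi Hpos).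
set (E := energy phi W W2) in *.
assert (HE : forall t, t <= T -> contraction * weighted phi t <= E t)
  by (intros t Ht; apply (energy_bounds T phi W W2 t HW Ho Ht)).
set (f := fun t => - Z t + nu * E t).
assert (Hf : forall t, t <= T -> f t <= f T * exp (nu * (T - t))).
{ intros t Ht.
  assert (G := exp_growth f (fun u => - (exp (- p * u) * (phi u * phi (u - h)))
    + (0 * E u + nu * (Z u + source phi u))) (- nu) t T Ht).
  assert (G' : f t * exp (- nu * (T - t)) <= f T).
  { apply G; intros u Hu.
    - unfold f. apply is_derive_add; [apply is_derive_neg, HZd |].
      apply is_derive_mul; [apply is_derive_cst |]. now apply energy_derive.
    - unfold f. specialize (HE u ltac:(lra)).
      destruct (source_bounds T phi u Ho ltac:(lra)) as [S1 _].
      pose proof (weighted_nonneg T phi u Ho ltac:(lra)) as Hwu.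
      assert (Hph : phi (u - h) <= contraction * (nu * nu)) by (apply HT; lra).
      replace (exp (- p * u) * (phi u * phi (u - h))) with (weighted phi u * phi (u - h))
        by (unfold weighted; ring).
      assert (Q1 : weighted phi u * phi (u - h) <= weighted phi u * (contraction * (nu * nu)))
        by now apply Rmult_le_compat_l.
      assert (Q2 : nu * nu * (contraction * weighted phi u) <= nu * nu * E u)
        by (apply Rmult_le_compat_l; nra).
      assert (Q3 : 0 <= nu * source phi u) by (apply Rmult_le_pos; lra). lra. }
  apply (Rmult_le_reg_r (exp (- nu * (T - t)))); [apply exp_pos |].
  rewrite Rmult_assoc, <- exp_plus.
  replace (nu * (T - t) + - nu * (T - t)) with 0 by ring. rewrite exp_0. lra. }
set (K := / (contraction * nu) * (f T * exp (nu * T))).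
assert (HK : forall t, t <= T -> weighted phi t <= K * exp (- nu * t)).
{ intros t Ht. specialize (Hf t Ht). specialize (HE t Ht).
  replace (nu * (T - t)) with (nu * T + - nu * t) in Hf by ring. rewrite exp_plus in Hf.
  assert (Q : nu * (contraction * weighted phi t) <= f t).
  { unfold f. specialize (HZ0 t).
    assert (nu * (contraction * weighted phi t) <= nu * E t) by (apply Rmult_le_compat_l; lra). lra. }
  apply (Rmult_le_reg_l (contraction * nu)); [now apply Rmult_lt_0_compat |].
  unfold K. rewrite <- Rmult_assoc.
  replace (contraction * nu * (/ (contraction * nu) * (f T * exp (nu * T)))) with (f T * exp (nu * T))
    by (field; lra).
  lra. }
assert (Hrate : forall t, t <= T ->
  exp (- p * t) * (phi t * phi (t - h)) <= K * K * exp (p / 2 * t)).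
{ intros t Ht. specialize (HK t Ht).
  pose proof (weighted_nonneg T phi t Ho Ht) as Hwt.
  assert (Q1 : weighted phi t * weighted phi t <= (K * exp (- nu * t)) * (K * exp (- nu * t)))
    by (apply Rmult_le_compat; lra).
  apply (Rmult_le_compat_r (exp (p * t))) in Q1; [| left; apply exp_pos].
  replace (K * exp (- nu * t) * (K * exp (- nu * t)) * exp (p * t)) with
    (K * K * (exp (- nu * t) * exp (- nu * t) * exp (p * t))) in Q1 by ring.
  rewrite <- !exp_plus in Q1.
  replace (- nu * t + - nu * t + p * t) with (p / 2 * t) in Q1 by (unfold nu; field).
  eapply Rle_trans; [| exact Q1]. unfold weighted.
  replace (exp (- p * t) * phi t * (exp (- p * t) * phi t) * exp (p * t)) with
    (exp (- p * t) * (phi t * phi t) * (exp (- p * t) * exp (p * t))) by ring.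
  rewrite <- exp_plus. replace (- p * t + p * t) with 0 by ring. rewrite exp_0, Rmult_1_r.
  apply Rmult_le_compat_l; [left; apply exp_pos |].
  apply Rmult_le_compat_l; [left; apply Hpos | apply Hi; lra]. }
set (M := - Z T + 2 * (K * K) / p * exp (p / 2 * T)).
assert (HKp : 0 <= 2 * (K * K) / p).
{ apply Rdiv_le_0_compat; [| easy]. pose proof (Rle_0_sqr K). unfold Rsqr in *. lra. }
assert (HZlow : forall t, - M <= Z t).
{ assert (Hl : forall t, t <= T -> - M <= Z t).
  { intros t Ht.
    assert (G := derive_nonneg_incr
      (fun u => - Z u + 2 * (K * K) / p * exp (p / 2 * u))
      (fun u => - (exp (- p * u) * (phi u * phi (u - h))) +
        (0 * exp (p / 2 * u) + 2 * (K * K) / p * (p / 2 * exp (p / 2 * u)))) t T Ht).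
    assert (G' : - Z t + 2 * (K * K) / p * exp (p / 2 * t) <= M).
    { apply G; intros u Hu.
      - apply is_derive_add; [apply is_derive_neg, HZd |].
        apply (is_derive_mul (fun _ => 2 * (K * K) / p) (fun u => exp (p / 2 * u)));
          [apply is_derive_cst | apply is_derive_exp_lin].
      - specialize (Hrate u ltac:(lra)).
        replace (2 * (K * K) / p * (p / 2 * exp (p / 2 * u))) with
          (K * K * exp (p / 2 * u)) by (field; lra). lra. }
    pose proof (exp_pos (p / 2 * t)).
    assert (0 <= 2 * (K * K) / p * exp (p / 2 * t)) by (apply Rmult_le_pos; lra). lra. }
  intros t. destruct (Rle_or_lt t T) as [Ht | Ht]; [now apply Hl |].
  specialize (Hl T ltac:(lra)). specialize (HZi T t ltac:(lra)). lra. }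
destruct (increasing_lim_m Z (- M) HZi HZlow) as [l [Hl1 Hl2]].
exists (- l). split.
- specialize (Hl2 0). specialize (HZneg 0). lra.
- exists W, W2. split; [easy |]. rewrite Ropp_involutive. split; [exact Hl2 |].
  intros eps He. apply is_lim_spec in Hl1. destruct (Hl1 (mkposreal eps He)) as [T' HT'].
  exists (T' - 1). intros t Ht. specialize (HT' t ltac:(lra)). simpl in HT'.
  apply Rabs_lt_between in HT'. fold Z. lra.
Qed.

Lemma weighted_shift (d : R -> R) (s t : R) :
  weighted (fun u => d (u + s)) t = exp (p * s) * weighted d (t + s).
Proof.
unfold weighted. rewrite <- Rmult_assoc, <- exp_plus. f_equal. f_equal. ring.
Qed.

Lemma leading_shift (phi J : R -> R) (C s : R) : leading phi J C ->
  leading (fun t => phi (t + s)) (fun t => J (t + s)) (exp (p * s) * C).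
Proof.
intros [HC [W [W2 [[HW HW2] [Hl Hu]]]]].
pose proof (exp_pos (p * s)) as Hs.
assert (E : forall t,
  flux (fun t => phi (t + s)) (fun u => J (u + s) - a * phi (u + s))
    (fun t => exp (p * s) * W (t + s)) t
  = exp (p * s) * flux phi (fun u => J u - a * phi u) W (t + s)).
{ intros t. unfold flux. replace (t - h + s) with (t + s - h) by ring.
  replace (exp (- p * t)) with (exp (p * s) * exp (- p * (t + s)))
    by (rewrite <- exp_plus; f_equal; ring). ring. }
split; [now apply Rmult_lt_0_compat |].
exists (fun t => exp (p * s) * W (t + s)), (fun t => exp (p * s) * W2 (t + s)).
split; [| split].
- split; intros t.
  + rewrite weighted_shift. eapply is_derive_rewrite; [derive | cbv beta; ring].
  + eapply is_derive_rewrite; [derive | cbv beta; ring].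
- intros t. rewrite E. specialize (Hl (t + s)).
  apply (Rmult_le_compat_l (exp (p * s))) in Hl; lra.
- intros eps He. destruct (Hu (eps / exp (p * s))) as [T HT].
  { now apply Rdiv_lt_0_compat. }
  exists (T - s). intros t Ht. rewrite E. specialize (HT (t + s) ltac:(lra)).
  apply (Rmult_le_compat_l (exp (p * s))) in HT; [| lra].
  replace (exp (p * s) * (- C + eps / exp (p * s))) with (- (exp (p * s) * C) + eps) in HT
    by (field; lra). exact HT.
Qed.

(** ** Uniqueness *)

Lemma step_g_upper (phi J g : R -> R) : front_profile phi J g ->
  forall t, g t <= (beta + 1) / (1 - b) * phi t.
Proof.
intros [HS Hi Hpos _] T. set (G := (beta + 1) / (1 - b)).
pose proof beta_pos as Hbeta. pose proof (step_range _ _ _ _ HS) as Hr.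
assert (HG : G * (1 - b) = beta + 1) by (unfold G; field; lra).
assert (HG0 : 0 < G) by (unfold G; apply Rdiv_lt_0_compat; lra).
destruct (step_g_bounded _ _ _ _ HS) as [M HM].
cut (0 <= G * phi T - g T); [lra |].
apply (delay_nonneg b h T M (fun u => G * phi u - g u) Hb Hh); [| | apply Rle_refl];
  intros u _.
- specialize (HM u). apply Rabs_le_between in HM. specialize (Hpos u).
  assert (0 <= G * phi u) by (apply Rmult_le_pos; lra). lra.
- assert (E := step_g _ _ _ _ HS u).
  destruct (reaction_increasing_bounds phi u Hi Hr) as [_ HR].
  pose proof (Hi (u - h) u ltac:(lra)) as Hi1.
  assert (G * (b * phi (u - h)) <= G * (b * phi u)).
  { apply Rmult_le_compat_l; [lra |]. apply Rmult_le_compat_l; lra. }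
  assert (G * phi u - G * (b * phi u) = (beta + 1) * phi u) by (rewrite <- HG; ring). lra.
Qed.

(** The decisive step: a strict multiple of a front lying below another one in the
    order can be enlarged. Near [+oo] the concavity of the reaction leaves room
    uniformly; near [-oo] the room comes from the gap between the fluxes. *)
Lemma improve_multiple (phi J g psi Jp gp : R -> R) (C Cp theta : R) :
  front_profile phi J g -> front_profile psi Jp gp ->
  leading phi J C -> leading psi Jp Cp -> C <= Cp ->
  0 <= theta < 1 -> (forall t, theta * J t <= Jp t) ->
  exists eta, 0 < eta /\ forall t, (theta + eta) * J t <= Jp t.
Proof.
intros Fphi Fpsi [HC [W [W2 [HW [HZl HZu]]]]] [HCp [V [V2 [HV [HYl HYu]]]]] HCC Hth HJ.
assert (Hgup := step_g_upper phi J g Fphi).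
destruct Fphi as [HS Hi Hpos Hsm]. destruct Fpsi as [HSp Hip Hposp Hsmp].
pose proof beta_pos as Hbeta. pose proof zeta_pos as Hzeta.
pose proof (step_phi _ _ _ _ HS) as Dphi. pose proof (step_phi _ _ _ _ HSp) as Dpsi.
pose proof (step_range _ _ _ _ HS) as Rphi. pose proof (step_range _ _ _ _ HSp) as Rpsi.
set (d := fun t => psi t - theta * phi t).
set (Jd := fun t => Jp t - theta * J t).
set (gd := fun t => gp t - theta * g t).
assert (Hd : forall t, is_derive d t (Jd t - a * d t)).
{ intros t. unfold d, Jd. eapply is_derive_rewrite; [derive | cbv beta; ring]. }
assert (HJd : forall t, is_derive Jd t (zeta * Jd t - gd t)).
{ intros t. unfold Jd, gd. pose proof (step_K _ _ _ _ HS). pose proof (step_K _ _ _ _ HSp).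
  eapply is_derive_rewrite; [derive | cbv beta; ring]. }
assert (Ho : forall T, ordered T d).
{ intros T. apply (order_harnack d (fun u => Jd u - a * d u) T 1); intros u Hu.
  - apply Hd.
  - specialize (HJ u). unfold Jd. lra.
  - unfold d. specialize (Rphi u). specialize (Rpsi u). nra. }
assert (Hd0 : forall t, 0 <= d t) by (intros t; apply (Ho t), Rle_refl).
assert (Hdh : forall t, d (t - h) <= exp (a * h) * d t).
{ intros t. destruct (Ho t) as [_ H]. specialize (H (t - h) t ltac:(lra) ltac:(lra)).
  now replace (t - (t - h)) with h in H by ring. }
assert (Hgdeq : forall t, gd t - b * gd (t - h) = reaction psi t - theta * reaction phi t).
{ intros t. unfold gd. rewrite <- (step_g _ _ _ _ HS), <- (step_g _ _ _ _ HSp). ring. }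
assert (Hgain : forall t, theta * (1 - theta) * (phi t * phi (t - h)) <=
  reaction psi t - theta * reaction phi t).
{ intros t. unfold reaction. apply reaction_gain; try apply Rphi; try apply Rpsi.
  - lra.
  - apply Hd0.
  - apply Hdh. }
assert (Hgain0 : forall t, 0 <= theta * (1 - theta) * (phi t * phi (t - h))).
{ intros t. apply Rmult_le_pos; [nra |]. apply Rmult_le_pos; left; apply Hpos. }
destruct (step_g_bounded _ _ _ _ HS) as [G HG].
destruct (step_g_bounded _ _ _ _ HSp) as [Gp HGp].
assert (HGd : forall t, - (Gp + G) <= gd t).
{ intros t. unfold gd. specialize (HG t). specialize (HGp t).
  apply Rabs_le_between in HG. apply Rabs_le_between in HGp. nra. }
assert (Hgd0 : forall t, 0 <= gd t).
{ intros t. apply (delay_nonneg b h t (Gp + G) gd Hb Hh); [| | apply Rle_refl]; intros u _.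
  - apply HGd.
  - rewrite Hgdeq. specialize (Hgain u). specialize (Hgain0 u). lra. }
(* On [t >= T], [d] is produced at a positive rate: for [theta > 0] by concavity, for
   [theta = 0] because [d = psi]. *)
assert (Hright : forall T, exists k, 0 < k /\ forall t, T <= t -> k <= Jd t).
{ intros T.
  assert (Hgam : exists k, 0 < k /\ forall t, T <= t -> k <= gd t).
  { destruct (Rle_lt_or_eq_dec 0 theta (proj1 Hth)) as [H0 | H0].
    - exists (theta * (1 - theta) * (phi T * phi (T - h))). split.
      + repeat apply Rmult_lt_0_compat; try apply Hpos; lra.
      + intros t Ht. specialize (Hgdeq t). specialize (Hgain t). specialize (Hgd0 (t - h)).
        assert (phi T * phi (T - h) <= phi t * phi (t - h)).
        { apply Rmult_le_compat; try (left; apply Hpos); apply Hi; lra. }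
        assert (theta * (1 - theta) * (phi T * phi (T - h)) <=
          theta * (1 - theta) * (phi t * phi (t - h))) by (apply Rmult_le_compat_l; nra).
        assert (0 <= b * gd (t - h)) by (apply Rmult_le_pos; lra). lra.
    - exists (beta * (1 - b) * psi T). split.
      + apply Rmult_lt_0_compat; [apply Rmult_lt_0_compat; lra | apply Hposp].
      + intros t Ht. specialize (Hgdeq t). rewrite <- H0 in Hgdeq. specialize (Hgd0 (t - h)).
        destruct (reaction_increasing_bounds psi t Hip Rpsi) as [H1 _].
        pose proof (Hip T t Ht) as H2.
        assert (beta * (1 - b) * psi T <= beta * (1 - b) * psi t)
          by (apply Rmult_le_compat_l; [apply Rmult_le_pos |]; lra).
        assert (0 <= b * gd (t - h)) by (apply Rmult_le_pos; lra). lra. }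
  destruct Hgam as [k [Hk Hkg]].
  exists (k / zeta). split; [now apply Rdiv_lt_0_compat |]. intros t Ht.
  cut (0 <= Jd t - k / zeta); [lra |].
  apply (backward_nonneg (fun u => Jd u - k / zeta) (fun u => (zeta * Jd u - gd u) - 0)
    zeta T (k / zeta) Hzeta); [| | | easy]; intros u Hu.
  - apply is_derive_sub; [apply HJd | apply is_derive_cst].
  - specialize (Hkg u Hu). replace (zeta * (Jd u - k / zeta)) with (zeta * Jd u - k)
      by (field; lra). lra.
  - specialize (HJ u). unfold Jd. lra. }
(* Near [-oo], [phi] is at most, and [d] at least, of the order of
   [envelope e t * exp (p t)]. *)
destruct energy_envelope as [e [He [Hup Hlow]]].
assert (Hleft : exists T k B, T <= 0 /\ 0 < k /\ 0 < B /\
  (forall t, t <= T -> weighted phi t <= B * envelope e t) /\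
  (forall t, t <= T -> k * envelope e t <= weighted d t) /\
  (forall t, t <= T -> beta * d t <= gd t)).
(* [flux psi - theta flux phi <= - Cp + eta + theta C <= - eta] near [-oo]. *)
{ set (eta := (1 - theta) * Cp / 2).
  assert (Heta : 0 < eta) by (unfold eta; assert (0 < (1 - theta) * Cp)
    by (apply Rmult_lt_0_compat; lra); lra).
  destruct (HYu eta Heta) as [T1 HT1].
  pose proof (Rmin_l T1 0) as L1. pose proof (Rmin_r T1 0) as L2.
  destruct (Hlow eta (Rmin T1 0) d (fun u => Jd u - a * d u) (fun u => V u - theta * W u)
    (fun u => V2 u - theta * W2 u)) as [k [T2 [Hk [HT2 Hkd]]]]; try easy.
  { destruct HW as [HW HW']. destruct HV as [HV HV']. split; intros t.
    - unfold d. eapply is_derive_rewrite; [derive | unfold weighted; ring].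
    - eapply is_derive_rewrite; [derive | cbv beta; ring]. }
  { intros t Ht. specialize (HT1 t ltac:(lra)). specialize (HZl t).
    apply Rle_trans with (flux psi (fun u => Jp u - a * psi u) V t
      - theta * flux phi (fun u => J u - a * phi u) W t);
      [right; unfold flux, d, Jd; ring |].
    apply (Rmult_le_compat_l theta) in HZl; [| lra].
    assert (theta * C <= theta * Cp) by (apply Rmult_le_compat_l; lra).
    unfold eta in *. lra. }
  destruct (Hup C T2 phi (fun u => J u - a * phi u) W W2 HC HW Dphi) as [B [HB HBd]].
  { now apply increasing_ordered. }
  { lra. }
  { intros t _. apply HZl. }
  pose proof (exp_pos (a * h)) as HE.
  destruct (Hsm (/ (2 * exp (a * h)))) as [T3 HT3]; [apply Rinv_0_lt_compat; lra |].
  destruct (Hsmp (1 / 2)) as [T4 HT4]; [lra |].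
  set (T := Rmin T2 (Rmin T3 T4)).
  assert (HT : T <= T2 /\ T <= T3 /\ T <= T4).
  { unfold T. pose proof (Rmin_l T2 (Rmin T3 T4)). pose proof (Rmin_r T2 (Rmin T3 T4)).
    pose proof (Rmin_l T3 T4). pose proof (Rmin_r T3 T4). lra. }
  exists T, k, B. split; [lra |]. split; [easy |]. split; [easy |].
  split; [intros t Ht; apply HBd; lra |]. split; [intros t Ht; apply Hkd; lra |].
  intros t Ht. cut (0 <= gd t - beta * d t); [lra |].
  apply (delay_nonneg b h T (Gp + G + beta) (fun u => gd u - beta * d u) Hb Hh);
    [| | easy]; intros u Hu.
  - specialize (HGd u). assert (beta * d u <= beta * 1); [| lra].
    apply Rmult_le_compat_l; [lra |]. unfold d. specialize (Rpsi u). specialize (Hpos u). nra.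
  - replace (gd u - beta * d u - b * (gd (u - h) - beta * d (u - h))) with
      ((gd u - b * gd (u - h)) - beta * (d u - b * d (u - h))) by ring.
    rewrite Hgdeq.
    replace (reaction psi u - theta * reaction phi u - beta * (d u - b * d (u - h))) with
      (d u * (1 - psi (u - h)) - theta * phi u * d (u - h)
        + theta * (1 - theta) * (phi u * phi (u - h))) by (unfold reaction, d; ring).
    specialize (HT3 u ltac:(lra)). specialize (HT4 (u - h) ltac:(lra)).
    specialize (Hdh u). specialize (Hd0 u). specialize (Hgain0 u). specialize (Hpos u).
    assert (Q1 : theta * phi u * d (u - h) <= theta * phi u * (exp (a * h) * d u))
      by (apply Rmult_le_compat_l; [apply Rmult_le_pos; lra | easy]).
    assert (Q2 : phi u * exp (a * h) <= 1 / 2).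
    { apply (Rmult_le_compat_r (exp (a * h))) in HT3; [| lra].
      replace (/ (2 * exp (a * h)) * exp (a * h)) with (1 / 2) in HT3 by (field; lra). lra. }
    assert (Q3 : theta * (phi u * exp (a * h)) <= 1 / 2).
    { assert (0 <= phi u * exp (a * h)) by (apply Rmult_le_pos; lra). nra. }
    assert (Q4 : theta * (phi u * exp (a * h)) * d u <= 1 / 2 * d u)
      by (apply Rmult_le_compat_r; lra).
    assert (Q5 : d u * (1 / 2) <= d u * (1 - psi (u - h)))
      by (apply Rmult_le_compat_l; lra).
    lra. }
destruct Hleft as [T [k [B [HT0 [Hk [HB [HBphi [Hkd Hgdd]]]]]]]].
assert (Henv : forall t, t <= T -> 1 <= envelope e t)
  by (intros t Ht; unfold envelope; nra).
set (Y := fun t => envelope e t * exp (p * t)).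
assert (HY : forall t, is_derive Y t ((p * envelope e t - e) * exp (p * t))).
{ intros t. unfold Y, envelope. auto_derive; [easy | ring]. }
assert (HYpos : forall t, t <= T -> 0 < Y t).
{ intros t Ht. apply Rmult_lt_0_compat; [specialize (Henv t Ht); lra | apply exp_pos]. }
assert (Hunw : forall f t, f t = weighted f t * exp (p * t)).
{ intros f t. unfold weighted. rewrite (Rmult_comm (exp (- p * t))), Rmult_assoc, <- exp_plus.
  replace (- p * t + p * t) with 0 by ring. rewrite exp_0. ring. }
destruct (increasing_step_nonneg J phi g HS Hi) as [_ HJ0].
(* The same orders of magnitude are passed from [phi] and [d] to [J] and [Jd]. *)
assert (HJup : exists B2, 0 < B2 /\ forall t, t <= T -> J t <= B2 * Y t).
{ set (G0 := (beta + 1) / (1 - b)) in *.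
  assert (HG0 : 0 < G0) by (unfold G0; apply Rdiv_lt_0_compat; lra).
  pose proof root_lt_speed as Hpc. assert (Hzp : 0 < zeta - p) by (unfold zeta; lra).
  set (B2 := G0 * B / (zeta - p) + J T / Y T).
  assert (HB1 : 0 < G0 * B / (zeta - p)).
  { apply Rdiv_lt_0_compat; [now apply Rmult_lt_0_compat | easy]. }
  pose proof (HYpos T ltac:(lra)) as HYT.
  assert (HB3 : 0 <= J T / Y T) by now apply Rdiv_le_0_compat.
  exists B2. split; [unfold B2; lra |]. intros t Ht.
  cut (0 <= B2 * Y t - J t); [lra |].
  apply (backward_nonneg_left (fun u => B2 * Y u - J u)
    (fun u => (0 * Y u + B2 * ((p * envelope e u - e) * exp (p * u))) - (zeta * J u - g u))
    zeta T); [| | | easy].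
  - intros u _. apply is_derive_sub; [| apply (step_K _ _ _ _ HS)].
    apply is_derive_mul; [apply is_derive_cst | apply HY].
  - intros u Hu. specialize (HBphi u Hu). specialize (Hgup u).
    pose proof (exp_pos (p * u)) as Eu. specialize (HYpos u Hu).
    assert (Q1 : phi u <= B * Y u).
    { rewrite (Hunw phi u). unfold Y. rewrite <- Rmult_assoc.
      apply Rmult_le_compat_r; [lra | easy]. }
    assert (Q2 : G0 * phi u <= G0 * (B * Y u)) by (apply Rmult_le_compat_l; lra).
    assert (Q3 : G0 * B <= B2 * (zeta - p)).
    { apply Rle_trans with (G0 * B / (zeta - p) * (zeta - p)); [right; field; lra |].
      apply Rmult_le_compat_r; unfold B2; lra. }
    assert (Q4 : G0 * B * Y u <= B2 * (zeta - p) * Y u) by (apply Rmult_le_compat_r; lra).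
    assert (Q5 : 0 <= B2 * (e * exp (p * u))).
    { apply Rmult_le_pos; [unfold B2; lra | apply Rmult_le_pos; lra]. }
    replace ((p * envelope e u - e) * exp (p * u)) with (p * Y u - e * exp (p * u))
      by (unfold Y; ring). lra.
  - unfold B2. replace ((G0 * B / (zeta - p) + J T / Y T) * Y T - J T) with
      (G0 * B / (zeta - p) * Y T) by (field; lra). apply Rmult_le_pos; lra. }
destruct HJup as [B2 [HB2 HJB2]].
destruct (Hright T) as [kr [Hkr Hkrd]].
assert (HJlow : exists k2, 0 < k2 /\ forall t, t <= T -> k2 * Y t <= Jd t).
{ pose proof (HYpos T ltac:(lra)) as HYT.
  set (k2 := Rmin (beta * k / (zeta + 1)) (kr / Y T)).
  assert (Hk2 : 0 < k2).
  { unfold k2. apply Rmin_glb_lt; apply Rdiv_lt_0_compat; try lra.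
    now apply Rmult_lt_0_compat. }
  exists k2. split; [easy |]. intros t Ht.
  cut (0 <= Jd t - k2 * Y t); [lra |].
  apply (backward_nonneg_left (fun u => Jd u - k2 * Y u)
    (fun u => (zeta * Jd u - gd u) - (0 * Y u + k2 * ((p * envelope e u - e) * exp (p * u))))
    zeta T); [| | | easy].
  - intros u _. apply is_derive_sub; [apply HJd |].
    apply is_derive_mul; [apply is_derive_cst | apply HY].
  - intros u Hu. specialize (Hkd u Hu). specialize (Hgdd u Hu).
    pose proof (exp_pos (p * u)) as Eu. specialize (HYpos u Hu). specialize (Henv u Hu).
    assert (Q1 : k * Y u <= d u).
    { rewrite (Hunw d u). unfold Y. rewrite <- Rmult_assoc.
      apply Rmult_le_compat_r; [lra | easy]. }
    assert (Q2 : beta * (k * Y u) <= beta * d u) by (apply Rmult_le_compat_l; lra).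
    assert (Q3 : k2 * (zeta + 1) <= beta * k).
    { apply Rle_trans with (beta * k / (zeta + 1) * (zeta + 1)); [| right; field; lra].
      apply Rmult_le_compat_r; [lra | apply Rmin_l]. }
    assert (Q4 : k2 * (zeta + 1) * Y u <= beta * k * Y u) by (apply Rmult_le_compat_r; lra).
    assert (Q5 : k2 * (e * exp (p * u)) <= k2 * Y u).
    { apply Rmult_le_compat_l; [lra |]. unfold Y. apply Rmult_le_compat_r; lra. }
    assert (Q6 : 0 <= k2 * (p * Y u)) by (apply Rmult_le_pos; [lra | apply Rmult_le_pos; lra]).
    replace ((p * envelope e u - e) * exp (p * u)) with (p * Y u - e * exp (p * u))
      by (unfold Y; ring). lra.
  - specialize (Hkrd T ltac:(lra)).
    assert (k2 * Y T <= kr / Y T * Y T)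
      by (apply Rmult_le_compat_r; [lra | apply Rmin_r]).
    replace (kr / Y T * Y T) with kr in H by (field; lra). lra. }
destruct HJlow as [k2 [Hk2 HJk2]].
destruct (step_K_bounded _ _ _ _ HS) as [N HN].
assert (HN0 : 0 <= N) by (pose proof (HN 0); pose proof (Rabs_pos (J 0)); lra).
exists (Rmin (k2 / B2) (kr / (N + 1))). split.
{ apply Rmin_glb_lt; apply Rdiv_lt_0_compat; lra. }
intros t. cut (Rmin (k2 / B2) (kr / (N + 1)) * J t <= Jd t); [unfold Jd; lra |].
specialize (HJ0 t).
destruct (Rle_or_lt t T) as [Ht | Ht].
- apply Rle_trans with (k2 / B2 * (B2 * Y t)).
  + apply Rmult_le_compat; [| easy | apply Rmin_l | now apply HJB2].
    left. apply Rmin_glb_lt; apply Rdiv_lt_0_compat; lra.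
  + replace (k2 / B2 * (B2 * Y t)) with (k2 * Y t) by (field; lra). now apply HJk2.
- apply Rle_trans with (kr / (N + 1) * (N + 1)).
  + specialize (HN t). apply Rabs_le_between in HN.
    apply Rmult_le_compat; [| easy | apply Rmin_r | lra].
    left. apply Rmin_glb_lt; apply Rdiv_lt_0_compat; lra.
  + replace (kr / (N + 1) * (N + 1)) with kr by (field; lra). apply Hkrd. lra.
Qed.

(** The set of admissible multiples is closed, so its supremum [theta] is admissible;
    [improve_multiple] then gives [theta = 1]. *)
Lemma leading_compare (phi J g psi Jp gp : R -> R) (C Cp : R) :
  front_profile phi J g -> front_profile psi Jp gp ->
  leading phi J C -> leading psi Jp Cp -> C <= Cp -> forall t, phi t <= psi t.
Proof.
intros Fphi Fpsi LC LCp HCC.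
destruct (increasing_step_nonneg Jp psi gp (fp_step _ _ _ Fpsi) (fp_increasing _ _ _ Fpsi))
  as [_ HJp0].
set (S := fun theta => 0 <= theta <= 1 /\ forall t, theta * J t <= Jp t).
destruct (completeness S) as [theta [Hub Hlub]].
{ exists 1. intros y [Hy _]. lra. }
{ exists 0. split; [lra |]. intros t. rewrite Rmult_0_l. apply HJp0. }
assert (H0 : 0 <= theta).
{ apply Hub. split; [lra |]. intros t. rewrite Rmult_0_l. apply HJp0. }
assert (H1 : theta <= 1) by (apply Hlub; intros y [Hy _]; lra).
destruct (increasing_step_nonneg J phi g (fp_step _ _ _ Fphi) (fp_increasing _ _ _ Fphi))
  as [_ HJ0].
assert (HSt : forall t, theta * J t <= Jp t).
{ intros t. specialize (HJ0 t). destruct (Rle_lt_or_eq_dec _ _ HJ0) as [Hpos | Hz].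
  - assert (Ht : theta <= Jp t / J t).
    { apply Hlub. intros y [_ Hy]. specialize (Hy t).
      apply (Rmult_le_reg_r (J t)); [easy |].
      replace (Jp t / J t * J t) with (Jp t) by (field; lra). easy. }
    apply (Rmult_le_compat_r (J t)) in Ht; [| lra].
    replace (Jp t / J t * J t) with (Jp t) in Ht by (field; lra). easy.
  - rewrite <- Hz, Rmult_0_r. apply HJp0. }
assert (Hone : theta = 1).
{ destruct (Rle_lt_or_eq_dec _ _ H1) as [Hlt | He]; [exfalso | easy].
  destruct (improve_multiple phi J g psi Jp gp C Cp theta Fphi Fpsi LC LCp HCC
    ltac:(lra) HSt) as [eta [Heta Himp]].
  pose proof (Rmin_l (theta + eta) 1) as M1. pose proof (Rmin_r (theta + eta) 1) as M2.
  assert (HM : theta < Rmin (theta + eta) 1) by (apply Rmin_glb_lt; lra).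
  assert (Rmin (theta + eta) 1 <= theta); [| lra].
  apply Hub. split; [lra |]. intros t. eapply Rle_trans; [| apply (Himp t)].
  apply Rmult_le_compat_r; [apply HJ0 | easy]. }
destruct (step_le _ _ _ _ _ _ _ _ (fp_step _ _ _ Fpsi) (fp_step _ _ _ Fphi)) as [Hle _];
  [| exact Hle].
intros t. specialize (HSt t). rewrite Hone in HSt. lra.
Qed.

Lemma front_profile_shift (phi J g : R -> R) (s : R) : front_profile phi J g ->
  front_profile (fun t => phi (t + s)) (fun t => J (t + s)) (fun t => g (t + s)).
Proof.
intros [HS Hi Hpos Hsm]. split.
- now apply step_shift.
- intros u v Huv. apply Hi. lra.
- intros t. apply Hpos.
- intros eps He. destruct (Hsm eps He) as [T HT]. exists (T - s). intros t Ht.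
  apply HT. lra.
Qed.

Lemma front_unique (tau : R) (phi psi : R -> R) : h = c * tau ->
  monotone_front b tau c phi -> monotone_front b tau c psi ->
  exists s, forall t, psi t = phi (t + s).
Proof.
intros Htau Hphi Hpsi.
destruct (front_is_fixed_point tau phi Htau Hphi) as [J [g F]].
destruct (front_is_fixed_point tau psi Htau Hpsi) as [Jp [gp Fp]].
destruct (leading_exists phi J g F) as [C LC].
destruct (leading_exists psi Jp gp Fp) as [Cp LCp].
assert (HC : 0 < C) by apply LC. assert (HCp : 0 < Cp) by apply LCp.
set (s := ln (Cp / C) / p).
assert (Hs : exp (p * s) * C = Cp).
{ unfold s. replace (p * (ln (Cp / C) / p)) with (ln (Cp / C)) by (field; lra).
  rewrite exp_ln by now apply Rdiv_lt_0_compat. field. lra. }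
assert (LS := leading_shift phi J C s LC). rewrite Hs in LS.
assert (FS := front_profile_shift phi J g s F).
exists s. intros t. apply Rle_antisym.
- exact (leading_compare _ _ _ _ _ _ Cp Cp Fp FS LCp LS (Rle_refl _) t).
- exact (leading_compare _ _ _ _ _ _ Cp Cp FS Fp LS LCp (Rle_refl _) t).
Qed.

End Leading.

End Profile.

Theorem theorem7 (b : R) (hb : 0 <= b < 1) (tau c : R) (hD : frakD b tau c) :
  (exists phi : R -> R, monotone_front b tau c phi) /\
  (forall phi psi : R -> R,
     monotone_front b tau c phi -> monotone_front b tau c psi ->
     exists s : R, forall t : R, psi t = phi (t + s)).
Proof.
destruct hD as [Htau [Hc0 [[z0 [Hz0 [Hd0 H0]]] [z1 [Hz1 [Hd1 H1]]]]]].
assert (Hden : forall z, chi_den b tau c z = 1 - b * exp (- z * (c * tau))).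
{ intros z. unfold chi_den. now rewrite Rmult_assoc. }
unfold chi0, chi1 in H0, H1. rewrite Hden in *.
assert (Hc : 0 < c).
{ destruct (Rle_lt_or_eq_dec _ _ Hc0) as [H | H]; [easy | exfalso]. subst c.
  replace (- z0 * (0 * tau)) with 0 in H0 by ring. rewrite exp_0, Rmult_0_l in H0.
  assert (0 < 1 / (1 - b * 1)) by (apply Rdiv_lt_0_compat; lra).
  assert (0 < z0 ^ 2) by (apply pow_lt; easy). lra. }
set (h := c * tau) in *. set (a := - z1).
assert (Hh : 0 <= h) by (apply Rmult_le_pos; easy).
assert (Ha : 0 < a) by (unfold a; lra).
replace (- z1 * c * tau) with (a * h) in H1 by (unfold a, h; ring). fold a in Hd1, H1.
assert (Hchar : beta c a * (1 - b * exp (a * h)) = exp (a * h)).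
{ unfold beta, zeta. replace (a * (a + c)) with (z1 ^ 2 - c * z1) by (unfold a; ring).
  replace (z1 ^ 2 - c * z1) with (exp (a * h) / (1 - b * exp (a * h))) by lra.
  field. exact Hd1. }
assert (Hroot0 : char_fun b h c z0 = 0).
{ unfold char_fun. replace (z0 * z0 - c * z0) with (- (1 / (1 - b * exp (- z0 * h)))) by lra.
  field. exact Hd0. }
destruct (leading_root b h c hb Hh z0 Hz0 Hroot0) as [p [Hp [Hroot Hlead]]].
split.
- exact (front_exists b h c a hb Hh Hc Ha Hchar tau p eq_refl Hp Hroot Hlead).
- intros phi psi.
  exact (front_unique b h c a hb Hh Hc Ha Hchar p Hp Hroot Hlead tau phi psi eq_refl).
Qed.
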